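(* Let $A_2$ be a unital von Neumann subalgebra of a von Neumann algebra $A_1$, and suppose there exists a faithful normal conditional expectation $\epsilon:A_1\to A_2$. Let $\phi_2$ be a faithful normal state on $A_2$ (even a semifinite weight will do). Let $\phi_1=\phi_2\circ\epsilon$, $\mathcal H_j=L^2(A_j,\phi_j)$, and let $\pi_j$ be the left regular representation of $A_j$ on $\mathcal H_j$ ($j=1,2$). Let $U$ be the natural isometric identification of $\mathcal H_2$ as a subspace of $\mathcal H_1$, so that $e=UU^*$ is the Jones projection. Then $$\mathcal E_{(A_2\subset A_1)}=(\pi_1(A_1)U,(\pi_1,\mathcal H_1),(\pi_2,\mathcal H_2))$$ is an example of a Hilbert von Neumann $A_1$-$A_2$ bimodule. Writing $E=\pi_1(A_1)U$, one has $[EE^*]=[\pi_1(A_1)e\pi_1(A_1)]$, so that the basic construction of Jones appears naturally in this context. Further, $\mathcal E_\epsilon\cong\mathcal E_{(A_2\subset A_1)}$, where $\mathcal E_\epsilon$ is the standard (Stinespring) bimodule associated with the normal completely positive map $\epsilon$.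
   Context: All Hilbert spaces are complex and separable. $[S]$ denotes the closure in the weak operator topology of the linear span of a set $S$ of operators. A Hilbert von Neumann $A_1$-$A_2$ bimodule is a tuple $(E,(\pi_1,\mathcal H_1),(\pi_2,\mathcal H_2))$ where $E\subset\mathcal L(\mathcal H_2,\mathcal H_1)$ satisfies $E=[E]\supset EE^*E$, $\pi_2:A_2\to[E^*E]$ is a normal isomorphism, and $\pi_1:A_1\to[EE^*]$ is a normal homomorphism with $\pi_1(1)$ the identity of $[EE^*]$. Two such bimodules are isomorphic ($\cong$) if there are unitaries $w_j:\mathcal H_j^{(1)}\to\mathcal H_j^{(2)}$, $j=1,2$, with $w_j\pi_j^{(1)}(a)=\pi_j^{(2)}(a)w_j$ for $a\in A_j$, such that $E^{(2)}=w_1E^{(1)}w_2^*$. For a unital normal completely positive map $\eta:A_1\to A_2$, the bimodule $\mathcal E_\eta=(E_\eta,(\pi_1,\mathcal H_1(\eta)),(\pi_2,\mathcal H_2(\eta)))$ is constructed as follows: $\mathcal H_2(\eta)=L^2(A_2,\phi)$ for a faithful normal state $\phi$ on $A_2$, with $\pi_2$ the left regular representation; $\mathcal H_1(\eta)$ is obtained by separation and completion of the algebraic tensor product $A_1\otimes A_2$ with respect to $\langle a_1\otimes a_2,b_1\otimes b_2\rangle=\phi(b_2^*\eta(b_1^*a_1)a_2)$; $\pi_1(a_1)(b_1\otimes b_2)=a_1b_1\otimes b_2$; $V:\mathcal H_2(\eta)\to\mathcal H_1(\eta)$ is the bounded operator with $V\hat a_2=1\otimes a_2$ (where $\hat a_2$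 is the image of $a_2\in A_2$ in $L^2(A_2,\phi)$); and $E_\eta=[\pi_1(A_1)V\pi_2(A_2)]$.
   Formalization: The bimodule (and the isomorphism) is stated for E = [π_1(A_1)U], the weakly closed span, instead of π_1(A_1)U, which need not be weakly closed: for A_2 = C, A_1 = L^∞[0,1] with the integral, π_1(A_1)U is L^∞[0,1] inside L^2[0,1], so E = [E] fails. *)

(* Defs.v *)
From HB Require Import structures.
From mathcomp Require Import all_boot all_order all_algebra.
From mathcomp Require Import all_classical all_reals all_analysis.
From mathcomp Require Import complex.
Set Implicit Arguments.
Unset Strict Implicit.
Unset Printing Implicit Defensive.
Import Order.TTheory GRing.Theory Num.Theory.
Import numFieldNormedType.Exports.
Local Open Scope classical_set_scope.
Local Open Scope ring_scope.
Local Open Scope complex_scope.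

(* Separable complex Hilbert spaces (all Hilbert spaces are separable here);
   the inner product is linear in its first argument.                        *)
HB.mixin Record isHilbert (R : realType) H of CompleteNormedModule R[i] H := {
  inner : H -> H -> R[i];
  inner_linear : forall (a : R[i]) (x y z : H),
    inner (a *: x + y) z = a * inner x z + inner y z;
  inner_conj : forall x y : H, inner y x = Num.conj (inner x y);
  inner_norm : forall x : H, `|x| ^+ 2 = inner x x;
  hilbert_separable : exists2 D : set H, countable D & dense D
}.

#[short(type="hilbertType")]
HB.structure Definition Hilbert (R : realType) :=
  {H of CompleteNormedModule R[i] H & isHilbert R H}.

Definition lspan (C : pzRingType) (V : lmodType C) (S : set V) : set V :=
  [set v | exists (n : nat) (c : 'I_n -> C) (s : 'I_n -> V),
     (forall i, S (s i)) /\ v = \sum_(i < n) c i *: s i].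

Definition linear_on (C : pzRingType) (V W : lmodType C) (N : set V)
    (f : V -> W) : Prop :=
  forall (c : C) (a b : V), N a -> N b -> f (c *: a + b) = c *: f a + f b.

Section Operators.
Variable R : realType.
Implicit Types H K : hilbertType R.

Definition bop H K : set (H -> K) := [set T | linear T /\ continuous T].

(* The unique bounded operator satisfying P, when there is one. *)
Definition the_bop H K (P : set (H -> K)) : H -> K :=
  xget (fun=> 0) (@bop H K `&` P).

Definition adj H K (T : H -> K) : K -> H :=
  the_bop [set S | forall x y, inner (T x) y = inner x (S y)].

(* [S]: the closure of the linear span of S in the weak operator topology of
   L(H, K), whose basic neighbourhoods of T are given by finitely many matrix
   coefficients.                                                             *)
Definition wspan H K (S : set (H -> K)) : set (H -> K) :=
  [set T | bop T /\ forall (s : seq (H * K)) (e : R[i]), 0 < e ->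
     exists2 T', lspan S T' &
       forall p, p \in s -> `|inner (T p.1) p.2 - inner (T' p.1) p.2| < e].

Definition setadj H K (E : set (H -> K)) : set (K -> H) := [set adj T | T in E].

Definition setcomp H K L (E : set (K -> L)) (F : set (H -> K)) : set (H -> L) :=
  [set S \o T | S in E & T in F].

Definition pos H (T : H -> H) : Prop := forall x, 0 <= inner (T x) x.

Definition ople H (S T : H -> H) : Prop :=
  forall x, inner (S x) x <= inner (T x) x.

Definition unitary H K (w : H -> K) : Prop :=
  [/\ linear w, forall x y, inner (w x) (w y) = inner x y & range w = setT].

Definition orth_projection H (M : set H) (p : H -> H) : Prop :=
  forall x, M (p x) /\ forall y, M y -> inner (x - p x) y = 0.

Definition von_neumann K (A : set (K -> K)) : Prop :=
  [/\ A id, forall a b, A a -> A b -> A (a \o b),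
      forall a, A a -> A (adj a) & wspan A = A].

Definition star_hom K H (A : set (K -> K)) (B : set (H -> H))
    (pi : (K -> K) -> (H -> H)) : Prop :=
  [/\ linear_on A pi, forall a, A a -> B (pi a),
      forall a b, A a -> A b -> pi (a \o b) = pi a \o pi b &
      forall a, A a -> pi (adj a) = adj (pi a)].

(* x is the supremum of D in B, for the order of operators. *)
Definition is_opsup H (B : set (H -> H)) (D : set (H -> H)) (x : H -> H) : Prop :=
  [/\ B x, forall d, D d -> ople d x &
      forall y, B y -> (forall d, D d -> ople d y) -> ople x y].

(* D, an upward directed set of positive elements of A, has supremum x in A;
   this is the range of a bounded increasing net with supremum x.            *)
Definition increases_to H (A : set (H -> H)) (D : set (H -> H)) (x : H -> H)
    : Prop :=
  [/\ D !=set0, forall d, D d -> A d /\ pos d,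
      forall a b, D a -> D b -> exists c, [/\ D c, ople a c & ople b c] &
      is_opsup A D x].

(* Normality of a positive linear map from A to B. *)
Definition normal_map K H (A : set (K -> K)) (B : set (H -> H))
    (eta : (K -> K) -> (H -> H)) : Prop :=
  forall D x, increases_to A D x -> is_opsup B (eta @` D) (eta x).

Definition cond_expectation K (A1 A2 : set (K -> K))
    (eps : (K -> K) -> (K -> K)) : Prop :=
  [/\ linear_on A1 eps,
      forall x, A1 x -> A2 (eps x),
      forall x, A1 x -> pos x -> pos (eps x),
      forall a, A2 a -> eps a = a &
      forall a x b, A2 a -> A1 x -> A2 b ->
        eps (a \o x \o b) = a \o eps x \o b].

Definition faithful_map K H (A : set (K -> K)) (eta : (K -> K) -> (H -> H)) : Prop :=
  forall x, A x -> pos x -> eta x = 0 -> x = 0.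

End Operators.

(* States and weights are treated in parallel: a state is a complex functional
   on A, a weight is a [0, +oo]-valued function on the positive part of A.     *)
Variant functional (R : realType) (K : hilbertType R) : Type :=
| State of ((K -> K) -> R[i])
| Weight of ((K -> K) -> \bar R).

Section Functionals.
Variables (R : realType) (K : hilbertType R).
Implicit Types (A : set (K -> K)) (f : (K -> K) -> R[i]) (w : (K -> K) -> \bar R).

Definition faithful_normal_state A f : Prop :=
  [/\ linear_on A (f : (K -> K) -> R[i]^o),
      forall a, A a -> pos a -> 0 <= f a,
      f id = 1,
      forall a, A a -> pos a -> f a = 0 -> a = 0 &
      forall D x, increases_to A D x ->
        (forall d, D d -> f d <= f x) /\
        forall m, (forall d, D d -> f d <= m) -> f x <= m].

Definition finite_pos A w : set (K -> K) :=
  [set a | [/\ A a, pos a & (w a < +oo)%E]].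

Definition faithful_normal_semifinite_weight A w : Prop :=
  [/\ [/\ forall a, A a -> pos a -> (0 <= w a)%E,
          forall a b, A a -> pos a -> A b -> pos b -> w (a + b) = (w a + w b)%E &
          forall (r : R) a, 0 <= r -> A a -> pos a ->
            w (r%:C *: a) = (r%:E * w a)%E],
      forall a, A a -> pos a -> w a = 0%E -> a = 0,
      forall D x, increases_to A D x -> w x = ereal_sup (w @` D) &
      wspan (finite_pos A w) = A].

Definition faithful_normal A (phi : functional K) : Prop :=
  match phi with
  | State f => faithful_normal_state A f
  | Weight w => faithful_normal_semifinite_weight A w
  end.

(* The left ideal n_phi = {a | phi (a^* a) < +oo}, which is A for a state. *)
Definition sq_integrable A (phi : functional K) : set (K -> K) :=
  match phi with
  | State _ => A
  | Weight w => [set a | A a /\ (w (adj a \o a) < +oo)%E]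
  end.

(* The complex value of phi: for a weight, its linear extension to
   m_phi = n_phi^* n_phi, the linear span of {a >= 0 | phi a < +oo}.  *)
Definition value A (phi : functional K) : (K -> K) -> R[i] :=
  match phi with
  | State f => f
  | Weight w => xget (fun=> 0)
      [set f : (K -> K) -> R[i] |
        linear_on (lspan (finite_pos A w)) (f : (K -> K) -> R[i]^o) /\
        forall a, finite_pos A w a -> f a = (fine (w a))%:C]
  end.

Definition comp_functional (phi : functional K) (eps : (K -> K) -> (K -> K)) :=
  match phi with
  | State f => State (f \o eps)
  | Weight w => Weight (w \o eps)
  end.

End Functionals.

Section Bimodules.
Variable R : realType.
Implicit Types K H : hilbertType R.

(* H is (a realization of) L^2(A, phi), with a |-> hat a the canonical map:
   the completion of n_phi for <a, b> = phi (b^* a). As for any completion, this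
   determines (H, hat) up to a unique unitary compatible with the maps hat.   *)
Definition is_L2 K (A : set (K -> K)) (phi : functional K) H
    (hat : (K -> K) -> H) : Prop :=
  [/\ linear_on (sq_integrable A phi) hat,
      forall a b, sq_integrable A phi a -> sq_integrable A phi b ->
        inner (hat a) (hat b) = value A phi (adj b \o a) &
      dense (hat @` sq_integrable A phi)].

Definition left_regular K (A : set (K -> K)) (phi : functional K) H
    (hat : (K -> K) -> H) (a : K -> K) : H -> H :=
  the_bop [set T | forall b, sq_integrable A phi b -> T (hat b) = hat (a \o b)].

(* The tuple (E, (pi_1, H_1), (pi_2, H_2)), for algebras A_j acting on K_j. *)
Record bimodule_data K1 K2 H1 H2 : Type := BimoduleData {
  bim_op : set (H2 -> H1);
  bim_rep1 : (K1 -> K1) -> (H1 -> H1);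
  bim_rep2 : (K2 -> K2) -> (H2 -> H2) }.

Definition hilbert_vN_bimodule K1 K2 H1 H2 (A1 : set (K1 -> K1))
    (A2 : set (K2 -> K2)) (X : bimodule_data K1 K2 H1 H2) : Prop :=
  let E := bim_op X in
  let pi1 := bim_rep1 X in
  let pi2 := bim_rep2 X in
  let EEs := wspan (setcomp E (setadj E)) in
  let EsE := wspan (setcomp (setadj E) E) in
  [/\ E = wspan E, setcomp (setcomp E (setadj E)) E `<=` E,
      [/\ star_hom A2 EsE pi2, set_bij A2 EsE pi2 & normal_map A2 EsE pi2] &
      [/\ star_hom A1 EEs pi1, normal_map A1 EEs pi1 &
          forall T, EEs T -> pi1 id \o T = T /\ T \o pi1 id = T]].

Definition bimodule_iso K1 K2 H1 H2 L1 L2 (A1 : set (K1 -> K1))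
    (A2 : set (K2 -> K2)) (X : bimodule_data K1 K2 H1 H2)
    (Y : bimodule_data K1 K2 L1 L2) : Prop :=
  exists (w1 : H1 -> L1) (w2 : H2 -> L2),
    [/\ unitary w1, unitary w2,
        forall a, A1 a -> w1 \o bim_rep1 X a = bim_rep1 Y a \o w1,
        forall a, A2 a -> w2 \o bim_rep2 X a = bim_rep2 Y a \o w2 &
        bim_op Y = [set w1 \o T \o adj w2 | T in bim_op X]].

(* H is (a realization of) H_1(eta), with tens a1 a2 the class of a1 (x) a2: the
   separation and completion of A1 (x) n_phi for
   <a1 (x) a2, b1 (x) b2> = phi (b2^* eta (b1^* a1) a2). *)
Definition is_stinespring_space K1 K2 (A1 : set (K1 -> K1)) (A2 : set (K2 -> K2))
    (eta : (K1 -> K1) -> (K2 -> K2)) (phi : functional K2) H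
    (tens : (K1 -> K1) -> (K2 -> K2) -> H) : Prop :=
  let N := sq_integrable A2 phi in
  [/\ forall b, N b -> linear_on A1 (tens ^~ b),
      forall a, A1 a -> linear_on N (tens a),
      forall a1 b1 a2 b2, A1 a1 -> A1 b1 -> N a2 -> N b2 ->
        inner (tens a1 a2) (tens b1 b2) =
        value A2 phi (adj b2 \o eta (adj b1 \o a1) \o a2) &
      dense (lspan [set tens a b | a in A1 & b in N])].

(* E_eta, built from realizations (H1, tens) of H_1(eta) and (H2, hat) of
   L^2(A2, phi).                                                          *)
Definition stinespring_bimodule K1 K2 (A1 : set (K1 -> K1))
    (A2 : set (K2 -> K2)) (phi : functional K2) H1 H2
    (tens : (K1 -> K1) -> (K2 -> K2) -> H1) (hat : (K2 -> K2) -> H2)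
    : bimodule_data K1 K2 H1 H2 :=
  let N := sq_integrable A2 phi in
  let pi1 := fun a : K1 -> K1 => the_bop [set T : H1 -> H1 |
    forall b1 b2, A1 b1 -> N b2 -> T (tens b1 b2) = tens (a \o b1) b2] in
  let pi2 := left_regular A2 phi hat in
  let V := the_bop [set T : H2 -> H1 |
    forall a2, N a2 -> T (hat a2) = tens id a2] in
  BimoduleData (wspan [set pi1 a \o V \o pi2 b | a in A1 & b in A2]) pi1 pi2.

(* The identification of L^2(A2, phi2) with a subspace of L^2(A1, phi1). *)
Definition L2_inclusion K (A2 : set (K -> K)) (phi2 : functional K) H1 H2
    (hat1 : (K -> K) -> H1) (hat2 : (K -> K) -> H2) : H2 -> H1 :=
  the_bop [set T | forall b, sq_integrable A2 phi2 b -> T (hat2 b) = hat1 b].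

End Bimodules.

(* Main.v *)
Require Import Defs.
From mathcomp Require Import all_boot all_order all_algebra.
From mathcomp Require Import all_classical all_reals all_analysis.
From mathcomp Require Import complex.
From mathcomp Require Import ring lra.
Set Implicit Arguments.
Unset Strict Implicit.
Unset Printing Implicit Defensive.
Import Order.TTheory GRing.Theory Num.Theory.
Import numFieldNormedType.Exports.
Local Open Scope classical_set_scope.
Local Open Scope ring_scope.
Local Open Scope complex_scope.

(** Write N1, N2 for the square-integrable elements of A1, A2, and hat1, hat2 for
    their maps into H1, H2.  The whole theorem comes out of one identity,
    U^* pi1(x) U = pi2(eps x) ([inclusion_eps]), which is the computation
    phi1(c^* x b) = phi2(c^* eps(x) b) for b, c in N2.  With pi1(b) U = U pi2(b) for
    b in A2 it gives, for E0 = pi1(A1) U and e = U U^*, the three products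
    E0^* E0 = pi2(A2), E0 E0^* = pi1(A1) e pi1(A1) and E0 E0^* E0 = E0; they pass to
    weak closures one factor at a time ([wspan_setcomp]).  Three points need an
    argument of another kind.

    The map pi2 must be onto the weak closure of E0^* E0, that is, pi2(A2) must be
    weakly closed ([rep_closed]).  Let rho be an injective normal representation
    of M, and T self-adjoint and small in the closure of rho(M).  Then
    T = 2G/(1+G^2) with G self-adjoint in the closure ([half_cayley]); if
    rho(a_n) -> G strongly with a_n self-adjoint, the elements 2 a_n/(1 + a_n^2) are
    bounded by 1 and their images converge strongly to T ([rep_closed_half]).  So it
    is enough to treat bounded sequences ([rep_seq_limit]), and there the convergence
    in M and the convergence of the images are equivalent, because a normal
    functional tends to 0 along a sequence of positive contractions as soon as a
    countable separating family of normal functionals does ([normal_vanish]).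

    The identity must lie in the closure of pi1(A1) e pi1(A1), so that pi1 takes its
    values in E E^*.  This *-algebra is nondegenerate, and the identity is weakly
    approximated by a nondegenerate *-algebra ([nondegenerate_id]).
    Nondegeneracy says that the vectors hat1(x b), x in N1 and b in N2, are total in
    H1; for a weight, b = 1 - (1 + k eps(x^* x))^-1 gives hat1(x b) -> hat1(x) as k grows
    ([hat_approx]).  The same totality makes the isometry tens a b |-> hat1(a b) of
    the Stinespring space into H1 onto, which is the isomorphism of the two
    bimodules ([stinespring_iso]).

    Third, the spaces and maps must exist.  Adjoints come from the Riesz theorem, U
    and the representations from extension by continuity, and the complex values of
    a weight from its linear extension ([value_weight]). *)

(** * Hilbert spaces through their real inner product *)

Section HilbertSpace.
Variables (R : realType) (H : hilbertType R).
Implicit Types (x y z : H) (r : R).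

Lemma innerDl x y z : inner (x + y) z = inner x z + inner y z.
Proof. by rewrite -{1}(scale1r x) inner_linear mul1r. Qed.

Lemma inner0l z : inner (0 : H) z = 0.
Proof. by apply: (addrI (inner (0 : H) z)); rewrite -innerDl !addr0. Qed.

Lemma innerZl (a : R[i]) x z : inner (a *: x) z = a * inner x z.
Proof. by rewrite -(addr0 (a *: x)) inner_linear inner0l addr0. Qed.

Lemma innerDr x y z : inner z (x + y) = inner z x + inner z y.
Proof. by rewrite inner_conj innerDl rmorphD /= -!inner_conj. Qed.

Lemma innerZr (a : R[i]) x z : inner z (a *: x) = Num.conj a * inner z x.
Proof. by rewrite inner_conj innerZl rmorphM /= -inner_conj. Qed.

Lemma inner0r z : inner z (0 : H) = 0.
Proof. by rewrite inner_conj inner0l rmorph0. Qed.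

Lemma innerNl x z : inner (- x) z = - inner x z.
Proof. by rewrite -scaleN1r innerZl mulN1r. Qed.

Lemma innerNr x z : inner z (- x) = - inner z x.
Proof. by rewrite -scaleN1r innerZr rmorphN1 mulN1r. Qed.

(** The real part of the inner product determines the inner product
    (lemma [inner_rin]) and keeps every estimate inside the ordered field R. *)
Definition rin x y : R := complex.Re (inner x y).
Definition nrm x : R := complex.Re `|x|.

Lemma rinDl x y z : rin (x + y) z = rin x z + rin y z.
Proof. by rewrite /rin innerDl raddfD. Qed.
Lemma rinDr x y z : rin z (x + y) = rin z x + rin z y.
Proof. by rewrite /rin innerDr raddfD. Qed.
Lemma rinNl x z : rin (- x) z = - rin x z.
Proof. by rewrite /rin innerNl raddfN. Qed.
Lemma rinNr x z : rin z (- x) = - rin z x.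
Proof. by rewrite /rin innerNr raddfN. Qed.
Lemma ReZ r (c : R[i]) : complex.Re (r%:C * c) = r * complex.Re c.
Proof. by case: c => a b /=; rewrite mul0r subr0. Qed.
Lemma conjC_real r : Num.conj r%:C = r%:C :> R[i].
Proof. by apply/eqP; rewrite eq_complex /= oppr0 !eqxx. Qed.
Lemma rinZl r x z : rin (r%:C *: x) z = r * rin x z.
Proof. by rewrite /rin innerZl ReZ. Qed.
Lemma rinZr r x z : rin z (r%:C *: x) = r * rin z x.
Proof. by rewrite /rin innerZr conjC_real ReZ. Qed.
Lemma rin0l z : rin 0 z = 0. Proof. by rewrite /rin inner0l. Qed.
Lemma rin0r z : rin z 0 = 0. Proof. by rewrite /rin inner0r. Qed.
Definition rinE := (rinDl, rinDr, rinNl, rinNr, rinZl, rinZr, rin0l, rin0r).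

Lemma conj_Re (c : R[i]) : complex.Re (Num.conj c) = complex.Re c.
Proof. by case: c. Qed.

Lemma rinC x y : rin x y = rin y x.
Proof. by rewrite /rin [inner x y]inner_conj conj_Re. Qed.

Lemma inner_rin x y : inner x y = rin x y +i* rin x ('i%C *: y).
Proof.
rewrite /rin innerZr; case: (inner x y) => a b /=.
by apply/eqP; rewrite eq_complex /= mul0r mulN1r opprK add0r !eqxx.
Qed.

Lemma nrmE x : `|x| = (nrm x)%:C.
Proof. by rewrite /nrm RRe_real // normr_real. Qed.

Lemma nrm_ge0 x : 0 <= nrm x.
Proof. by rewrite -ler0c -nrmE. Qed.

Lemma nrm_sqr x : nrm x ^+ 2 = rin x x.
Proof. by rewrite /rin -inner_norm nrmE -rmorphXn. Qed.

Lemma rin_ge0 x : 0 <= rin x x.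
Proof. by rewrite -nrm_sqr sqr_ge0. Qed.

Lemma inner_diag x : inner x x = (rin x x)%:C.
Proof. by rewrite -inner_norm nrmE -rmorphXn nrm_sqr. Qed.

Lemma nrm_eq0 x : nrm x = 0 -> x = 0.
Proof. by move=> h; apply/normr0_eq0; rewrite nrmE h. Qed.

Lemma rin_eq0 x : rin x x = 0 -> x = 0.
Proof. by move=> h; apply: nrm_eq0; apply/eqP; rewrite -(sqrf_eq0 (nrm x)) nrm_sqr h. Qed.

Lemma nrm0 : nrm 0 = 0. Proof. by rewrite /nrm normr0. Qed.
Lemma nrmN x : nrm (- x) = nrm x. Proof. by rewrite /nrm normrN. Qed.
Lemma nrmB x y : nrm (x - y) = nrm (y - x). Proof. by rewrite -nrmN opprB. Qed.
Lemma nrmD x y : nrm (x + y) <= nrm x + nrm y.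
Proof. by rewrite -lecR rmorphD /= -!nrmE ler_normD. Qed.
Lemma nrm_tri x y z : nrm (x - z) <= nrm (x - y) + nrm (y - z).
Proof. by rewrite (le_trans _ (nrmD _ _)) // addrA subrK. Qed.
Lemma nrmZ (a : R[i]) x : nrm (a *: x) = complex.Re `|a| * nrm x.
Proof. by rewrite /nrm normrZ nrmE -{1}(RRe_real (normr_real a)) ReZ. Qed.
Lemma nrmZr r x : nrm (r%:C *: x) = `|r| * nrm x.
Proof. by rewrite nrmZ normc_def /= expr0n addr0 sqrtr_sqr. Qed.

Lemma le_nrm x r : 0 <= r -> (nrm x <= r) = (rin x x <= r ^+ 2).
Proof. by move=> r0; rewrite -nrm_sqr ler_sqr ?nnegrE ?nrm_ge0. Qed.

(** Positivity of the square norm of x - (<x,y>/<y,y>) y. *)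
Lemma rin_CS x y : `|rin x y| <= nrm x * nrm y.
Proof.
have [y0|y0] := eqVneq (nrm y) 0.
  by rewrite (nrm_eq0 y0) rin0r normr0 nrm0 mulr0.
have hy : 0 < rin y y by rewrite -nrm_sqr exprn_gt0 // lt_def y0 nrm_ge0.
have := rin_ge0 (x - (rin x y / rin y y)%:C *: y).
rewrite !rinE (rinC y x).
have -> : rin x x + - (rin x y / rin y y * rin x y)
   + (- (rin x y / rin y y * rin x y) - - (rin x y / rin y y * (rin x y / rin y y * rin y y)))
   = rin x x - rin x y ^+ 2 / rin y y by field; exact: lt0r_neq0.
rewrite subr_ge0 ler_pdivrMr // -!nrm_sqr -exprMn => h.
by rewrite -[leRHS]ger0_norm ?mulr_ge0 ?nrm_ge0 // -ler_sqr ?nnegrE ?normr_ge0 // !real_normK ?num_real.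
Qed.

Lemma normc_le (c : R[i]) : `|c| <= (`|complex.Re c| + `|complex.Im c|)%:C.
Proof.
rewrite normc_def lecR -[leRHS]ger0_norm ?addr_ge0 ?normr_ge0 // -sqrtr_sqr.
apply: ler_wsqrtr; rewrite sqrrD !real_normK ?num_real // -addrA lerD2l lerDr.
by rewrite mulrn_wge0 // mulr_ge0.
Qed.

Lemma nrmi x : nrm ('i%C *: x) = nrm x.
Proof. by rewrite nrmZ normc_def /= expr0n expr1n add0r sqrtr1 mul1r. Qed.

Lemma nrm_rin_le x r : 0 <= r -> (forall y, rin x y <= r * nrm y) -> nrm x <= r.
Proof.
move=> r0 /(_ x); rewrite -nrm_sqr expr2; have [->//|n0] := eqVneq (nrm x) 0.
by rewrite ler_pM2r // lt_def n0 nrm_ge0.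
Qed.

Lemma rin_eqP x y : (forall z, rin x z = rin y z) -> x = y.
Proof.
move=> h; apply/eqP; rewrite -subr_eq0; apply/eqP/rin_eq0.
by rewrite rinDl rinNl h subrr.
Qed.

Lemma inner_eqP x y : (forall z, inner x z = inner y z) -> x = y.
Proof. by move=> h; apply: rin_eqP => z; rewrite /rin h. Qed.

Lemma nrm_small x : (forall e, 0 < e -> nrm x <= e) -> x = 0.
Proof.
move=> h; apply: nrm_eq0; apply/eqP; rewrite eq_le nrm_ge0 andbT.
by apply/ler_addgt0Pr => e e0; rewrite add0r h.
Qed.

Definition seq_cvg (u : nat -> H) (l : H) :=
  forall e : R, 0 < e -> exists N : nat, forall n, (N <= n)%N -> nrm (u n - l) < e.

Lemma real_of_pos (e : R[i]) : 0 < e -> exists2 r : R, 0 < r & e = r%:C.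
Proof.
case: e => a b; rewrite ltcE /= => /andP[/eqP -> a0]; by exists a.
Qed.

Lemma ball_nrm x r y : ball x r%:C y <-> nrm (x - y) < r.
Proof. by rewrite -ball_normE /= nrmE ltcR. Qed.

Lemma cauchy_seq_cvg (u : nat -> H) :
  (forall e : R, 0 < e -> exists N : nat, forall n m, (N <= n)%N -> (N <= m)%N ->
     nrm (u n - u m) < e) -> exists l, seq_cvg u l.
Proof.
move=> hu; have : cvg (u n @[n --> \oo]).
  apply/cauchy_cvgP/cauchy_exP => e' /real_of_pos[e e0 ->].
  have [N hN] := hu _ e0; exists (u N); exists N => // n /= Nn.
  by apply/ball_nrm; apply: hN.
move=> /cvg_ex[l hl]; exists l => e e0.
have he : 0 < e%:C :> R[i] by rewrite ltcR.
move/cvgrPdist_lt: hl => /(_ _ he)[N _ hN]; exists N => n Nn.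
by rewrite -ltcR -nrmE distrC; exact: hN.
Qed.

Lemma seq_cvg_uniq (u : nat -> H) l l' : seq_cvg u l -> seq_cvg u l' -> l = l'.
Proof.
move=> h h'; apply/eqP; rewrite -subr_eq0; apply/eqP/nrm_small => e e0.
have e2 : 0 < e / 2 by lra.
have [N hN] := h _ e2; have [M hM] := h' _ e2.
have := hN _ (leq_maxl N M); have := hM _ (leq_maxr N M).
have := nrm_tri l (u (maxn N M)) l'; rewrite (nrmB l (u _)); lra.
Qed.

Lemma closureP (S : set H) x :
  closure S x <-> forall e : R, 0 < e -> exists2 s, S s & nrm (x - s) < e.
Proof.
split=> [cS e e0|h B /nbhs_ballP[e' /= /real_of_pos[e e0 ->] hB]].
  have he : 0 < e%:C :> R[i] by rewrite ltcR.
  by have [s [Ss /ball_nrm hs]] := cS _ (nbhsx_ballx x _ he); exists s.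
by have [s Ss /ball_nrm hs] := h _ e0; exists s; split=> //; apply: hB.
Qed.

Lemma denseP (S : set H) :
  dense S <-> forall x (e : R), 0 < e -> exists2 s, S s & nrm (x - s) < e.
Proof.
split=> [dS x e e0|h O [x Ox] oO].
  apply: (closureP S x).1 e e0 => B /nbhs_interior Bx.
  have [|s [/interior_subset Bs Ss]] := dS (interior B) _ (open_interior B).
    by exists x; apply: nbhs_singleton.
  by exists s.
have := oO; rewrite openE => /(_ _ Ox); rewrite /interior.
move=> /nbhs_ballP[e' /= /real_of_pos[e e0 ->] hB].
by have [s Ss /ball_nrm hs] := h x _ e0; exists s; split=> //; apply: hB.
Qed.

Lemma separable_seq : exists q : nat -> H,
  forall x (e : R), 0 < e -> exists k, nrm (x - q k) < e.
Proof.
have [D cD /denseP dD] := @hilbert_separable R H.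
have [f hf] : exists f : nat -> H, D `<=` range f.
  have /pfcard_geP[->|[f]] := cD; first by exists (fun=> 0).
  by exists f => s Ds; have [n _ <-] := @surj _ _ _ _ f s Ds; exists n.
exists f => x e e0; have [s /hf[k _ <-] hs] := dD x e e0; by exists k.
Qed.
End HilbertSpace.

(** * Projection onto a real subspace of tuples *)

Section Projection.
Variables (R : realType) (H : hilbertType R) (k : nat).
Implicit Types (v w : 'I_k -> H) (W : set ('I_k -> H)).

Lemma inv_small (e : R) : 0 < e -> exists N : nat, forall n, (N <= n)%N -> n.+1%:R^-1 < e.
Proof.
by move=> e0; have [N _ hN] := near_infty_natSinv_lt (PosNum e0); exists N => n /hN.
Qed.

Definition trin v w : R := \sum_i rin (v i) (w i).

Lemma trinDl u v w : trin (u + v) w = trin u w + trin v w.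
Proof. by rewrite /trin -big_split; apply: eq_bigr => i _; rewrite /= rinDl. Qed.
Lemma trinC v w : trin v w = trin w v.
Proof. by apply: eq_bigr => i _; rewrite rinC. Qed.
Lemma trinZl (r : R) v w : trin (r%:C *: v) w = r * trin v w.
Proof. by rewrite /trin mulr_sumr; apply: eq_bigr => i _; rewrite /= rinZl. Qed.
Lemma trinNl v w : trin (- v) w = - trin v w.
Proof. by rewrite /trin -sumrN; apply: eq_bigr => i _; rewrite /= rinNl. Qed.
Lemma trinDr u v w : trin w (u + v) = trin w u + trin w v.
Proof. by rewrite trinC trinDl !(trinC w). Qed.
Lemma trinZr (r : R) v w : trin w (r%:C *: v) = r * trin w v.
Proof. by rewrite trinC trinZl (trinC w). Qed.
Lemma trinNr v w : trin w (- v) = - trin w v.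
Proof. by rewrite trinC trinNl (trinC w). Qed.
Lemma trin_ge0 v : 0 <= trin v v.
Proof. by apply: sumr_ge0 => i _; apply: rin_ge0. Qed.
Lemma rin_le_trin v i : rin (v i) (v i) <= trin v v.
Proof.
by rewrite /trin (bigD1 i) //= lerDl; apply: sumr_ge0 => j _; apply: rin_ge0.
Qed.
Definition trinE := (trinDl, trinDr, trinZl, trinZr, trinNl, trinNr).

Lemma trin_le_nrm v w e : (forall i, nrm (v i) <= e) ->
  `|trin v w| <= e * \sum_i nrm (w i).
Proof.
move=> h; rewrite mulr_sumr; apply: le_trans (ler_norm_sum _ _ _) _.
apply: ler_sum => i _; apply: le_trans (rin_CS _ _) _.
by rewrite ler_wpM2r // nrm_ge0.
Qed.

(** A sequence in W minimizing the distance to z is Cauchy by the parallelogram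
    law; p is the limit of the defects.  Tuples stand for the Hilbert sum of k
    copies of H, so that finitely many vectors are approximated at once, and W
    is only a real subspace so that the lemma applies to self-adjoint
    operators evaluated at a tuple. *)
Lemma tuple_projection W (z : 'I_k -> H) :
  W 0 -> (forall v w, W v -> W w -> W (v + w)) ->
  (forall (r : R) v, W v -> W (r%:C *: v)) ->
  exists2 p : 'I_k -> H, forall w, W w -> trin p w = 0 &
    forall e : R, 0 < e -> exists2 w, W w & forall i, nrm (z i - w i - p i) < e.
Proof.
move=> W0 WD WZ.
pose D := [set trin (z - w) (z - w) | w in W].
have D0 : D !=set0 by exists (trin (z - 0) (z - 0)), 0.
have lD : lbound D 0 by move=> _ [w _ <-]; exact: trin_ge0.
have iD : has_inf D by split => //; exists 0.
pose d := inf D.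
have dle w : W w -> d <= trin (z - w) (z - w).
  by move=> Ww; apply: (ge_inf iD.2); exists w.
have /choice[w hw] : forall n : nat, exists w, W w /\ trin (z - w) (z - w) < d + n.+1%:R^-1.
  move=> n; have hn : 0 < n.+1%:R^-1 :> R by rewrite invr_gt0.
  by have [_ [w Ww <-] hw] := inf_adherent hn iD; exists w.
have mid n m : 4 * d <= trin (z - w n) (z - w n) + 2 * trin (z - w n) (z - w m)
    + trin (z - w m) (z - w m).
  have hW : W ((2^-1)%:C *: (w n + w m)) by apply/WZ/WD; [exact: (hw n).1|exact: (hw m).1].
  have := dle _ hW.
  have -> : z - (2^-1)%:C *: (w n + w m) = (2^-1)%:C *: ((z - w n) + (z - w m)).
    rewrite addrACA -opprD scalerBr; congr (_ - _).
    have -> : z + z = 2%:R%:C *: z by rewrite rmorph_nat scaler_nat mulr2n.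
    by rewrite scalerA -rmorphM mulVf ?pnatr_eq0 // scale1r.
  move: (z - w n) (z - w m) => a b; rewrite !trinE (trinC b a); lra.
have close n m : trin (w n - w m) (w n - w m) <= 2 * n.+1%:R^-1 + 2 * m.+1%:R^-1.
  have -> : w n - w m = (z - w m) - (z - w n) by rewrite opprB [RHS]addrC subrKA.
  have := mid n m; have [_ ] := hw n; have [_ ] := hw m.
  move: (z - w n) (z - w m) => a b.
  rewrite !trinE (trinC b a); set x := n.+1%:R^-1; set y := m.+1%:R^-1.
  lra.
have cau i : exists l, seq_cvg (fun n => z i - w n i) l.
  apply: cauchy_seq_cvg => e e0; have e24 : 0 < e ^+ 2 / 4 by rewrite divr_gt0 ?exprn_gt0.
  have [N hN] := inv_small e24; exists N => n m /hN hn /hN hm.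
  have -> : z i - w n i - (z i - w m i) = w m i - w n i.
    by rewrite opprB addrC subrKA.
  rewrite -ltr_sqr ?nnegrE ?nrm_ge0 1?ltW // nrm_sqr.
  have := rin_le_trin (w m - w n) i; have := close m n.
  change (rin ((w m - w n) i) ((w m - w n) i)) with (rin (w m i - w n i) (w m i - w n i)).
  move: (rin _ _) (trin _ _) => B A.
  move: hn hm; set a := n.+1%:R^-1; set b := m.+1%:R^-1; set f := e ^+ 2; lra.
have [p hp] := choice cau.
have app (e : R) : 0 < e -> exists N : nat, forall n, (N <= n)%N -> forall i, nrm (z i - w n i - p i) < e.
  move=> e0; have [N hN] := choice (fun i => hp i e e0).
  exists (\max_i N i) => n hn i; apply: hN.
  exact: leq_trans (leq_bigmax i) hn.
exists p => [v Wv|e /app[N hN]]; last by exists (w N); [exact: (hw N).1|exact: hN].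
(* minimality against the competitor w n + t v, in the limit *)
have key (t : R) : 2 * t * trin p v <= t ^+ 2 * trin v v.
  apply/ler_addgt0Pr => e e0.
  pose C := \sum_i nrm (v i).
  have C0 : 0 <= C by apply: sumr_ge0 => i _; exact: nrm_ge0.
  have [N1 hN1] := inv_small (divr_gt0 e0 (ltr0Sn _ 1)).
  have ce : 0 < e / (4 * (1 + `|t| * C)).
    apply: divr_gt0 => //; apply: mulr_gt0 => //.
    by apply: ltr_pwDl => //; apply: mulr_ge0.
  have [N2 hN2] := app _ ce.
  pose n := maxn N1 N2.
  have h1 := hN1 n (leq_maxl N1 N2); have h2 := hN2 n (leq_maxr N1 N2).
  have h3 : `|trin (z - w n - p) v| <= e / (4 * (1 + `|t| * C)) * C.
    by apply: trin_le_nrm => i; apply: ltW (h2 i).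
  have h4 : `|2 * t * trin (z - w n - p) v| <= e / 2.
    rewrite normrM; apply: le_trans (ler_wpM2l (normr_ge0 _) h3) _.
    rewrite normrM ger0_norm //.
    have -> : 2 * `|t| * (e / (4 * (1 + `|t| * C)) * C) =
       e / 2 * ((`|t| * C) / (1 + `|t| * C)).
      field; apply/lt0r_neq0/ltr_pwDl => //; exact: mulr_ge0.
    apply: ler_piMr; first by lra.
    rewrite ler_pdivrMr ?mul1r ?lerDr //.
    by apply: ltr_pwDl => //; apply: mulr_ge0.
  have h5 := dle (w n + t%:C *: v) (WD _ _ (hw n).1 (WZ t _ Wv)).
  have h6 := (hw n).2.
  move: h4 h5; rewrite ler_norml => /andP[h4 _].
  have -> : z - (w n + t%:C *: v) = (z - w n) - t%:C *: v by rewrite opprD addrA.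
  move: h4 h6; move: (z - w n) => a h4 h6.
  rewrite trinDl trinNl in h4; rewrite !trinE (trinC v a); set x := n.+1%:R^-1 in h1 h6 *; lra.
have vv := trin_ge0 v.
pose s := trin p v; rewrite -/s in key *.
have := key (s / (1 + trin v v)).
have ne : 1 + trin v v != 0 by apply: lt0r_neq0; lra.
have -> : 2 * (s / (1 + trin v v)) * s = (2 * (1 + trin v v)) * (s / (1 + trin v v)) ^+ 2.
  by field.
rewrite [leRHS]mulrC -subr_ge0 -mulrBl => h.
have h0 : 0 <= (s / (1 + trin v v)) ^+ 2 by apply: sqr_ge0.
have : (s / (1 + trin v v)) ^+ 2 = 0 by nra.
move/eqP; rewrite sqrf_eq0 mulf_eq0 invr_eq0 (negPf ne) orbF => /eqP //.
Qed.
End Projection.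

(** * Bounded operators and adjoints *)

Section Linear.
Variables (R : realType) (H K : hilbertType R).
Implicit Types (T S : H -> K).

Lemma linD T x y : linear T -> T (x + y) = T x + T y.
Proof. by move=> lT; rewrite -{1}(scale1r x) lT scale1r. Qed.
Lemma lin0 T : linear T -> T 0 = 0.
Proof. by move=> lT; apply: (addrI (T 0)); rewrite -linD // !addr0. Qed.
Lemma linZ T a x : linear T -> T (a *: x) = a *: T x.
Proof. by move=> lT; rewrite -(addr0 (a *: x)) lT lin0 // addr0. Qed.
Lemma linN T x : linear T -> T (- x) = - T x.
Proof. by move=> lT; rewrite -scaleN1r linZ // scaleN1r. Qed.
Lemma linB T x y : linear T -> T (x - y) = T x - T y.
Proof. by move=> lT; rewrite linD // linN. Qed.

Definition bnd (c : R) T := forall x, nrm (T x) <= c * nrm x.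

Lemma bopP T : bop T <-> linear T /\ exists2 c : R, 0 <= c & bnd c T.
Proof.
split=> [[lT cT]|[lT [c c0 cT]]]; split=> //; last first.
  move=> x; apply/cvgrPdist_lt => e' /real_of_pos[e e0 ->].
  have hc : 0 < e / (c + 1) by rewrite divr_gt0 // ltr_wpDl.
  near=> y; rewrite nrmE ltcR -linB //.
  apply: le_lt_trans (cT _) _.
  have : nrm (x - y) < e / (c + 1).
    near: y; have : 0 < (e / (c + 1))%:C :> R[i] by rewrite ltcR.
    move=> he; have := nbhsx_ballx x _ he.
    apply: filterS => y /ball_nrm //.
  rewrite ltr_pdivlMr ?ltr_wpDl // => h.
  apply: le_lt_trans h; rewrite mulrC ler_wpM2l ?nrm_ge0 // lerDl //.
have /cvgrPdist_lt /(_ 1 ltr01) := cT 0.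
move=> /nbhs_ballP[d' /= /real_of_pos[d d0 ->] hd].
have hT x : nrm x < d -> nrm (T x) < 1.
  move=> hx; rewrite -(@ltcR R) -nrmE.
  by have := hd x; rewrite /= lin0 // sub0r normrN; apply; apply/ball_nrm; rewrite sub0r nrmN.
exists (2 / d); first by rewrite divr_ge0 // ltW.
move=> x; have [x0|x0] := eqVneq (nrm x) 0.
  by rewrite (nrm_eq0 x0) lin0 // !nrm0 mulr0.
have xp : 0 < nrm x by rewrite lt_def x0 nrm_ge0.
(* half of the radius keeps r x strictly inside the ball of radius d *)
pose r := d / (2 * nrm x); have r0 : 0 < r by rewrite divr_gt0 // mulr_gt0.
have := hT (r%:C *: x); rewrite linZ // !nrmZr gtr0_norm //.
have -> : r * nrm x = d / 2 by rewrite /r; field.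
move=> h; have : r * nrm (T x) < 1 by apply: h; lra.
rewrite -ltr_pdivlMl // mulr1 /r invf_div => /ltW.
by rewrite mulrAC.
Unshelve. all: by end_near. Qed.

Lemma bop_lin T : bop T -> linear T. Proof. by case. Qed.

(** A strictly positive bound, which estimates can divide by. *)
Lemma bop_bnd T : bop T -> exists2 c : R, 0 < c & bnd c T.
Proof.
move=> /bopP[_ [c c0 h]]; exists (c + 1); first by rewrite ltr_wpDl.
move=> x; apply: le_trans (h x) _; rewrite ler_wpM2r ?nrm_ge0 // lerDl //.
Qed.

Lemma bnd_bop T c : linear T -> 0 <= c -> bnd c T -> bop T.
Proof. by move=> lT c0 h; apply/bopP; split=> //; exists c. Qed.

Lemma bop_comb (a : R[i]) S T : bop S -> bop T -> bop (a *: S + T).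
Proof.
move=> /bopP[lS [c c0 hS]] /bopP[lT [d d0 hT]]; apply/bopP; split.
  move=> b x y /=; rewrite !fctE lS lT !scalerDr !scalerA addrACA mulrC //.
have n0 : 0 <= complex.Re `|a| by rewrite -ler0c RRe_real ?normr_real.
exists (complex.Re `|a| * c + d); first by rewrite addr_ge0 // mulr_ge0.
move=> x; rewrite !fctE; apply: le_trans (nrmD _ _) _.
by rewrite nrmZ mulrDl -mulrA lerD // ler_wpM2l.
Qed.

Lemma bop_eq0 : bop (0 : H -> K).
Proof.
by apply: (@bnd_bop _ 0) => // [a x y|x]; rewrite ?fctE ?scaler0 ?addr0 // nrm0 mul0r.
Qed.

Lemma bopD S T : bop S -> bop T -> bop (S + T).
Proof. by move=> hS hT; rewrite -[S]scale1r; apply: bop_comb. Qed.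
Lemma bopZ a S : bop S -> bop (a *: S).
Proof. by move=> hS; rewrite -[_ *: _]addr0; apply: bop_comb => //; exact: bop_eq0. Qed.
Lemma bopN S : bop S -> bop (- S).
Proof. by move=> hS; rewrite -scaleN1r; apply: bopZ. Qed.
Lemma bopB S T : bop S -> bop T -> bop (S - T).
Proof. by move=> hS hT; apply/bopD/bopN. Qed.

Lemma the_bopP (P : set (H -> K)) T : bop T -> P T ->
  bop (the_bop P) /\ P (the_bop P).
Proof. by move=> bT PT; apply: (@xgetPex _ _ (@bop _ H K `&` P)); exists T. Qed.

End Linear.

Section Comp.
Variables (R : realType) (H K L : hilbertType R).
Lemma bop_comp (S : K -> L) (T : H -> K) : bop S -> bop T -> bop (S \o T).
Proof.
move=> /bopP[lS [c c0 hS]] /bopP[lT [d d0 hT]]; apply/bopP; split.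
  by move=> b x y /=; rewrite lT lS.
exists (c * d); first by rewrite mulr_ge0.
by move=> x /=; apply: le_trans (hS _) _; rewrite -mulrA ler_wpM2l.
Qed.
Lemma bop_id : bop (id : H -> H).
Proof. by apply: (@bnd_bop _ _ _ _ 1) => // x; rewrite mul1r. Qed.
End Comp.

Section Riesz.
Variables (R : realType) (H : hilbertType R).

(** When f is not 0, the projection of a point x0 with f x0 = 1 onto the kernel
    of f leaves a vector r orthogonal to the kernel with f r = 1, and f is the
    inner product with r / <r,r>. *)
Lemma riesz (f : H -> R[i]) (c : R) :
  (forall a x y, f (a *: x + y) = a * f x + f y) -> 0 <= c ->
  (forall x, complex.Re (f x) <= c * nrm x) ->
  exists y, forall x, f x = inner x y.
Proof.
move=> lf c0 hc.
have f0 : f 0 = 0.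
  by apply: (addrI (f 0)); rewrite -{1}(mul1r (f 0)) -lf scale1r !addr0.
have fZ a x : f (a *: x) = a * f x by rewrite -(addr0 (a *: x)) lf f0 addr0.
have fD x y : f (x + y) = f x + f y by rewrite -{1}(scale1r x) lf mul1r.
have fB x y : f (x - y) = f x - f y by rewrite fD -scaleN1r fZ mulN1r.
have [h|] := pselect (forall x, f x = 0).
  by exists 0 => x; rewrite inner0r h.
move=> /existsNP[x1 /eqP fx1].
pose x0 := (f x1)^-1 *: x1; have fx0 : f x0 = 1 by rewrite fZ mulVf.
have [|||p hp app] := @tuple_projection R H 1 [set w | f (w ord0) = 0] (fun=> x0).
- by rewrite /= f0.
- by move=> v w /= fv fw; rewrite fD fv fw addr0.
- by move=> r v /= fv; rewrite fZ fv mulr0.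
pose r := p ord0.
have orth x : f x = 0 -> inner x r = 0.
  move=> fx.
  have hr y : f y = 0 -> rin y r = 0.
    by move=> fy; have := hp (fun=> y) fy; rewrite /trin big_ord1 rinC.
  have -> : inner x r = rin x r +i* rin (- 'i%C *: x) r.
    rewrite [LHS]inner_rin; congr (_ +i* _); rewrite /rin innerZl innerZr.
    by congr (complex.Re (_ * _)); apply/eqP; rewrite eq_complex /= oppr0 !eqxx.
  by rewrite !hr // fZ fx mulr0.
have fr : f r = 1.
  apply/eqP; rewrite -subr_eq0 -normr_le0; apply/ler_addgt0Pr => e' /real_of_pos[e e0 ->].
  rewrite add0r; have e1 : 0 < e / (2 * (c + 1)) by rewrite divr_gt0 // mulr_gt0 // ltr_wpDl.
  have [w /= fw /(_ ord0) hw] := app _ e1.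
  have -> : f r - 1 = - f (x0 - w ord0 - r) by rewrite !fB fx0 fw subr0 opprB.
  rewrite normrN; apply: le_trans (normc_le _) _; rewrite lecR.
  move: hw; rewrite -/r; move: (x0 - _ - _) => u hu.
  have b1 : c * nrm u <= e / 2.
    have : (c + 1) * nrm u <= (c + 1) * (e / (2 * (c + 1))).
      by rewrite ler_wpM2l ?addr_ge0 // ltW.
    have -> : (c + 1) * (e / (2 * (c + 1))) = e / 2 by field; lra.
    have := nrm_ge0 u; nra.
  have hre v : nrm v = nrm u -> `|complex.Re (f v)| <= e / 2.
    move=> vu; rewrite ler_norml lerNl; apply/andP; split.
      have := hc (- v); rewrite -scaleN1r fZ mulN1r raddfN scaleN1r nrmN vu => h.
      exact: le_trans h b1.
    by apply: le_trans (hc _) _; rewrite vu.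
  have -> : complex.Im (f u) = complex.Re (f (- 'i%C *: u)).
    by rewrite fZ; case: (f u) => a b /=; lra.
  have h1 := hre _ erefl.
  have h2 : `|complex.Re (f (- 'i%C *: u))| <= e / 2.
    by apply: hre; rewrite scaleNr nrmN nrmi.
  lra.
have r0 : inner r r != 0.
  apply/eqP => h; have r0 : r = 0 by apply: rin_eq0; rewrite /rin h.
  by move/eqP: fr; rewrite r0 f0 eq_sym oner_eq0.
exists ((inner r r)^-1 *: r) => x.
have : inner (x - f x *: r) r = 0.
  by apply: orth; rewrite fB fZ fr mulr1 subrr.
rewrite innerDl innerNl innerZl => /eqP; rewrite subr_eq0 => /eqP h.
have rr : Num.conj (inner r r)^-1 = (inner r r)^-1.
  by rewrite inner_diag fmorphV; congr (_^-1); exact: conjC_real.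
by rewrite innerZr rr h mulrC mulfK.
Qed.
End Riesz.

Section Adjoint.
Variables (R : realType) (H K : hilbertType R).
Implicit Types (T S : H -> K).

Lemma adjP T : bop T ->
  bop (adj T) /\ forall x y, inner (T x) y = inner x (adj T y).
Proof.
move=> bT; have /bopP[lT [c c0 hT]] := bT.
have /choice[S hS] : forall y, exists z, forall x, inner (T x) y = inner x z.
  move=> y; apply: (@riesz _ _ (fun x => inner (T x) y) (c * nrm y)).
  - by move=> a x z; rewrite lT inner_linear.
  - by rewrite mulr_ge0 ?nrm_ge0.
  - move=> x; apply: le_trans (ler_norm _) _; apply: le_trans (rin_CS _ _) _.
    by rewrite mulrAC ler_wpM2r ?nrm_ge0.
suff bS : bop S by have := @the_bopP _ _ _ [set S | forall x y, inner (T x) y = inner x (S y)] S bS (fun x y => hS y x).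
apply: (@bnd_bop _ _ _ _ c) => // [a x y|y].
  apply: inner_eqP => z; rewrite inner_conj -hS innerDr innerZr !hS.
  by rewrite [in RHS]inner_conj innerDr innerZr.
apply: nrm_rin_le; first by rewrite mulr_ge0 ?nrm_ge0.
move=> z; rewrite rinC /rin -hS; apply: le_trans (ler_norm _) _.
apply: le_trans (rin_CS _ _) _.
by rewrite [leRHS]mulrAC ler_wpM2r ?nrm_ge0.
Qed.

Lemma adj_bop T : bop T -> bop (adj T). Proof. by case/adjP. Qed.
Lemma inner_adj T x y : bop T -> inner (T x) y = inner x (adj T y).
Proof. by case/adjP => _; apply. Qed.
Lemma inner_adjr T x y : bop T -> inner (adj T x) y = inner x (T y).
Proof. by move=> bT; rewrite inner_conj -inner_adj // -inner_conj. Qed.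
Lemma rin_adj T x y : bop T -> rin (T x) y = rin x (adj T y).
Proof. by move=> bT; rewrite /rin inner_adj. Qed.
Lemma rin_adjr T x y : bop T -> rin (adj T x) y = rin x (T y).
Proof. by move=> bT; rewrite /rin inner_adjr. Qed.

Lemma adj_uniq T (S : K -> H) : bop T -> (forall x y, rin (T x) y = rin x (S y)) ->
  adj T = S.
Proof.
move=> bT h; apply/funext => y; apply: rin_eqP => x.
by rewrite rin_adjr // -[RHS]rinC -h rinC.
Qed.
End Adjoint.

Section AdjointTheory.
Variables (R : realType) (H K L : hilbertType R).

Lemma adjK (T : H -> K) : bop T -> adj (adj T) = T.
Proof. by move=> bT; apply: adj_uniq => [|x y]; [exact: adj_bop|rewrite rin_adjr]. Qed.

Lemma adj_comp (S : K -> L) (T : H -> K) : bop S -> bop T ->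
  adj (S \o T) = adj T \o adj S.
Proof.
by move=> bS bT; apply: adj_uniq => [|x y /=]; [exact: bop_comp|rewrite !rin_adj].
Qed.

Lemma adj_comb (a : R[i]) (S T : H -> K) : bop S -> bop T ->
  adj (a *: S + T) = Num.conj a *: adj S + adj T.
Proof.
move=> bS bT; apply: adj_uniq => [|x y]; first exact: bop_comb.
rewrite /rin !fctE innerDl innerDr innerZl innerZr conjCK.
by rewrite -!inner_adj.
Qed.

Lemma adj0 : adj (0 : H -> K) = 0.
Proof. by apply: adj_uniq => [|x y]; [exact: bop_eq0|rewrite [LHS]rin0l [RHS]rin0r]. Qed.
Lemma adjD (S T : H -> K) : bop S -> bop T -> adj (S + T) = adj S + adj T.
Proof. by move=> bS bT; rewrite -[S]scale1r adj_comb // rmorph1 !scale1r. Qed.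
Lemma adjZ a (S : H -> K) : bop S -> adj (a *: S) = Num.conj a *: adj S.
Proof. by move=> bS; rewrite -[_ *: S]addr0 adj_comb ?adj0 ?addr0 //; exact: bop_eq0. Qed.
Lemma adjN (S : H -> K) : bop S -> adj (- S) = - adj S.
Proof. by move=> bS; rewrite -scaleN1r adjZ // rmorphN1 scaleN1r. Qed.
Lemma adjB (S T : H -> K) : bop S -> bop T -> adj (S - T) = adj S - adj T.
Proof. by move=> bS bT; rewrite adjD ?adjN //; exact: bopN. Qed.
Lemma adj_id : adj (id : H -> H) = id.
Proof. by apply: adj_uniq => //; exact: bop_id. Qed.
End AdjointTheory.

(** * Linear spans and extension from a dense subspace *)

Section Span.
Variables (C : pzRingType) (V : lmodType C).
Implicit Types (S : set V).

Lemma lspan0 S : lspan S 0.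
Proof. by exists 0%N, (fun=> 0), (fun=> 0); split; [case|rewrite big_ord0]. Qed.

Lemma sub_lspan S : S `<=` lspan S.
Proof.
by move=> v Sv; exists 1%N, (fun=> 1), (fun=> v); split=> //; rewrite big_ord1 scale1r.
Qed.

Lemma lspan_comb S (a : C) u v : lspan S u -> lspan S v -> lspan S (a *: u + v).
Proof.
move=> [n [c [s [hs ->]]]] [m [d [t [ht ->]]]].
exists (n + m)%N, (fun i => match fintype.split i with inl j => a * c j | inr j => d j end),
  (fun i => match fintype.split i with inl j => s j | inr j => t j end); split.
  by move=> i; case: (fintype.split i).
rewrite big_split_ord /= scaler_sumr; congr (_ + _); apply: eq_bigr => i _.
  by have -> : fintype.split (lshift m i) = inl i := unsplitK (inl i); rewrite scalerA.
by have -> : fintype.split (rshift n i) = inr i := unsplitK (inr i).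
Qed.

Lemma lspan_ind S (Q : set V) : Q 0 -> (forall (a : C) s v, S s -> Q v -> Q (a *: s + v)) ->
  lspan S `<=` Q.
Proof.
move=> Q0 QS _ [n [c [s [hs ->]]]]; elim: n c s hs => [|n IH] c s hs.
  by rewrite big_ord0.
by rewrite big_ord_recl; apply: QS => //; apply: IH.
Qed.

Lemma lspanD S u v : lspan S u -> lspan S v -> lspan S (u + v).
Proof. by move=> hu hv; rewrite -[u]scale1r; exact: lspan_comb. Qed.
Lemma lspanZ S a u : lspan S u -> lspan S (a *: u).
Proof. by move=> hu; rewrite -[_ *: _]addr0; apply: lspan_comb => //; exact: lspan0. Qed.
End Span.

Section Extension.
Variables (R : realType) (H K : hilbertType R).

(** The operators of the construction are prescribed on vectors indexed by
    elements of an algebra, and the indexing need not be injective; a relation G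
    records the prescription, and the bound c makes its closure single-valued. *)
Lemma extend_relation (G : set (H * K)) (c : R) : 0 <= c ->
  (forall a p q, G p -> G q -> G (a *: p + q)) ->
  (forall p, G p -> nrm p.2 <= c * nrm p.1) ->
  (forall x (e : R), 0 < e -> exists2 p, G p & nrm (x - p.1) < e) ->
  exists T : H -> K, [/\ bop T, bnd c T & forall p, G p -> T p.1 = p.2].
Proof.
move=> c0 GL Gc Gd.
(* the graph of the extension: the closure of G *)
pose L x y := forall e : R, 0 < e -> exists2 p, G p & nrm (x - p.1) < e /\ nrm (y - p.2) < e.
have GB p q : G p -> G q -> G (p - q).
  by move=> Gp Gq; rewrite addrC -scaleN1r; apply: GL.
have GcB p q : G p -> G q -> nrm (p.2 - q.2) <= c * nrm (p.1 - q.1).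
  by move=> Gp Gq; exact: Gc (GB _ _ Gp Gq).
have ce e : 0 < e -> 0 < e / (2 * (c + 1)) by move=> e0; rewrite divr_gt0 // mulr_gt0 // ltr_wpDl.
have cce e n : 0 <= n -> n < e / (2 * (c + 1)) -> c * n <= e / 2.
  move=> n0 hn; have : (c + 1) * n <= (c + 1) * (e / (2 * (c + 1))).
    by rewrite ler_wpM2l ?addr_ge0 // ltW.
  have -> : (c + 1) * (e / (2 * (c + 1))) = e / 2 by field; lra.
  nra.
have LB x y : L x y -> nrm y <= c * nrm x.
  move=> h; apply/ler_addgt0Pr => e e0.
  have e4 : 0 < e / 4 by lra.
  have [p Gp [h1 h2]] := h (Num.min (e / 4) (e / 4 / (2 * (c + 1)))) ltac:(by rewrite lt_min e4 ce).
  move: h1 h2; rewrite !lt_min => /andP[h1 h1'] /andP[h2 _].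
  have := cce _ _ (nrm_ge0 _) h1'.
  have := Gc _ Gp; have := nrmD (y - p.2) p.2; have := nrmD (p.1 - x) x.
  rewrite !subrK (nrmB p.1) => h3 h4 h5 h6.
  have : c * nrm p.1 <= c * (nrm (x - p.1) + nrm x) by rewrite ler_wpM2l.
  rewrite mulrDr; lra.
have Lc a x y x' y' : L x y -> L x' y' -> L (a *: x + x') (a *: y + y').
  move=> h h' e e0; pose m := complex.Re `|a|.
  have m0 : 0 <= m by rewrite -ler0c RRe_real ?normr_real.
  have em : 0 < e / (2 * (m + 1)) by rewrite divr_gt0 // mulr_gt0 // ltr_wpDl.
  have e2 : 0 < e / 2 by lra.
  have [p Gp [h1 h2]] := h _ em; have [q Gq [h3 h4]] := h' _ e2.
  have mm u : nrm u < e / (2 * (m + 1)) -> m * nrm u <= e / 2.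
    move=> hu; have : (m + 1) * nrm u <= (m + 1) * (e / (2 * (m + 1))).
      by rewrite ler_wpM2l ?addr_ge0 // ltW.
    have -> : (m + 1) * (e / (2 * (m + 1))) = e / 2 by field; lra.
    have := nrm_ge0 u; nra.
  have main (V : hilbertType R) (u v u' v' : V) : nrm (u - v) < e / (2 * (m + 1)) ->
      nrm (u' - v') < e / 2 -> nrm (a *: u + u' - (a *: v + v')) < e.
    move=> k1 k2; rewrite opprD addrACA -scalerBr.
    apply: le_lt_trans (nrmD _ _) _; rewrite nrmZ.
    have := mm _ _ k1; rewrite -/m; lra.
  by exists (a *: p + q); [exact: GL|split; apply: main].
have L0 : L 0 0.
  move=> e e0; have [p Gp _] := Gd 0 _ e0; exists (p - p); first exact: GB.
  by rewrite subrr; split; [rewrite (subr0 (0 : H))|rewrite (subr0 (0 : K))]; rewrite nrm0.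
have Lu x y y' : L x y -> L x y' -> y = y'.
  move=> h h'; have h'' := Lc (-1) _ _ _ _ h h'.
  apply/eqP; rewrite eq_sym -subr_eq0; apply/eqP/nrm_eq0/eqP.
  rewrite eq_le nrm_ge0 andbT; apply: le_trans (_ : c * nrm (-1 *: x + x) <= _).
    by have := LB _ _ h''; rewrite scaleN1r (addrC (- y)).
  by rewrite scaleN1r addNr nrm0 mulr0.
have /choice[T hT] : forall x, exists y, L x y.
  move=> x; have /choice[g hg] : forall n : nat, exists p, G p /\ nrm (x - p.1) < n.+1%:R^-1.
    move=> n; have hn : 0 < n.+1%:R^-1 :> R by rewrite invr_gt0.
    by have [p Gp hp] := Gd x _ hn; exists p.
  have [y hy] : exists l, seq_cvg (fun n => (g n).2) l.
    apply: cauchy_seq_cvg => e e0.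
    have e4 : 0 < e / (2 * (c + 1)) / 2 by have := ce _ e0; lra.
    have [N hN] := inv_small e4; exists N => n m Nn Nm.
    apply: le_lt_trans (GcB _ _ (hg n).1 (hg m).1) _.
    have h3 : nrm ((g n).1 - (g m).1) < e / (2 * (c + 1)).
      apply: le_lt_trans (nrm_tri _ x _) _; rewrite (nrmB (g n).1).
      have := hN _ Nn; have := hN _ Nm; have := (hg n).2; have := (hg m).2.
      set a := n.+1%:R^-1; set b := m.+1%:R^-1; lra.
    have := cce _ _ (nrm_ge0 _) h3; lra.
  exists y => e e0; have [N hN] := hy e e0; have [M hM] := inv_small e0.
  exists (g (maxn N M)); first exact: (hg _).1.
  split; last by rewrite nrmB; apply: hN; exact: leq_maxl.
  exact: lt_trans (hg _).2 (hM _ (leq_maxr _ _)).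
have lT : linear T by move=> a x y; apply: Lu (hT _) _; exact: Lc.
exists T; split; first exact: bnd_bop lT c0 (fun x => LB _ _ (hT x)).
  by move=> x; exact: LB.
move=> p Gp; apply: Lu (hT _) _ => e e0; exists p => //.
by rewrite !subrr !nrm0.
Qed.
End Extension.

Section Isometry.
Variables (R : realType) (H K : hilbertType R).

(** Preservation of inner products on generators passes to linear combinations,
    so the span of S is a bounded linear relation with bound 1. *)
Lemma extend_isometry (S : set (H * K)) :
  (forall p q, S p -> S q -> inner p.1 q.1 = inner p.2 q.2) ->
  dense (lspan (fst @` S)) ->
  exists T : H -> K, [/\ bop T, forall x y, inner (T x) (T y) = inner x y &
     forall p, S p -> T p.1 = p.2].
Proof.
move=> hS /denseP dS.
have iso p q : lspan S p -> lspan S q -> inner p.1 q.1 = inner p.2 q.2.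
  move=> Sp Sq; move: p Sp; apply: lspan_ind => [|a s v Ss IH].
    by rewrite !inner0l.
  rewrite !innerDl !innerZl IH; congr (_ * _ + _); move: q Sq {IH}.
  apply: lspan_ind => [|b t w St IH']; first by rewrite !inner0r.
  by rewrite !innerDr !innerZr IH' (hS _ _ Ss St).
have [|||x e e0|T [bT bndT hT]] := @extend_relation R H K (lspan S) 1.
- exact: ler01.
- by move=> a p q; exact: lspan_comb.
- move=> p Sp; rewrite mul1r le_nrm ?nrm_ge0 // nrm_sqr.
  by rewrite /rin iso.
- have [s Ss hs] := dS x e e0; suff [p Sp ps] : exists2 p, lspan S p & p.1 = s.
    by exists p; rewrite ?ps.
  move: s Ss {hs}; apply: lspan_ind => [|a _ v [p Sp <-] [q Sq <-]].
    by exists 0 => //; exact: lspan0.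
  by exists (a *: p + q) => //; apply: lspan_comb => //; exact: sub_lspan.
exists T; split=> //; last by move=> p Sp; apply: hT; exact: sub_lspan.
have lT := bop_lin bT.
have nT x : nrm (T x) = nrm x.
  apply/eqP; rewrite eq_le -{1}[nrm x]mul1r bndT /=.
  apply/ler_addgt0Pr => e e0; have e2 : 0 < e / 2 by lra.
  have [s Ss hs] := dS x _ e2.
  have [p Sp ps] : exists2 p, lspan S p & p.1 = s.
    move: s Ss {hs}; apply: lspan_ind => [|a _ v [p Sp <-] [q Sq <-]].
      by exists 0 => //; exact: lspan0.
    by exists (a *: p + q) => //; apply: lspan_comb => //; exact: sub_lspan.
  have np : nrm p.1 = nrm (T p.1).
    rewrite hT //; apply/eqP; rewrite -(@eqrXn2 _ 2) ?nrm_ge0 // !nrm_sqr.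
    by rewrite /rin iso.
  have := nrmD (x - p.1) p.1; have := nrmD (T p.1 - T x) (T x); have := bndT (p.1 - x).
  rewrite !subrK -linB // (nrmB p.1) -np ps; lra.
have rT x y : rin (T x) (T y) = rin x y.
  have := congr1 (fun z => z ^+ 2) (nT (x + y)); rewrite linD // !nrm_sqr !rinE.
  have := congr1 (fun z => z ^+ 2) (nT x); have := congr1 (fun z => z ^+ 2) (nT y).
  by rewrite !nrm_sqr (rinC y) (rinC (T y)); lra.
by move=> x y; rewrite !inner_rin -!linZ // !rT.
Qed.

Lemma bop_ext (S : set H) (T T' : H -> K) : bop T -> bop T' -> dense (lspan S) ->
  (forall x, S x -> T x = T' x) -> T = T'.
Proof.
move=> bT bT' /denseP dS h; apply/funext => x.
have [c c0 hc] := bop_bnd (bopB bT bT').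
have lTT := bop_lin (bopB bT bT').
have hs s : lspan S s -> (T - T') s = 0.
  move: s; apply: lspan_ind => [|a s v Ss IH]; first exact: lin0.
  by rewrite lTT IH !fctE h // subrr scaler0 addr0.
apply/eqP; rewrite -subr_eq0; apply/eqP/nrm_small => e e0.
have [s Ss xs] := dS x _ (divr_gt0 e0 c0).
change (nrm ((T - T') x) <= e); rewrite -[x](subrK s) (linD _ _ lTT) (hs _ Ss) addr0.
apply: le_trans (hc _) _; rewrite mulrC -ler_pdivlMr // ltW //.
Qed.
End Isometry.

(** * The weak operator closure of a linear span *)

Section WeakSpan.
Variables (R : realType) (H K : hilbertType R).
Implicit Types (S : set (H -> K)) (T : H -> K).

(** Weak approximation is stated for a set Q that need not be a complex
    subspace, and with real parts of coefficients: by [wspanP] nothing is lost,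
    the imaginary part at (x, y) being the real part at (x, iy). *)
Definition wapprox (Q : set (H -> K)) T := forall (s : seq (H * K)) (e : R), 0 < e ->
  exists2 T', Q T' & forall p, p \in s -> `|rin (T p.1 - T' p.1) p.2| < e.

Lemma wspanP S T : wspan S T <-> bop T /\ wapprox (lspan S) T.
Proof.
split=> -[bT h]; split=> // s e.
  move=> e0; have he : 0 < e%:C :> R[i] by rewrite ltcR.
  have [T' ST' hT'] := h s _ he; exists T' => // p /hT'.
  rewrite -innerNl -innerDl => h'; rewrite -ltcR; apply: le_lt_trans h'.
  exact: normc_ge_Re.
move=> /real_of_pos[r r0 ->]; have r2 : 0 < r / 2 by lra.
have [T' ST' hT'] := h (s ++ [seq (p.1, 'i%C *: p.2) | p <- s]) _ r2.
exists T' => // p ps; rewrite -innerNl -innerDl inner_rin.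
apply: le_lt_trans (normc_le _) _; rewrite ltcR /=.
have h1 : `|rin (T p.1 - T' p.1) p.2| < r / 2 by apply: hT'; rewrite mem_cat ps.
have h2 : `|rin (T p.1 - T' p.1) ('i%C *: p.2)| < r / 2.
  by apply: (hT' (p.1, 'i%C *: p.2)); rewrite mem_cat (map_f (fun p => (p.1, _)) ps) orbT.
lra.
Qed.

Lemma wspan_bop S : wspan S `<=` @bop R H K. Proof. by move=> T []. Qed.

Lemma sub_wspan S : S `<=` @bop R H K -> S `<=` wspan S.
Proof.
move=> bS T ST; apply/wspanP; split; first exact: bS.
move=> s e e0; exists T; first exact: sub_lspan.
by move=> p _; rewrite subrr rin0l normr0.
Qed.

Lemma wspan0 S : wspan S 0.
Proof.
apply/wspanP; split; first exact: bop_eq0.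
move=> s e e0; exists 0; first exact: lspan0.
by move=> p _; rewrite subrr rin0l normr0.
Qed.

Lemma wspan_comb S a T T' : wspan S T -> wspan S T' -> wspan S (a *: T + T').
Proof.
move=> /wspanP[bT h] /wspanP[bT' h']; apply/wspanP; split; first exact: bop_comb.
move=> s e e0; have e2 : 0 < e / 2 by lra.
have [X SX hX] := h [seq (p.1, Num.conj a *: p.2) | p <- s] _ e2.
have [Y SY hY] := h' s _ e2.
exists (a *: X + Y); first exact: lspan_comb.
move=> p ps; rewrite !fctE opprD addrACA -scalerBr rinDl.
apply: le_lt_trans (ler_normD _ _) _.
have := hX _ (map_f (fun p => (p.1, Num.conj a *: p.2)) ps).
rewrite /= {1}/rin innerZr conjCK -innerZl -/(rin _ _); have := hY _ ps; lra.
Qed.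

Lemma wspanD S T T' : wspan S T -> wspan S T' -> wspan S (T + T').
Proof. by move=> h h'; rewrite -[T]scale1r; exact: wspan_comb. Qed.
Lemma wspanZ S a T : wspan S T -> wspan S (a *: T).
Proof. by move=> h; rewrite -[_ *: _]addr0; apply: wspan_comb => //; exact: wspan0. Qed.
Lemma wspanN S T : wspan S T -> wspan S (- T).
Proof. by move=> h; rewrite -scaleN1r; exact: wspanZ. Qed.
Lemma wspanB S T T' : wspan S T -> wspan S T' -> wspan S (T - T').
Proof. by move=> h h'; apply: wspanD => //; exact: wspanN. Qed.

Lemma lspan_wspan S S' : S' `<=` wspan S -> lspan S' `<=` wspan S.
Proof.
move=> h; apply: lspan_ind => [|a s v /h ws wv]; first exact: wspan0.
exact: wspan_comb.
Qed.

Lemma wspan_closed S T : bop T -> wapprox (wspan S) T -> wspan S T.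
Proof.
move=> bT h; apply/wspanP; split=> // s e e0; have e2 : 0 < e / 2 by lra.
have [X /wspanP[_ hX] TX] := h s _ e2; have [Y SY XY] := hX s _ e2.
exists Y => // p ps; have h1 := TX _ ps; have h2 := XY _ ps.
have -> : T p.1 - Y p.1 = (T p.1 - X p.1) + (X p.1 - Y p.1) by rewrite addrA subrK.
rewrite rinDl; apply: le_lt_trans (ler_normD _ _) _; lra.
Qed.

Lemma wspan_sub S S' : S' `<=` wspan S -> wspan S' `<=` wspan S.
Proof.
move=> h T /wspanP[bT hT]; apply: wspan_closed => // s e e0.
by have [X SX hX] := hT s e e0; exists X => //; exact: lspan_wspan h _ SX.
Qed.

Lemma wspan_mono S S' : S' `<=` @bop R H K -> S `<=` S' -> wspan S `<=` wspan S'.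
Proof. by move=> b h; apply: wspan_sub => T /h; exact: sub_wspan. Qed.

Lemma wspan_id S : wspan (wspan S) = wspan S.
Proof.
apply/seteqP; split; first exact: wspan_sub.
exact/sub_wspan/wspan_bop.
Qed.

(** The defect p of the best approximation of T z by the X z is orthogonal to all
    of them, hence to T z by weak approximation, hence to itself. *)
Lemma weak_strong (Q : set (H -> K)) T : Q 0 -> (forall X Y, Q X -> Q Y -> Q (X + Y)) ->
  (forall (r : R) X, Q X -> Q (r%:C *: X)) -> wapprox Q T ->
  forall (k : nat) (z : 'I_k -> H) (e : R), 0 < e ->
    exists2 X, Q X & forall i, nrm (T (z i) - X (z i)) < e.
Proof.
move=> Q0 QD QZ h k z.
have [|||p hp app] := @tuple_projection R K k [set w | exists2 X, Q X & w = X \o z] (T \o z).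
- by exists 0.
- by move=> _ _ [X QX ->] [Y QY ->]; exists (X + Y); [exact: QD|].
- by move=> r _ [X QX ->]; exists (r%:C *: X); [exact: QZ|].
suff p0 : trin p p = 0.
  move=> e e0; have [_ [X QX ->] hX] := app e e0; exists X => // i.
  have : p i = 0.
    by apply: rin_eq0; apply/eqP; rewrite eq_le rin_ge0 andbT -p0 rin_le_trin.
  by have := hX i; rewrite /= => + pi; rewrite pi subr0.
have C0 : 0 <= \sum_i nrm (p i) by apply: sumr_ge0 => i _; exact: nrm_ge0.
(* e / (k + 1) leaves room for the sum of the k errors, even if k = 0 *)
have pz : trin p (T \o z) = 0.
  apply/eqP; rewrite -normr_le0; apply/ler_addgt0Pr => e e0; rewrite add0r.
  have ek : 0 < e / k.+1%:R by rewrite divr_gt0.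
  have [X QX hX] := h [seq (z i, p i) | i <- enum 'I_k] _ ek.
  have -> : trin p (T \o z) = trin p ((T \o z) - (X \o z)).
    by rewrite trinDr trinNr (hp (X \o z)) ?subr0 //; exists X.
  apply: le_trans (ler_norm_sum _ _ _) _.
  apply: le_trans (_ : \sum_(i < k) e / k.+1%:R <= _).
    apply: ler_sum => i _; rewrite rinC ltW //.
    by apply: (hX (z i, p i)); rewrite (map_f (fun i => (z i, p i))) ?mem_enum.
  rewrite sumr_const card_ord -[leLHS]mulr_natr -mulrA; apply: ler_piMr; first exact: ltW.
  by rewrite ler_pdivrMl // mulr1 ler_nat.
apply/eqP; rewrite eq_le trin_ge0 andbT; apply/ler_addgt0Pr => e e0; rewrite add0r.
have e1 : 0 < e / (1 + \sum_i nrm (p i)) by rewrite divr_gt0 // ltr_pwDl.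
have [w Qw hw] := app _ e1.
have -> : trin p p = - trin ((T \o z) - w - p) p.
  rewrite !trinDl !trinNl [trin (_ \o _) _]trinC pz [trin w _]trinC (hp w) //.
  by rewrite oppr0 addr0 sub0r opprK.
apply: le_trans (ler_norm _) _; rewrite normrN.
apply: le_trans (trin_le_nrm _ (fun i => ltW (hw i))) _.
rewrite mulrAC ler_pdivrMr ?ltr_pwDl // ler_wpM2l ?ltW //; lra.
Qed.

End WeakSpan.

Section WeakMaps.
Variables (R : realType).

(** F is weakly continuous because each coefficient of F X is a coefficient of X;
    sg is the identity or the conjugation, which treats compositions and the
    adjoint alike. *)
Lemma wspan_map (H K H' K' : hilbertType R) (S : set (H -> K)) (sg : R[i] -> R[i])
    (F : (H -> K) -> (H' -> K')) (f : H' * K' -> H * K) :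
  (forall a X Y, bop X -> bop Y -> F (a *: X + Y) = sg a *: F X + F Y) -> F 0 = 0 ->
  (forall X p, bop X -> rin (F X p.1) p.2 = rin (X (f p).1) (f p).2) ->
  S `<=` @bop R H K ->
  forall T, wspan S T -> bop (F T) -> wspan (F @` S) (F T).
Proof.
move=> FL F0 hF bS T /wspanP[bT hT] bFT; apply/wspanP; split=> // s e e0.
have [X SX hX] := hT (map f s) e e0.
have [bX SFX] : bop X /\ lspan (F @` S) (F X).
  move: X SX {hX}; apply: lspan_ind => [|a X Y SX [bY SY]].
    by rewrite F0; split; [exact: bop_eq0|exact: lspan0].
  split; first by apply: bop_comb => //; exact: bS.
  rewrite FL //; last exact: bS.
  by apply: lspan_comb => //; apply: sub_lspan; exists X.
exists (F X) => // p ps; have := hX _ (map_f f ps).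
by rewrite !rinDl !rinNl !hF.
Qed.

Lemma wspan_comp (H K H' K' : hilbertType R) (S : set (H -> K)) (A : K -> K') (B : H' -> H) T :
  bop A -> bop B -> S `<=` @bop R H K -> wspan S T ->
  wspan [set A \o X \o B | X in S] (A \o T \o B).
Proof.
move=> bA bB bS wT; have lA := bop_lin bA; have bT := wspan_bop wT.
apply: (@wspan_map _ _ _ _ S id (fun X => A \o X \o B) (fun p => (B p.1, adj A p.2))) => //.
- by move=> a X Y bX bY; apply/funext => x /=; rewrite !fctE lA.
- by apply/funext => x; exact: lin0.
- by move=> X p bX /=; rewrite rin_adj.
- by do 2!apply: bop_comp => //.
Qed.

Lemma wspan_adj (H K : hilbertType R) (S : set (H -> K)) T :
  S `<=` @bop R H K -> wspan S T -> wspan (setadj S) (adj T).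
Proof.
move=> bS wT; have bT := wspan_bop wT.
apply: (@wspan_map _ _ _ _ S Num.conj (@adj R H K) (fun p => (p.2, p.1))) => //.
- by move=> a X Y bX bY; rewrite adj_comb.
- exact: adj0.
- by move=> X p bX /=; rewrite rin_adjr // rinC.
- exact: adj_bop.
Qed.

Lemma setadj_bop (H K : hilbertType R) (S : set (H -> K)) :
  S `<=` @bop R H K -> setadj S `<=` @bop R K H.
Proof. by move=> bS _ [T ST <-]; apply/adj_bop/bS. Qed.

Lemma setcomp_bop (H K L : hilbertType R) (S : set (K -> L)) (S' : set (H -> K)) :
  S `<=` @bop R K L -> S' `<=` @bop R H K -> setcomp S S' `<=` @bop R H L.
Proof. by move=> bS bS' _ [T ST [T' ST' <-]]; apply: bop_comp; [exact: bS|exact: bS']. Qed.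

(** Composition is only separately continuous for the weak operator topology, so
    one factor is approximated at a time. *)
Lemma wspan_setcomp (H K L : hilbertType R) (S : set (K -> L)) (S' : set (H -> K)) :
  S `<=` @bop R K L -> S' `<=` @bop R H K ->
  setcomp (wspan S) (wspan S') `<=` wspan (setcomp S S').
Proof.
move=> bS bS' _ [T wT [T' wT' <-]].
have step X : S X -> wspan (setcomp S S') (X \o T').
  move=> SX; have bX := bS _ SX.
  have := @wspan_comp _ _ _ _ _ X id _ bX (@bop_id _ _) bS' wT'.
  apply: wspan_mono; first exact: setcomp_bop.
  by move=> _ [Y SY <-]; exists X => //; exists Y.
have bT' := wspan_bop wT'.
have := @wspan_comp _ _ _ _ _ id T' _ (@bop_id _ _) bT' bS wT.
by apply: wspan_sub => _ [X SX <-]; exact: step.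
Qed.

Lemma wspan_setcomp_eq (H K L : hilbertType R) (S : set (K -> L)) (S' : set (H -> K)) :
  S `<=` @bop R K L -> S' `<=` @bop R H K ->
  wspan (setcomp (wspan S) (wspan S')) = wspan (setcomp S S').
Proof.
move=> bS bS'; apply/seteqP; split; first exact/wspan_sub/wspan_setcomp.
apply: wspan_mono; first by apply: setcomp_bop; exact: wspan_bop.
move=> _ [X SX [Y SY <-]]; exists X; first exact: sub_wspan.
by exists Y => //; exact: sub_wspan.
Qed.

Lemma setadj_wspan (H K : hilbertType R) (S : set (H -> K)) :
  S `<=` @bop R H K -> setadj (wspan S) = wspan (setadj S).
Proof.
move=> bS; apply/seteqP; split=> [_ [T wT <-]|T wT]; first exact: wspan_adj.
have bT := wspan_bop wT; exists (adj T); last exact: adjK.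
have := wspan_adj (setadj_bop bS) wT.
apply: wspan_mono => // _ [_ [X SX <-] <-]; rewrite adjK //; exact: bS.
Qed.
End WeakMaps.

(** * Positive operators and von Neumann algebras *)

Section Positive.
Variables (R : realType) (K : hilbertType R).
Implicit Types (S T p : K -> K).

Definition rle S T := forall x, rin (S x) x <= rin (T x) x.

Lemma rin_ii (x y : K) : rin ('i%C *: x) ('i%C *: y) = rin x y.
Proof.
rewrite /rin innerZl innerZr; congr complex.Re; case: (inner x y) => a b.
by apply/eqP; rewrite eq_complex /=; apply/andP; split; apply/eqP; ring.
Qed.

Lemma scale_ii (x : K) : 'i%C *: ('i%C *: x) = - x.
Proof.
rewrite scalerA; have -> : ('i%C * 'i%C : R[i]) = -1.
  by apply/eqP; rewrite eq_complex /=; apply/andP; split; apply/eqP; ring.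
by rewrite scaleN1r.
Qed.

Lemma inner_sa T x : bop T -> adj T = T -> inner (T x) x = (rin (T x) x)%:C.
Proof.
move=> bT aT; rewrite [LHS]inner_rin.
suff -> : rin (T x) ('i%C *: x) = 0 by [].
have h : rin (T x) ('i%C *: x) = - rin (T x) ('i%C *: x).
  rewrite -{1}rin_ii scale_ii rinNr -(linZ _ _ (bop_lin bT)) rin_adj // aT rinC //.

lra.
Qed.

(** The form Re <T x, i y> vanishes on the diagonal, hence is alternating; this is
    the symmetry of Re <T x, y> once y is replaced by i y. *)
Lemma pos_sa T : bop T -> pos T -> adj T = T.
Proof.
move=> bT pT; apply: adj_uniq => // x y; have lT := bop_lin bT.
have im z : rin (T z) ('i%C *: z) = 0.
  by have := pT z; rewrite inner_rin lecE /= => /andP[/eqP h _].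
have alt u v : rin (T u) ('i%C *: v) = - rin (T v) ('i%C *: u).
  have := im (u + v); rewrite linD // scalerDr !rinE !im; lra.
have := alt x ('i%C *: y); rewrite scale_ii rinNr linZ // rin_ii => /oppr_inj ->.
by rewrite rinC.
Qed.

Lemma pos_ge0 T x : pos T -> 0 <= rin (T x) x.
Proof. by move=> /(_ x); rewrite lecE /= => /andP[]. Qed.

Lemma rin_pos T : bop T -> adj T = T -> (forall x, 0 <= rin (T x) x) -> pos T.
Proof. by move=> bT aT h x; rewrite inner_sa // ler0c. Qed.

Lemma ople_rle S T : bop S -> bop T -> adj S = S -> adj T = T -> (ople S T <-> rle S T).
Proof.
move=> bS bT aS aT; split=> h x; have := h x; first by rewrite !inner_sa // lecR.
by rewrite !inner_sa // lecR.
Qed.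

Lemma ople_pos S T : pos S -> ople S T -> pos T.
Proof. by move=> pS h x; apply: le_trans (pS x) (h x). Qed.

(** p^2 <= c p, by positivity of p at c x - p x and p <= c at p x. *)
Lemma pos_sqr_le p (c : R) : bop p -> pos p -> 0 < c ->
  (forall x, rin (p x) x <= c * rin x x) -> forall x, rin (p x) (p x) <= c * rin (p x) x.
Proof.
move=> bp pp c0 pc x; set u := p x.
have := pos_ge0 (c%:C *: x - u) pp; rewrite (linB _ _ (bop_lin bp)) (linZ _ _ (bop_lin bp)) -/u.
have e : rin (p u) x = rin u u by rewrite rin_adj // (pos_sa bp pp).
rewrite !rinE e; have := pc u; move: (rin u u) (rin (p u) u) (rin u x) => A B C h1 h2.
by rewrite -(ler_pM2l c0); nra.
Qed.

Lemma pos_bnd p (c : R) : bop p -> pos p -> 0 < c ->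
  (forall x, rin (p x) x <= c * rin x x) -> bnd c p.
Proof.
move=> bp pp c0 pc x; have c0' := ltW c0.
rewrite le_nrm ?mulr_ge0 ?nrm_ge0 // exprMn nrm_sqr.
apply: le_trans (pos_sqr_le bp pp c0 pc x) _.
by rewrite expr2 -mulrA ler_pM2l.
Qed.

Lemma bnd_rle T (c : R) x : bnd c T -> rin (T x) x <= c * rin x x.
Proof.
move=> h; apply: le_trans (ler_norm _) _; apply: le_trans (rin_CS _ _) _.
by rewrite -nrm_sqr expr2 mulrA ler_wpM2r ?nrm_ge0.
Qed.

Lemma posD S T : pos S -> pos T -> pos (S + T).
Proof. by move=> hS hT x; rewrite innerDl addr_ge0. Qed.
Lemma pos0 : pos (0 : K -> K).
Proof. by move=> x; rewrite inner0l. Qed.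
Lemma posZ (r : R) T : 0 <= r -> pos T -> pos (r%:C *: T).
Proof. by move=> r0 hT x; rewrite innerZl mulr_ge0 // ler0c. Qed.

(** The positivity through which a positive linear map inherits norm
    bounds. *)
Lemma pos_sub_adj_comp T (c : R) : 0 <= c -> bop T -> bnd c T ->
  pos ((c ^+ 2)%:C *: id - (adj T \o T)).
Proof.
move=> c0 bT hT; have bid := @bop_id R K; have bTT := bop_comp (adj_bop bT) bT.
apply: rin_pos; first by apply: bopB => //; exact: bopZ.
  rewrite adjB //; last exact: bopZ.
  by rewrite adjZ // adj_id conjC_real (adj_comp (adj_bop bT) bT) adjK.
move=> x; rewrite !fctE rinDl rinNl rinZl /= rin_adjr // subr_ge0 -!nrm_sqr -exprMn.
by rewrite ler_sqr ?nnegrE ?mulr_ge0 ?nrm_ge0.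
Qed.
Lemma pos_adj_comp (L : hilbertType R) (T : K -> L) : bop T -> pos (adj T \o T).
Proof. by move=> bT x; rewrite /= inner_adjr // inner_diag ler0c rin_ge0. Qed.
End Positive.

Section VonNeumann.
Variables (R : realType) (K : hilbertType R) (M : set (K -> K)).
Hypothesis vM : von_neumann M.
Implicit Types (a b d : K -> K).

Lemma vn_wspan a : wspan M a -> M a. Proof. by case: vM => _ _ _ ->. Qed.
Lemma vn_bop : M `<=` @bop R K K.
Proof. by case: vM => _ _ _ e a; rewrite -{1}e; exact: wspan_bop. Qed.
Lemma vn_id : M id. Proof. by case: vM. Qed.
Lemma vn_comp a b : M a -> M b -> M (a \o b). Proof. by case: vM => _ h _ _; exact: h. Qed.
Lemma vn_adj a : M a -> M (adj a). Proof. by case: vM => _ _ h _; exact: h. Qed.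
Lemma vn_comb (c : R[i]) a b : M a -> M b -> M (c *: a + b).
Proof. by case: vM => _ _ _ <-; exact: wspan_comb. Qed.
Lemma vn0 : M 0. Proof. by case: vM => _ _ _ <-; exact: wspan0. Qed.
Lemma vnD a b : M a -> M b -> M (a + b).
Proof. by case: vM => _ _ _ <-; exact: wspanD. Qed.
Lemma vnB a b : M a -> M b -> M (a - b).
Proof. by case: vM => _ _ _ <-; exact: wspanB. Qed.
Lemma vnN a : M a -> M (- a).
Proof. by case: vM => _ _ _ <-; exact: wspanN. Qed.
Lemma vnZ c a : M a -> M (c *: a).
Proof. by case: vM => _ _ _ <-; exact: wspanZ. Qed.
Lemma vn_lin a : M a -> linear a. Proof. by move=> /vn_bop/bop_lin. Qed.
Lemma vn_wapprox a : bop a -> wapprox M a -> M a.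
Proof.
move=> ba h; apply/vn_wspan/wspan_closed => // s e e0.
by have [X MX hX] := h s e e0; exists X => //; apply: sub_wspan => //; exact: vn_bop.
Qed.
Lemma vn_sum (I : Type) (r : seq I) (P : pred I) (F : I -> K -> K) :
  (forall i, P i -> M (F i)) -> M (\sum_(i <- r | P i) F i).
Proof. by move=> h; apply: big_ind => //; [exact: vn0|exact: vnD]. Qed.

Lemma vn_seq_limit (a : nat -> K -> K) (c : R) : 0 <= c ->
  (forall n, M (a n)) -> (forall n, bnd c (a n)) ->
  (forall x (e : R), 0 < e -> exists N : nat, forall n m, (N <= n)%N -> (N <= m)%N ->
     nrm (a n x - a m x) < e) ->
  exists A, [/\ M A, bnd c A & forall x, seq_cvg (fun n => a n x) (A x)].
Proof.
move=> c0 Ma ba ca.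
have /choice[A hA] : forall x, exists y, seq_cvg (fun n => a n x) y.
  by move=> x; apply: cauchy_seq_cvg; exact: ca.
have bA : bnd c A.
  move=> x; apply/ler_addgt0Pr => e e0; have [N /(_ N (leqnn N)) hN] := hA x e e0.
  have := nrmD (A x - a N x) (a N x); have := ba N x.
  by rewrite subrK (nrmB (A x)); lra.
have lA : linear A.
  move=> k x y; apply: seq_cvg_uniq (hA _) _ => e e0; pose m := complex.Re `|k|.
  have m0 : 0 <= m by rewrite -ler0c RRe_real ?normr_real.
  have em : 0 < e / (2 * (m + 1)) by rewrite divr_gt0 // mulr_gt0 // ltr_wpDl.
  have e2 : 0 < e / 2 by lra.
  have [N hN] := hA x _ em; have [N' hN'] := hA y _ e2.
  exists (maxn N N') => n; rewrite geq_max => /andP[/hN h1 /hN' h2].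
  rewrite (vn_lin (Ma n)) opprD addrACA -scalerBr.
  apply: le_lt_trans (nrmD _ _) _; rewrite nrmZ -/m.
  have : (m + 1) * nrm (a n x - A x) <= (m + 1) * (e / (2 * (m + 1))).
    by rewrite ler_wpM2l ?addr_ge0 // ltW.
  have -> : (m + 1) * (e / (2 * (m + 1))) = e / 2 by field; lra.
  have := nrm_ge0 (a n x - A x); nra.
exists A; split=> //; apply: vn_wapprox; first exact: bnd_bop bA.
move=> s e e0.
suff [N hN] : exists N : nat, forall n, (N <= n)%N ->
    forall p, p \in s -> `|rin (A p.1 - a n p.1) p.2| < e.
  by exists (a N); [exact: Ma|exact: hN].
elim: s => [|p s [N hN]]; first by exists 0%N.
have ep : 0 < e / (nrm p.2 + 1) by rewrite divr_gt0 // ltr_wpDl // nrm_ge0.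
have [N' hN'] := hA p.1 _ ep.
exists (maxn N N') => n; rewrite geq_max => /andP[/hN h1 /hN' h2] q.
rewrite inE => /orP[/eqP ->|]; last exact: h1.
apply: le_lt_trans (rin_CS _ _) _; rewrite nrmB.
move: h2; rewrite ltr_pdivlMr ?ltr_wpDl ?nrm_ge0 // mulrDr mulr1.
by have := nrm_ge0 (a n p.1 - A p.1); lra.
Qed.

(** Banach's fixed point theorem for operators of M, the norm being expressed by
    [bnd].  Resolvents and Cayley-type transforms are obtained from it, which
    dispenses with functional calculus. *)
Lemma vn_fixpoint (P : set (K -> K)) (F : (K -> K) -> K -> K) (k : R) a0 :
  0 <= k -> k < 1 -> P `<=` M -> P a0 -> (forall a, P a -> P (F a)) ->
  (forall a, M a -> (forall e : R, 0 < e -> exists2 b, P b & bnd e (a - b)) -> P a) ->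
  (forall a b (C : R), P a -> P b -> 0 <= C -> bnd C (a - b) -> bnd (k * C) (F a - F b)) ->
  exists2 a, P a & F a = a.
Proof.
move=> k0 k1 PM Pa0 PF Pcl Fk.
pose a n := iter n F a0.
have Pa n : P (a n) by elim: n => //= n; exact: PF.
have Ma n : M (a n) by exact/PM/Pa.
have [C C0 hC] := bop_bnd (vn_bop (vnB (Ma 1%N) (Ma 0%N))).
have step n : bnd (k ^+ n * C) (a n.+1 - a n).
  elim: n => [|n IH]; first by rewrite expr0 mul1r.
  rewrite exprS -mulrA; apply: (Fk (a n.+1) (a n)) IH => //.
  by apply: mulr_ge0; [exact: exprn_ge0|exact: ltW].
pose E n := k ^+ n * C / (1 - k).
have k1' : 0 < 1 - k by lra.
have E0 n : 0 <= E n by apply: divr_ge0; [apply: mulr_ge0; [exact: exprn_ge0|exact: ltW]|exact: ltW].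
have tail n j : bnd (E n - E (n + j)%N) (a (n + j)%N - a n).
  elim: j => [|j IH] x; first by rewrite addn0 !subrr mul0r nrm0.
  rewrite addnS; have h1 := IH x; have h2 := step (n + j)%N x.
  have -> : E n - E (n + j).+1 = (E n - E (n + j)%N) + k ^+ (n + j) * C.
    rewrite /E exprS; field; lra.
  rewrite mulrDl; have := nrmD (a (n + j).+1 x - a (n + j)%N x) (a (n + j)%N x - a n x).
  by rewrite addrA subrK; move: h1 h2; rewrite !fctE; lra.
have tail' n m : (n <= m)%N -> bnd (E n) (a m - a n).
  move=> nm x; have := tail n (m - n)%N x; rewrite subnKC // => h.
  by apply: le_trans h _; rewrite ler_wpM2r ?nrm_ge0 // gerBl.
have Esmall (e : R) : 0 < e -> exists N : nat, E N < e.
  move=> e0; have ec : 0 < e * (1 - k) / C by rewrite divr_gt0 // mulr_gt0.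
  have kn : `|k| < 1 by rewrite ger0_norm.
  have /cvgrPdist_lt /(_ _ ec)[N _ /(_ N (leqnn N))] := cvg_expr kn.
  rewrite sub0r normrN ger0_norm ?exprn_ge0 // => h; exists N.
  by rewrite /E ltr_pdivrMr // -ltr_pdivlMr.
have cau x (e : R) : 0 < e -> exists N : nat, forall n m, (N <= n)%N -> (N <= m)%N ->
     nrm (a n x - a m x) < e.
  move=> e0; have ex : 0 < e / (2 * (nrm x + 1)) by rewrite divr_gt0 // mulr_gt0 // ltr_wpDl // nrm_ge0.
  have [N hN] := Esmall _ ex; exists N => n m /tail'/(_ x) h1 /tail'/(_ x) h2.
  have := nrm_tri (a n x) (a N x) (a m x); rewrite (nrmB (a N x)).
  move: h1 h2 hN; rewrite !fctE ltr_pdivlMr ?mulr_gt0 ?ltr_wpDl ?nrm_ge0 //.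
  have : 0 <= E N * nrm x by rewrite mulr_ge0 ?nrm_ge0.
  by have := E0 N; lra.
have [c c0 hc] := bop_bnd (vn_bop (Ma 0%N)).
have ab n : bnd (E 0%N + c) (a n).
  move=> x; have := tail' 0%N n (leq0n n) x; have := hc x; rewrite !fctE.
  by have := nrmD (a n x - a 0%N x) (a 0%N x); rewrite subrK mulrDl; lra.
have [A [MA bA hA]] := vn_seq_limit (addr_ge0 (E0 0%N) (ltW c0)) Ma ab cau.
have lim n : bnd (E n) (A - a n).
  move=> x; apply/ler_addgt0Pr => e e0; have [N hN] := hA x e e0.
  have := tail' n (maxn n N) (leq_maxl _ _) x; have := hN _ (leq_maxr n N).
  have := nrm_tri (A x) (a (maxn n N) x) (a n x); rewrite (nrmB (A x) (a (maxn n N) x)) !fctE; lra.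
have PA : P A.
  by apply: Pcl => // e /Esmall[N hN]; exists (a N) => // x; apply: le_trans (lim N x) _;
    rewrite ler_wpM2r ?nrm_ge0 // ltW.
exists A => //; apply/funext => x; apply/eqP; rewrite -subr_eq0; apply/eqP/nrm_small => e e0.
have ex : 0 < e / (2 * (nrm x + 1)) by rewrite divr_gt0 // mulr_gt0 // ltr_wpDl // nrm_ge0.
have [N hN] := Esmall _ ex.
have h1 := Fk _ _ _ PA (Pa N) (E0 N) (lim N) x.
have h2 := lim N.+1 x.
have := nrm_tri (F A x) (a N.+1 x) (A x); rewrite (nrmB (a N.+1 x)).
move: h1 h2 hN; rewrite !fctE ltr_pdivlMr ?mulr_gt0 ?ltr_wpDl ?nrm_ge0 //=.
have : 0 <= E N * nrm x by rewrite mulr_ge0 ?nrm_ge0.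
have EN : E N.+1 = k * E N by rewrite /E exprS -!mulrA.
have : k * E N * nrm x <= E N * nrm x by rewrite -mulrA; apply: ler_piMl; [exact: mulr_ge0 (E0 N) (nrm_ge0 _)|exact: ltW].
by have := E0 N; rewrite EN; lra.
Qed.
End VonNeumann.

(** * Resolvents and increasing nets *)

Section Inverse.
Variables (R : realType) (K : hilbertType R).
Implicit Types (s b : K -> K).

(** b is the inverse of 1 + s. *)
Definition is_res s b := (forall x, b x + s (b x) = x) /\ (forall x, b (x + s x) = x).

Lemma res_rin s b x : bop s -> bop b -> pos s -> is_res s b ->
  rin (b x) x = rin (b x) (b x) + rin (s (b x)) (b x).
Proof. by move=> bs bb ps [h _]; rewrite -{2}(h x) rinDr (rinC _ (s _)). Qed.

Lemma res_sa s b : bop s -> bop b -> pos s -> is_res s b -> adj b = b.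
Proof.
move=> bs bb ps [h _]; apply: adj_uniq => // x y.
rewrite -{1}(h y) -{2}(h x) !rinE; congr (_ + _).
by rewrite [RHS]rin_adj // (pos_sa bs ps).
Qed.

Lemma res_pos s b : bop s -> bop b -> pos s -> is_res s b -> pos b.
Proof.
move=> bs bb ps hb; apply: rin_pos => //; first exact: res_sa hb.
move=> x; rewrite (res_rin _ bs bb ps hb) addr_ge0 ?rin_ge0 //; exact: pos_ge0.
Qed.

Lemma res_le1 s b x : bop s -> bop b -> pos s -> is_res s b -> rin (b x) x <= rin x x.
Proof.
move=> bs bb ps hb; rewrite (res_rin _ bs bb ps hb) -{5 6}(hb.1 x) !rinE.
have := pos_ge0 (b x) ps; have := rin_ge0 (s (b x)); rewrite (rinC (b x) (s _)); lra.
Qed.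

Lemma res_nrm s b : bop s -> bop b -> pos s -> is_res s b -> bnd 1 b.
Proof.
move=> bs bb ps hb; apply: pos_bnd => //; first exact: res_pos hb.
by move=> x; rewrite mul1r; exact: res_le1 hb.
Qed.

(** In terms of s: s/(1+s) <= s. *)
Lemma res_ge s b x : bop s -> bop b -> pos s -> is_res s b ->
  rin x x - rin (b x) x <= rin (s x) x.
Proof.
move=> bs bb ps hb; have ls := bop_lin bs; set y := b x.
have -> : x = y + s y by rewrite (hb.1 x).
rewrite (linD _ _ ls) !rinE (rinC y (s y)).
have := pos_ge0 (s y) ps; have := rin_ge0 (s y).
have -> : rin (s (s y)) y = rin (s y) (s y) by rewrite rin_adj // (pos_sa bs ps).
lra.
Qed.

(** In terms of s: s <= 2 s/(1+s), as 1 + s <= 2. *)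
Lemma res_half s b x : bop s -> bop b -> pos s -> is_res s b ->
  (forall x, rin (s x) x <= rin x x) ->
  rin (s x) x <= 2 * (rin x x - rin (b x) x).
Proof.
move=> bs bb ps hb s1; have ls := bop_lin bs; set y := b x.
have -> : x = y + s y by rewrite (hb.1 x).
have c1 x' : rin (s x') x' <= 1 * rin x' x' by rewrite mul1r.
have := pos_sqr_le bs ps ltr01 c1 y; have := s1 (s y).
have e : rin (s (s y)) y = rin (s y) (s y) by rewrite rin_adj // (pos_sa bs ps).
rewrite (linD _ _ ls) !rinE e (rinC y (s y)); lra.
Qed.

(** With z = b x and y = c x, the difference of the forms of b and c at x is
    <(1+s)(z-y), z-y> + <(t-s)y, y>. *)
Lemma res_anti s t b c : bop s -> bop t -> pos s -> pos t -> bop b -> bop c ->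
  is_res s b -> is_res t c -> rle s t -> rle c b.
Proof.
move=> bs bt ps pt bb bc hb hc st x; set y := c x; set z := b x.
have ez : x = z + s z by rewrite (hb.1 x).
have ey : x = y + t y by rewrite (hc.1 x).
have := pos_ge0 (z - y) ps; have := rin_ge0 (z - y); have := st y.
have e1 : rin z x = rin z z + rin (s z) z by rewrite ez !rinE (rinC z (s z)).
have e2 : rin y x = rin y y + rin (t y) y by rewrite ey !rinE (rinC y (t y)).
have e3 : rin y x = rin z y + rin (s z) y by rewrite ez !rinE (rinC y z) (rinC y (s z)).
have e4 : rin (s y) z = rin (s z) y by rewrite rin_adj // (pos_sa bs ps) rinC.
rewrite (linB _ _ (bop_lin bs)) !rinE e4 (rinC y z); lra.
Qed.

End Inverse.

Section VonNeumann.
Variables (R : realType) (K : hilbertType R) (M : set (K -> K)).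
Hypothesis vM : von_neumann M.
Implicit Types (a b d s : K -> K).

(** For 0 <= s <= c the map b |-> (1 + (c - s) b)/(1 + c) contracts with ratio
    c/(1+c), and its fixed point is a right inverse of 1 + s; injectivity of
    1 + s makes it a two-sided inverse. *)
Lemma vn_res s : M s -> pos s -> exists2 b, M b & is_res s b.
Proof.
move=> Ms ps; have bs := vn_bop vM Ms; have [c c0 hc] := bop_bnd bs.
have ls := bop_lin bs.
pose q := (1 + c)^-1; have q0 : 0 < q by rewrite invr_gt0 addr_gt0.
have c1 : 1 + c != 0 by apply: lt0r_neq0; rewrite addr_gt0.
pose F (b : K -> K) : K -> K := q%:C *: (id + (c%:C *: b - (s \o b))).
have bcs : bop (c%:C *: id - s) by apply: bopB => //; apply: bopZ; exact: bop_id.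
have scs : adj (c%:C *: id - s) = c%:C *: id - s.
  rewrite adjB ?adjZ ?adj_id ?(pos_sa bs ps) ?conjC_real //; try exact: bop_id.
  by apply: bopZ; exact: bop_id.
have hcs : bnd c (c%:C *: id - s).
  apply: pos_bnd => //; last first.
    by move=> x; rewrite !fctE !rinE; have := pos_ge0 x ps; lra.
  apply: rin_pos => // x; rewrite !fctE !rinE.
  by have := bnd_rle x hc; lra.
have FM b : M b -> M (F b).
  by move=> Mb; apply: vnZ => //; apply: vnD => //; [exact: vn_id|apply: vnB => //; [exact: vnZ|exact: vn_comp]].
have [|||||||b Mb Fb] := @vn_fixpoint R K M vM M F (c / (1 + c)) 0.
- by rewrite divr_ge0 // ltW // addr_gt0.
- by rewrite ltr_pdivrMr ?addr_gt0 //; lra.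
- by [].
- exact: vn0.
- exact: FM.
- by [].
- move=> a b C Ma Mb C0 hC x.
  have -> : (F a - F b) x = q%:C *: (c%:C *: id - s) ((a - b) x).
    rewrite !fctE /F /= !fctE (linB _ _ ls) -scalerBr; congr (_ *: _).
    rewrite opprD addrACA subrr add0r scalerBr !opprB addrACA.
    by rewrite [RHS]addrACA [in RHS](addrC (- (_ *: _))).
  rewrite nrmZr gtr0_norm //; apply: le_trans (_ : q * (c * (C * nrm x)) <= _).
    rewrite ler_wpM2l ?(ltW q0) //; apply: le_trans (hcs _) _.
    by rewrite ler_wpM2l ?(ltW c0) // hC.
  by rewrite (_ : q * _ = c / (1 + c) * C * nrm x) // /q; field.
have hb x : b x + s (b x) = x.
  have := congr1 (fun f => (1 + c)%:C *: f x) Fb.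
  rewrite /F !fctE /= scalerA -rmorphM /q mulfV // scale1r rmorphD /= scalerDl scale1r.
  move/(canRL (addrK _)) => e.
  by rewrite [RHS]e opprB -addrA (addrCA (c%:C *: _)) subrr addr0.
exists b => //; split=> // x.
have inj u : u + s u = 0 -> u = 0.
  move=> hu; apply: rin_eq0; apply/eqP; rewrite eq_le rin_ge0 andbT.
  have : rin (u + s u) u = 0 by rewrite hu rin0l.
  by rewrite rinDl; have := pos_ge0 u ps; lra.
apply/eqP; rewrite -subr_eq0; apply/eqP/inj; rewrite (linB _ _ ls).
by rewrite addrACA hb -opprD subrr.
Qed.

(** Vigier's theorem.  For d0 <= d the operator d - d0 is positive and bounded
    by c, so |(d - d0) x|^2 <= c <(d - d0) x, x>, and convergence of the increasing
    forms makes the net d x Cauchy. *)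
Lemma vigier (D : set (K -> K)) (c : R) : 0 < c -> D !=set0 ->
  (forall d, D d -> M d /\ pos d) ->
  (forall a b, D a -> D b -> exists d, [/\ D d, ople a d & ople b d]) ->
  (forall d x, D d -> rin (d x) x <= c * rin x x) ->
  exists X, [/\ M X, pos X, forall d, D d -> ople d X &
    forall x (m : R), (forall d, D d -> rin (d x) x <= m) -> rin (X x) x <= m].
Proof.
move=> c0 [d00 Dd00] DM Ddir Dc.
have Db d : D d -> bop d by move=> /DM[/(vn_bop vM)].
have Dp d : D d -> pos d by move=> /DM[].
have Dsa d : D d -> adj d = d by move=> Dd; apply: pos_sa; [exact: Db|exact: Dp].
have Dle a b : D a -> D b -> (ople a b <-> rle a b).
  by move=> Da Db'; apply: ople_rle; [exact: Db|exact: Db|exact: Dsa|exact: Dsa].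
have up2 a b : D a -> D b -> exists2 d, D d & rle a d /\ rle b d.
  move=> Da Db'; have [d [Dd h1 h2]] := Ddir _ _ Da Db'; exists d => //.
  by split; [exact/Dle|exact/Dle].
have rtr a b d : rle a b -> rle b d -> rle a d by move=> h1 h2 x; apply: le_trans (h1 x) (h2 x).
have osc d0 d x : D d0 -> D d -> rle d0 d ->
    rin (d x - d0 x) (d x - d0 x) <= c * (rin (d x) x - rin (d0 x) x).
  move=> Dd0 Dd h.
  have bdd : bop (d - d0) by apply: bopB; exact: Db.
  have pdd : pos (d - d0).
    apply: rin_pos => // [|y]; first by rewrite adjB ?Dsa //; exact: Db.
    by rewrite !fctE !rinE subr_ge0.
  have := pos_sqr_le bdd pdd c0 _ x; rewrite !fctE (rinDl _ _ x) rinNl; apply => y.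
  rewrite rinDl rinNl; have := Dc _ y Dd; have := pos_ge0 y (Dp _ Dd0); lra.
have cau x (e : R) : 0 < e -> exists2 d0, D d0 & forall d, D d -> rle d0 d ->
    nrm (d x - d0 x) < e.
  move=> e0; pose V := [set rin (d x) x | d in D].
  have sV : has_sup V.
    split; first by exists (rin (d00 x) x), d00.
    by exists (c * rin x x) => _ [d Dd <-]; exact: Dc.
  have e2 : 0 < e ^+ 2 / c by rewrite divr_gt0 // exprn_gt0.
  have [_ [d0 Dd0 <-] hd0] := sup_adherent e2 sV; exists d0 => // d Dd h.
  rewrite -ltr_sqr ?nnegrE ?nrm_ge0 ?(ltW e0) // nrm_sqr.
  apply: le_lt_trans (osc _ _ _ Dd0 Dd h) _.
  have : rin (d x) x <= sup V by apply: (ub_le_sup sV.2); exists d.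
  rewrite -ltr_pdivlMl // mulrC => h2; lra.
(* y is the limit of the net of the d x *)
pose L x y := forall e : R, 0 < e -> exists2 d0, D d0 & forall d, D d -> rle d0 d -> nrm (d x - y) < e.
have /choice[X hX] : forall x, exists y, L x y.
  move=> x; have /choice[u hu] : forall n : nat, exists d0, D d0 /\
      forall d, D d -> rle d0 d -> nrm (d x - d0 x) < n.+1%:R^-1.
    move=> n; have hn : 0 < n.+1%:R^-1 :> R by rewrite invr_gt0.
    by have [d0 Dd0 h] := cau x _ hn; exists d0.
  have [y hy] : exists l, seq_cvg (fun n => u n x) l.
    apply: cauchy_seq_cvg => e e0; have e2 : 0 < e / 2 by lra.
    have [N hN] := inv_small e2; exists N => n m /hN hn /hN hm.
    have [d Dd [h1 h2]] := up2 _ _ (hu n).1 (hu m).1.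
    have := nrm_tri (u n x) (d x) (u m x); rewrite (nrmB (u n x) (d x)).
    have := (hu n).2 _ Dd h1; have := (hu m).2 _ Dd h2.
    set p := n.+1%:R^-1 in hn *; set q := m.+1%:R^-1 in hm *; lra.
  exists y => e e0; have e2 : 0 < e / 2 by lra.
  have [N hN] := inv_small e2; have [N' hN'] := hy _ e2.
  exists (u (maxn N N')); first exact: (hu _).1.
  move=> d Dd h; have h1 := (hu (maxn N N')).2 _ Dd h.
  have h2 := hN (maxn N N') (leq_maxl _ _); have h3 := hN' (maxn N N') (leq_maxr _ _).
  have := nrm_tri (d x) (u (maxn N N') x) y.
  set p := (maxn N N').+1%:R^-1 in h1 h2; lra.
have both x x' (e e' : R) : 0 < e -> 0 < e' -> exists2 d0, D d0 &
    forall d, D d -> rle d0 d -> nrm (d x - X x) < e /\ nrm (d x' - X x') < e'.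
  move=> e0 e0'; have [d1 Dd1 h1] := hX x _ e0; have [d2 Dd2 h2] := hX x' _ e0'.
  have [d Dd [k1 k2]] := up2 _ _ Dd1 Dd2; exists d => // d' Dd' k3; split.
    by apply: h1 => //; exact: rtr k3.
  by apply: h2 => //; exact: rtr k3.
have rr d : rle d d by move=> x.
have lX : linear X.
  move=> k x y; apply/eqP; rewrite -subr_eq0; apply/eqP/nrm_small => e e0.
  pose m := complex.Re `|k|.
  have m0 : 0 <= m by rewrite -ler0c RRe_real ?normr_real.
  have em : 0 < e / 3 / (m + 1) by rewrite !divr_gt0 // ltr_wpDl.
  have e3 : 0 < e / 3 by lra.
  have [d1 Dd1 h1] := both x y _ _ em e3; have [d2 Dd2 h2] := hX (k *: x + y) _ e3.
  have [d Dd [k1 k2]] := up2 _ _ Dd1 Dd2.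
  have [h3 h4] := h1 _ Dd k1; have h5 := h2 _ Dd k2.
  have := nrm_tri (X (k *: x + y)) (d (k *: x + y)) (k *: X x + X y).
  rewrite (nrmB (X (k *: x + y)) (d _)).
  rewrite {2}(bop_lin (Db _ Dd)) opprD addrACA -scalerBr.
  have := nrmD (k *: (d x - X x)) (d y - X y); rewrite nrmZ -/m.
  move: h3; rewrite ltr_pdivlMr ?ltr_wpDl //.
  have : 0 <= nrm (d x - X x) by exact: nrm_ge0.
  move: h5 h4; lra.
have bX : bnd c X.
  move=> x; apply/ler_addgt0Pr => e e0; have [d0 Dd0 /(_ _ Dd0 (rr _)) h] := hX x _ e0.
  have := nrmD (X x - d0 x) (d0 x); rewrite subrK nrmB.
  have := pos_bnd (Db _ Dd0) (Dp _ Dd0) c0 (fun x => Dc _ x Dd0) x; lra.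
have boX : bop X by apply: bnd_bop bX => //; exact: ltW.
have MX : M X.
  apply: vn_wapprox => // s e e0.
  suff [d0 Dd0 h] : exists2 d0, D d0 & forall d, D d -> rle d0 d ->
      forall p, p \in s -> `|rin (X p.1 - d p.1) p.2| < e.
    by exists d0; [exact: (DM _ Dd0).1|exact: h].
  elim: s => [|p s [d1 Dd1 h1]]; first by exists d00.
  have ep : 0 < e / (nrm p.2 + 1) by rewrite divr_gt0 // ltr_wpDl // nrm_ge0.
  have [d2 Dd2 h2] := hX p.1 _ ep.
  have [d Dd [k1 k2]] := up2 _ _ Dd1 Dd2; exists d => // d' Dd' k3 q.
  rewrite inE => /orP[/eqP ->|]; last by apply: h1 => //; exact: rtr k3.
  apply: le_lt_trans (rin_CS _ _) _; rewrite nrmB.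
  have := h2 _ Dd' (rtr _ _ _ k2 k3).
  rewrite ltr_pdivlMr ?ltr_wpDl ?nrm_ge0 // mulrDr mulr1.
  by have := nrm_ge0 (d' p.1 - X p.1); lra.
have approx x (e : R) d1 : 0 < e -> D d1 -> exists2 d, D d /\ rle d1 d &
    `|rin (d x) x - rin (X x) x| < e.
  move=> e0 Dd1; have ex : 0 < e / (nrm x + 1) by rewrite divr_gt0 // ltr_wpDl // nrm_ge0.
  have [d2 Dd2 h2] := hX x _ ex; have [d Dd [k1 k2]] := up2 _ _ Dd1 Dd2.
  exists d => //; rewrite -rinNl -rinDl; apply: le_lt_trans (rin_CS _ _) _.
  have := h2 _ Dd k2; rewrite ltr_pdivlMr ?ltr_wpDl ?nrm_ge0 // mulrDr mulr1.
  by have := nrm_ge0 (d x - X x); lra.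
have Xge d : D d -> rle d X.
  move=> Dd x; apply/ler_addgt0Pr => e e0.
  have [d' [Dd' /(_ x) h] ] := approx x e d e0 Dd.
  rewrite ltr_norml => /andP[_]; lra.
have aX : adj X = X.
  apply: adj_uniq => // x y; apply/eqP; rewrite -subr_eq0 -normr_le0.
  apply/ler_addgt0Pr => e e0; rewrite add0r.
  have e1 : 0 < e / 2 / (nrm y + 1) by rewrite !divr_gt0 // ltr_wpDl // nrm_ge0.
  have e1' : 0 < e / 2 / (nrm x + 1) by rewrite !divr_gt0 // ltr_wpDl // nrm_ge0.
  have [d Dd /(_ _ Dd (rr d))[h1 h2]] := both x y _ _ e1 e1'.
  have -> : rin (X x) y - rin x (X y) = rin x (d y - X y) - rin (d x - X x) y.
    have ed : rin (d x) y = rin x (d y) by rewrite rin_adj ?Dsa //; exact: Db.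
    by rewrite !rinE ed; lra.
  have := rin_CS (d x - X x) y; have := rin_CS x (d y - X y).
  move: h1 h2; rewrite !ltr_pdivlMr ?ltr_wpDl ?nrm_ge0 //.
  have := nrm_ge0 (d x - X x); have := nrm_ge0 (d y - X y).
  have := ler_normB (rin x (d y - X y)) (rin (d x - X x) y).
  lra.
have pX : pos X.
  apply: rin_pos => // x; apply: le_trans (pos_ge0 x (Dp _ Dd00)) (Xge _ Dd00 x).
exists X; split=> //.
  by move=> d Dd; apply/ople_rle => //; [exact: Db|exact: Dsa|exact: Xge].
move=> x m hm; apply/ler_addgt0Pr => e e0.
have [d [Dd _]] := approx x e d00 e0 Dd00.
by rewrite ltr_norml => /andP[h _]; have := hm _ Dd; lra.
Qed.

(** The limit given by Vigier's theorem lies in M, so it dominates the supremum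
    taken in M, and the supremum has the values of the limit. *)
Lemma increases_toP D X : increases_to M D X ->
  [/\ M X, pos X, forall d, D d -> rle d X &
    forall x (m : R), (forall d, D d -> rin (d x) x <= m) -> rin (X x) x <= m].
Proof.
move=> [[d0 Dd0] DM Ddir [MX DX Xleast]].
have bX := vn_bop vM MX.
have pX : pos X by apply: ople_pos (DX _ Dd0); exact: (DM _ Dd0).2.
have aX := pos_sa bX pX.
have Db d : D d -> bop d by move=> /DM[/(vn_bop vM)].
have Dsa d : D d -> adj d = d.
  by move=> Dd; apply: pos_sa; [exact: Db|exact: (DM _ Dd).2].
have Dle d : D d -> rle d X by move=> Dd; apply/ople_rle; [exact: Db| |exact: Dsa| |exact: DX].
have [c c0 hc] := bop_bnd bX.
have [||||Y [MY pY hY limY]] := @vigier D c c0 => //.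
- by exists d0.
- by move=> d x /Dle/(_ x) h; apply: le_trans h _; exact: bnd_rle.
have XY : ople X Y by exact: Xleast.
split=> // x m hm; have bY := vn_bop vM MY.
apply: le_trans (_ : rin (Y x) x <= _); last exact: limY.
by have /(ople_rle bX bY aX (pos_sa bY pY))/(_ x) := XY.
Qed.

Lemma increases_toI D X : D !=set0 -> (forall d, D d -> M d /\ pos d) ->
  (forall a b, D a -> D b -> exists d, [/\ D d, ople a d & ople b d]) ->
  M X -> adj X = X -> (forall d, D d -> ople d X) ->
  (forall x (m : R), (forall d, D d -> rin (d x) x <= m) -> rin (X x) x <= m) ->
  increases_to M D X.
Proof.
move=> [d0 Dd0] DM Ddir MX aX DX hX; split=> //; first by exists d0.
have bX := vn_bop vM MX.
split=> // Y MY DY; have bY := vn_bop vM MY.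
have pY : pos Y by apply: ople_pos (DY _ Dd0); exact: (DM _ Dd0).2.
apply/(ople_rle bX bY aX (pos_sa bY pY)) => x; apply: hX => d Dd.
have bd := vn_bop vM (DM _ Dd).1.
have [h _] := ople_rle bd bY (pos_sa bd (DM _ Dd).2) (pos_sa bY pY).
exact: h (DY _ Dd) x.
Qed.
Lemma vigier_increases D (c : R) : 0 < c -> D !=set0 ->
  (forall d, D d -> M d /\ pos d) ->
  (forall a b, D a -> D b -> exists d, [/\ D d, ople a d & ople b d]) ->
  (forall d x, D d -> rin (d x) x <= c * rin x x) -> exists X, increases_to M D X.
Proof.
move=> c0 D0 DM Ddir Dc; have [X [MX pX h1 h2]] := vigier c0 D0 DM Ddir Dc.
by exists X; apply: increases_toI => //; exact: (pos_sa (vn_bop vM MX)).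
Qed.
End VonNeumann.

(** * Normal functionals *)

Section NormalFunctional.
Variables (R : realType) (K : hilbertType R) (M : set (K -> K)).
Hypothesis vM : von_neumann M.
Implicit Types (a b d s : K -> K) (w : (K -> K) -> R).

Definition normal_functional w : Prop :=
  [/\ forall a b, M a -> M b -> w (a + b) = w a + w b,
      forall a, M a -> pos a -> 0 <= w a &
      forall D X, increases_to M D X -> forall m, (forall d, D d -> w d <= m) -> w X <= m].

Lemma normal_mono w a b : normal_functional w -> M a -> M b -> adj a = a -> adj b = b ->
  rle a b -> w a <= w b.
Proof.
move=> [wD w0 _] Ma Mb aa ab h; have ba := vn_bop vM Ma; have bb := vn_bop vM Mb.
have -> : b = a + (b - a) by rewrite addrC subrK.
have Mba : M (b - a) by exact: vnB.
rewrite wD // lerDl; apply: w0 => //.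
apply: rin_pos; [exact: bopB|by rewrite adjB ?aa ?ab|].
by move=> x; rewrite !fctE !rinE subr_ge0.
Qed.

Lemma normal_sum w (z : nat -> K -> K) (r : seq nat) : normal_functional w ->
  (forall i, M (z i)) -> w (\sum_(i <- r) z i) = \sum_(i <- r) w (z i).
Proof.
move=> [wD _ _] Mz.
have w0 : w 0 = 0 by apply: (addrI (w 0)); rewrite -wD ?addr0 //; exact: vn0.
elim: r => [|i r IH]; first by rewrite !big_nil.
by rewrite !big_cons wD ?IH //; exact: vn_sum.
Qed.

Lemma geo_sum (n m : nat) : \sum_(n <= i < m) (2^-1 : R) ^+ i <= 2 * 2^-1 ^+ n.
Proof.
have [nm|mn] := leqP n m; last first.
  by rewrite big_geq ?(ltnW mn) // mulr_ge0 // exprn_ge0.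
have -> : \sum_(n <= i < m) (2^-1 : R) ^+ i = 2 * 2^-1 ^+ n - 2 * 2^-1 ^+ m.
  elim: m nm => [|m IH]; first by rewrite leqn0 => /eqP ->; rewrite big_nil subrr.
  rewrite leq_eqVlt => /orP[/eqP <-|nm]; first by rewrite big_geq // subrr.
  rewrite big_nat_recr //= IH // exprS; lra.
by rewrite gerBl mulr_ge0 // exprn_ge0.
Qed.

(** Normality is about increasing nets, while sequences that converge to 0 are
    not monotone.  Suppose w (x n) >= e for all large n.  After extraction,
    q k (z j) < 2^-j for k <= j.  With s n m = z n + ... + z (m-1), the operators
    y n m = s/(1+s) are at most 1, increase with m and decrease with n, since
    s |-> s/(1+s) is operator monotone; they dominate z n / 2 and are dominated
    by s n m.  So Y n = sup_m (y n m) satisfies w (Y n) >= e/2 and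
    q k (Y n) <= 2^(1-n), and the infimum v of the Y n is killed by every q k,
    hence is 0.  Then 1 = sup (1 - Y n), and normality of w at this supremum
    contradicts w (Y n) >= e/2. *)
Lemma normal_vanish (q : nat -> (K -> K) -> R) w (x : nat -> K -> K) :
  (forall k, normal_functional (q k)) -> normal_functional w ->
  (forall y, M y -> pos y -> (forall k, q k y = 0) -> y = 0) ->
  (forall n, [/\ M (x n), pos (x n) & forall u, rin (x n u) u <= rin u u]) ->
  (forall k (e : R), 0 < e -> exists N : nat, forall n, (N <= n)%N -> q k (x n) < e) ->
  forall (e : R) (N : nat), 0 < e -> exists2 n, (N <= n)%N & w (x n) < e.
Proof.
move=> qn wn qsep hx qx e N e0; apply: contrapT => hcon.
have big n : (N <= n)%N -> e <= w (x n).
  by move=> Nn; rewrite leNgt; apply/negP => h; apply: hcon; exists n.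
have /choice[sb hsb] : forall j : nat, exists n, (N <= n)%N /\
    forall k, (k <= j)%N -> q k (x n) < 2^-1 ^+ j.
  move=> j; have ej : 0 < 2^-1 ^+ j :> R by rewrite exprn_gt0.
  have /choice[f hf] := fun k => qx k _ ej.
  exists (maxn N (\max_(k < j.+1) f k)); split; first exact: leq_maxl.
  move=> k kj; apply: hf; apply: leq_trans (leq_maxr _ _).
  by rewrite -ltnS in kj; apply: (leq_bigmax (Ordinal kj)).
pose z j := x (sb j).
have Mz j : M (z j) by case: (hx (sb j)).
have pz j : pos (z j) by case: (hx (sb j)).
have z1 j u : rin (z j u) u <= rin u u by have [_ _] := hx (sb j); exact.
pose s n m : K -> K := \sum_(n <= i < m) z i.
have Ms n m : M (s n m) by exact: vn_sum.
have ps n m : pos (s n m) by apply: big_ind => //; [exact: pos0|exact: posD].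
have bM a : M a -> bop a by exact: vn_bop.
have sle n n' m m' : (n' <= n)%N -> (m <= m')%N -> rle (s n m) (s n' m').
  move=> nn mm u; have [mn|nm] := leqP m n.
    by rewrite /s big_geq // rin0l; exact: pos_ge0 (ps n' m').
  have -> : s n' m' = s n' n + (s n m + s m m').
    rewrite /s -big_cat_nat ?(ltnW nm) //= -big_cat_nat //.
    exact: leq_trans (ltnW nm) mm.
  rewrite !fctE !rinE; have := pos_ge0 u (ps n' n); have := pos_ge0 u (ps m m'); lra.
have /choice[r hr] : forall nm : nat * nat, exists b, M b /\ is_res (s nm.1 nm.2) b.
  by move=> nm; have [b Mb hb] := vn_res vM (Ms nm.1 nm.2) (ps _ _); exists b.
pose y n m : K -> K := id - r (n, m).
have Mr n m : M (r (n, m)) by exact: (hr _).1.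
have resr n m : is_res (s n m) (r (n, m)) := (hr (n, m)).2.
have My n m : M (y n m) by apply: vnB => //; exact: vn_id.
have sr n m : adj (r (n, m)) = r (n, m) by apply: res_sa (resr n m) => //; exact: bM.
have aid := @adj_id R K.
have bid := @bop_id R K.
have sy n m : adj (y n m) = y n m by rewrite adjB ?sr ?aid //; exact: bM.
have yE n m u : rin (y n m u) u = rin u u - rin (r (n, m) u) u.
  by rewrite /y !fctE !rinE.
have py n m : pos (y n m).
  apply: rin_pos => //; first exact: bM.
  move=> u; rewrite yE subr_ge0; apply: res_le1 (resr n m) => //; exact: bM.
have y1 n m u : rin (y n m u) u <= rin u u.
  rewrite yE gerBl; apply: pos_ge0; apply: res_pos (resr n m) => //; exact: bM.
have yle n n' m m' : (n' <= n)%N -> (m <= m')%N -> rle (y n m) (y n' m').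
  move=> h h' u; rewrite !yE lerD2l lerN2.
  by apply: (res_anti _ _ _ _ _ _ (resr n m) (resr n' m')) => //; try exact: bM; exact: sle.
have ysle n m : rle (y n m) (s n m).
  by move=> u; rewrite yE; apply: res_ge (resr n m) => //; exact: bM.
have zle n m : (n < m)%N -> rle (z n) (y n m + y n m).
  move=> nm u; have [b Mb hb] := vn_res vM (Mz n) (pz n).
  have h1 := res_half u (bM _ (Mz n)) (bM _ Mb) (pz n) hb (z1 n).
  have h2 : rle (r (n, m)) b.
    apply: (res_anti _ _ _ _ _ _ hb (resr n m)) => //; try exact: bM.
    move=> v; have := @sle n n n.+1 m (leqnn n) nm v.
    by rewrite /s big_nat1.
  by rewrite !fctE rinDl !yE; have := h2 u; lra.
have op_r a b : M a -> M b -> adj a = a -> adj b = b -> rle a b -> ople a b.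
  by move=> Ma Mb aa ab h; apply/ople_rle => //; exact: bM.
pose D n := range (y n).
have DM n d : D n d -> M d /\ pos d by move=> [m _ <-].
have Ddir n a b : D n a -> D n b -> exists d, [/\ D n d, ople a d & ople b d].
  move=> [m _ <-] [m' _ <-]; exists (y n (maxn m m')); split; first by exists (maxn m m').
    by apply: op_r => //; apply: yle => //; exact: leq_maxl.
  by apply: op_r => //; apply: yle => //; exact: leq_maxr.
have Dc n d u : D n d -> rin (d u) u <= 1 * rin u u by move=> [m _ <-]; rewrite mul1r.
have D0 n : D n !=set0 by exists (y n 0%N), 0%N.
have /choice[Y incY] := fun n => vigier_increases vM ltr01 (D0 n) (@DM n) (@Ddir n) (@Dc n).
have hY n := increases_toP vM (incY n).
have MY n : M (Y n) by case: (hY n).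
have pY n : pos (Y n) by case: (hY n).
have sY n : adj (Y n) = Y n by apply: pos_sa => //; exact: bM.
have yY n m : rle (y n m) (Y n) by have [_ _ h _] := hY n; apply: h; exists m.
have Yle n n' : (n <= n')%N -> rle (Y n') (Y n).
  move=> nn u; have [_ _ _ h2] := hY n'; apply: h2 => _ [m _ <-].
  exact: le_trans (yle n' n m m nn (leqnn m) u) (yY n m u).
have Y1 n u : rin (Y n u) u <= rin u u.
  by have [_ _ _ h2] := hY n; apply: h2 => _ [m _ <-].
have qY k n : (k <= n)%N -> q k (Y n) <= 2 * 2^-1 ^+ n.
  move=> kn; have [_ _ qnorm] := qn k; apply: (qnorm _ _ (incY n)) => _ [m _ <-].
  apply: le_trans (normal_mono (qn k) (My n m) (Ms n m) _ _ (ysle n m)) _ => //.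
    by apply: pos_sa => //; exact: bM.
  rewrite (normal_sum _ (qn k)) //; apply: le_trans (geo_sum n m).
  rewrite big_nat_cond [leRHS]big_nat_cond; apply: ler_sum => i /andP[/andP[ni _] _].
  by apply/ltW/(hsb i).2; exact: leq_trans ni.
have wY n : e / 2 <= w (Y n).
  have h1 := big _ (hsb n).1; have [wD _ _] := wn.
  have h2 : w (z n) <= w (y n n.+1) + w (y n n.+1).
    rewrite -wD //; apply: normal_mono wn _ _ _ _ (zle n n.+1 (ltnSn n)) => //.
    - exact: vnD.
    - by apply: pos_sa => //; exact: bM.
    - by rewrite adjD ?sy //; exact: bM.
  have h3 : w (y n n.+1) <= w (Y n) by apply: normal_mono wn _ _ _ _ _ => //; exact: yY.
  by rewrite -/(z n) in h1; lra.
pose D' := range (fun n => (id - Y n : K -> K)).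
have MY' n : M (id - Y n) by apply: vnB => //; exact: vn_id.
have sY' n : adj (id - Y n) = id - Y n by rewrite adjB ?sY ?aid //; exact: bM.
have Y'E n u : rin ((id - Y n) u) u = rin u u - rin (Y n u) u by rewrite !fctE !rinE.
have [|||d u|X incX] := @vigier_increases R K M vM D' 1 ltr01.
- by exists (id - Y 0%N), 0%N.
- move=> _ [n _ <-]; split=> //; apply: rin_pos => //; first exact: bM.
  by move=> u; rewrite Y'E subr_ge0.
- move=> _ _ [n _ <-] [m _ <-]; exists (id - Y (maxn n m)); split; first by exists (maxn n m).
    apply: op_r => // u; rewrite !Y'E lerD2l lerN2; apply: Yle; exact: leq_maxl.
  apply: op_r => // u; rewrite !Y'E lerD2l lerN2; apply: Yle; exact: leq_maxr.
- by move=> [n _ <-]; rewrite Y'E mul1r gerBl; exact: pos_ge0.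
have [MX pX hX1 hX2] := increases_toP vM incX.
have sX : adj X = X by apply: pos_sa => //; exact: bM.
pose v : K -> K := id - X.
have Mv : M v by apply: vnB => //; exact: vn_id.
have sv : adj v = v by rewrite adjB ?sX ?aid //; exact: bM.
have vE u : rin (v u) u = rin u u - rin (X u) u by rewrite /v !fctE !rinE.
have pv : pos v.
  apply: rin_pos => //; first exact: bM.
  by move=> u; rewrite vE subr_ge0; apply: hX2 => _ [n _ <-]; rewrite Y'E gerBl; exact: pos_ge0.
have vY n : rle v (Y n).
  move=> u; have /(_ u) : rle (id - Y n) X by apply: hX1; exists n.
  by rewrite Y'E vE; lra.
have v0 : v = 0.
  apply: qsep => // k; apply/eqP; rewrite eq_le; apply/andP; split; last first.
    by have [_ h _] := qn k; exact: h.
  apply/ler_addgt0Pr => f f0; rewrite add0r.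
  have kn : `|2^-1 : R| < 1 by rewrite ger0_norm //; lra.
  have f2 : 0 < f / 2 by lra.
  have /cvgrPdist_lt /(_ _ f2)[n0 _ /(_ (maxn k n0) (leq_maxr _ _))] := cvg_expr kn.
  rewrite sub0r normrN ger0_norm ?exprn_ge0 // => h.
  have h1 := qY k (maxn k n0) (leq_maxl _ _).
  have := normal_mono (qn k) Mv (MY (maxn k n0)) sv (sY _) (vY _); lra.
have [wD _ wnorm] := wn.
have Xid : X = id by apply/esym/eqP; rewrite -subr_eq0 -/v v0.
have : w id <= w id - e / 2.
  rewrite -{1}Xid; apply: (wnorm _ _ incX) => _ [n _ <-].
  have -> : w id = w (id - Y n) + w (Y n) by rewrite -wD // subrK.
  by have := wY n; lra.
lra.
Qed.
End NormalFunctional.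

(** * Normal representations *)

Section Representation.
Variables (R : realType) (K H : hilbertType R) (M : set (K -> K)).
Variable (rho : (K -> K) -> (H -> H)).
Hypothesis vM : von_neumann M.
Implicit Types (a b d : K -> K).

Definition normal_rep : Prop :=
  [/\ linear_on M rho,
      [/\ forall a, M a -> bop (rho a),
          forall a b, M a -> M b -> rho (a \o b) = rho a \o rho b,
          forall a, M a -> rho (adj a) = adj (rho a) & rho id = id],
      forall a, M a -> pos a -> pos (rho a) &
      forall D X, increases_to M D X -> forall z (m : R),
        (forall d, D d -> rin (rho d z) z <= m) -> rin (rho X z) z <= m].

Hypothesis nrho : normal_rep.

Lemma repL c a b : M a -> M b -> rho (c *: a + b) = c *: rho a + rho b.
Proof. by case: nrho => h _ _ _; exact: h. Qed.
Lemma rep_bop a : M a -> bop (rho a). Proof. by case: nrho => _ [h _ _ _] _ _; exact: h. Qed.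
Lemma rep_comp a b : M a -> M b -> rho (a \o b) = rho a \o rho b.
Proof. by case: nrho => _ [_ h _ _] _ _; exact: h. Qed.
Lemma rep_adj a : M a -> rho (adj a) = adj (rho a).
Proof. by case: nrho => _ [_ _ h _] _ _; exact: h. Qed.
Lemma rep_id : rho id = id. Proof. by case: nrho => _ [_ _ _ h] _ _. Qed.
Lemma rep_pos a : M a -> pos a -> pos (rho a).
Proof. by case: nrho => _ _ h _; exact: h. Qed.
Lemma repD a b : M a -> M b -> rho (a + b) = rho a + rho b.
Proof. by move=> Ma Mb; rewrite -[a]scale1r repL // !scale1r. Qed.
Lemma rep0 : rho 0 = 0.
Proof. by have M0 := vn0 vM; apply: (addrI (rho 0)); rewrite -repD ?addr0. Qed.
Lemma repZ c a : M a -> rho (c *: a) = c *: rho a.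
Proof. by move=> Ma; rewrite -[_ *: a]addr0 repL ?rep0 ?addr0 //; exact: vn0. Qed.
Lemma repB a b : M a -> M b -> rho (a - b) = rho a - rho b.
Proof.
move=> Ma Mb; rewrite repD //; last exact: vnN.
by rewrite -scaleN1r repZ // scaleN1r.
Qed.

(** The operator c^2 - a^* a is positive, so its image is. *)
Lemma rep_bnd a (c : R) : 0 <= c -> M a -> bnd c a -> bnd c (rho a).
Proof.
move=> c0 Ma ha z; have ba := vn_bop vM Ma.
have Maa : M (adj a \o a) := vn_comp vM (vn_adj vM Ma) Ma.
have Mid := vn_id vM.
have Mp : M ((c ^+ 2)%:C *: id - (adj a \o a)) by apply: vnB => //; exact: vnZ.
have := pos_ge0 z (rep_pos Mp (pos_sub_adj_comp c0 ba ha)).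
rewrite repB //; last exact: vnZ.
rewrite repZ // rep_id rep_comp ?rep_adj //; last exact: vn_adj.
rewrite !fctE rinDl rinNl rinZl /= rin_adjr ?subr_ge0 -?nrm_sqr -?exprMn; last exact: rep_bop.
by rewrite ler_sqr ?nnegrE ?mulr_ge0 ?nrm_ge0.
Qed.

Lemma rep_functional z : normal_functional M (fun a => rin (rho a z) z).
Proof.
split=> [a b Ma Mb|a Ma pa|D X hX m]; first by rewrite /= repD // -rinDl.
  by apply: pos_ge0; exact: rep_pos.
by case: nrho => _ _ _ h; exact: h.
Qed.

Lemma id_functional x : normal_functional M (fun a => rin (a x) x).
Proof.
split=> [a b Ma Mb|a Ma pa|D X /(increases_toP vM)[_ _ _ h] m hm].
- by rewrite -rinDl.
- exact: pos_ge0.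
- exact: h.
Qed.

(** The quadratic forms at a dense sequence of vectors separate the positive
    operators: p^2 <= c p, so p vanishes at each of these vectors. *)
Lemma pos_dense_eq0 (L : hilbertType R) (p : L -> L) (q : nat -> L) : bop p -> pos p ->
  (forall x (e : R), 0 < e -> exists k, nrm (x - q k) < e) ->
  (forall k, rin (p (q k)) (q k) = 0) -> p = 0.
Proof.
move=> bp pp hq h; have lp := bop_lin bp; have [c c0 hc] := bop_bnd bp.
have pq k : p (q k) = 0.
  apply: rin_eq0; apply/eqP; rewrite eq_le rin_ge0 andbT.
  by have := pos_sqr_le bp pp c0 (fun x => bnd_rle x hc) (q k); rewrite h mulr0.
apply/funext => x; apply/nrm_small => e e0.
have [k hk] := hq x _ (divr_gt0 e0 c0).
rewrite -[x](subrK (q k)) (linD _ _ lp) pq addr0.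
by apply: le_trans (hc _) _; rewrite mulrC -ler_pdivlMr // ltW.
Qed.

Hypothesis rho_inj : forall a, M a -> rho a = 0 -> a = 0.

(** [normal_vanish] is used in both directions.  If rho (b n) converges, the
    squares |b n - b m|^2 / 4, of values in [0,1], tend to 0 on the functionals of
    H, which are separating because rho is injective; so they tend to 0 on those
    of K, and b n converges to some A.  Conversely the squares |b n - A|^2 / 4 tend
    to 0 on the functionals of K, so on those of H, and rho A is the limit. *)
Lemma rep_seq_limit (b : nat -> K -> K) (S : H -> H) :
  (forall n, M (b n)) -> (forall n, bnd 1 (b n)) ->
  (forall z, seq_cvg (fun n => rho (b n) z) (S z)) -> exists2 a, M a & rho a = S.
Proof.
move=> Mb bb hS.
have sq a : M a -> [/\ M (adj a \o a), pos (adj a \o a) &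
    (forall x, rin ((adj a \o a) x) x = rin (a x) (a x)) /\
    (forall z, rin (rho (adj a \o a) z) z = rin (rho a z) (rho a z))].
  move=> Ma; have ba := vn_bop vM Ma; have Ma' := vn_adj vM Ma; split.
  - exact: vn_comp.
  - exact: pos_adj_comp.
  - split=> z; first by rewrite /= rin_adjr.
    by rewrite rep_comp // rep_adj //= rin_adjr //; exact: rep_bop.
have half (a : K -> K) : M a -> bnd 2 a -> let x := (4^-1)%:C *: (adj a \o a) in
    [/\ M x, pos x, (forall u, rin (x u) u <= rin u u),
        forall u, rin (x u) u = 4^-1 * rin (a u) (a u) &
        forall z, rin (rho x z) z = 4^-1 * rin (rho a z) (rho a z)].
  move=> Ma ha x; have [M1 p1 [e1 e2]] := sq a Ma.
  have ex u : rin (x u) u = 4^-1 * rin (a u) (a u) by rewrite /x fctE rinZl e1.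
  split=> //.
  - exact: vnZ.
  - by apply: posZ => //; rewrite invr_ge0.
  - move=> u; rewrite ex -!nrm_sqr; have := ha u; have := nrm_ge0 (a u); have := nrm_ge0 u.
    by move: (nrm u) (nrm (a u)) => s t s0 t0 ts; nra.
  - by move=> z; rewrite repZ // fctE rinZl e2.
have bdif a a' : bnd 1 a -> bnd 1 a' -> bnd 2 (a - a').
  move=> h h' x; rewrite fctE; apply: le_trans (nrmD _ _) _; rewrite nrmN.
  by have := h x; have := h' x; lra.
have [qH hqH] := separable_seq H; have [qK hqK] := separable_seq K.
have cau x (e : R) : 0 < e -> exists N : nat, forall n m, (N <= n)%N -> (N <= m)%N ->
    nrm (b n x - b m x) < e.
  move=> e0; apply: contrapT => hcon.
  have /choice[g hg] : forall N : nat, exists p : nat * nat,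
      [/\ (N <= p.1)%N, (N <= p.2)%N & e <= nrm (b p.1 x - b p.2 x)].
    move=> N; apply: contrapT => h1; apply: hcon; exists N => n m Nn Nm.
    by rewrite ltNge; apply/negP => h2; apply: h1; exists (n, m).
  pose a j : K -> K := b (g j).1 - b (g j).2.
  have Ma j : M (a j) by apply: vnB.
  have ha j := half _ (Ma j) (bdif _ _ (bb (g j).1) (bb (g j).2)).
  pose X j := (4^-1)%:C *: (adj (a j) \o a j).
  have e4 : 0 < 4^-1 * e ^+ 2 by rewrite mulr_gt0 // ?invr_gt0 // exprn_gt0.
  have [|||||n _] := @normal_vanish R K M vM (fun k d => rin (rho d (qH k)) (qH k))
      (fun d => rin (d x) x) X _ _ _ _ _ (4^-1 * e ^+ 2) 0%N e4.
  - by move=> k; exact: rep_functional.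
  - exact: id_functional.
  - move=> y My py hy; apply: rho_inj => //; apply: (pos_dense_eq0 _ _ hqH) => //.
      exact: rep_bop.
    exact: rep_pos.
  - by move=> n; case: (ha n).
  - move=> k f f0; pose z := qH k.
    have f1 : 0 < Num.min 1 f by rewrite lt_min ltr01 f0.
    have [N hN] := hS z _ f1; exists N => n Nn.
    have [_ _ _ _ ->] := ha n; rewrite /a repB // -nrm_sqr fctE.
    have [h1 h2 _] := hg n.
    have h3 := hN _ (leq_trans Nn h1); have h4 := hN _ (leq_trans Nn h2).
    have := nrm_tri (rho (b (g n).1) z) (S z) (rho (b (g n).2) z).
    rewrite (nrmB (S z)); move: h3 h4; rewrite !lt_min => /andP[h3 h3'] /andP[h4 h4'].
    have := nrm_ge0 (rho (b (g n).1) z - rho (b (g n).2) z).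
    move: (nrm _) (nrm (_ - S z)) (nrm (_ - S z)) h3 h3' h4 h4' => s t u *; nra.
  have [_ _ _ -> _] := ha n; rewrite -nrm_sqr /a fctE.
  have [_ _ h1] := hg n; rewrite ltr_pM2l ?invr_gt0 // ltr_sqr ?nnegrE ?nrm_ge0 ?(ltW e0) //.
  by rewrite ltNge h1.
have [A [MA bA hA]] := vn_seq_limit vM ler01 Mb bb cau.
exists A => //; apply/funext => z; apply/eqP; rewrite -subr_eq0; apply/eqP/nrm_small => e e0.
pose a n : K -> K := b n - A.
have Ma n : M (a n) by apply: vnB.
have ha n := half _ (Ma n) (bdif _ _ (bb n) bA).
pose X n := (4^-1)%:C *: (adj (a n) \o a n).
have e2 : 0 < e / 2 by lra.
have e4 : 0 < 4^-1 * (e / 2) ^+ 2 by rewrite mulr_gt0 // ?invr_gt0 // exprn_gt0.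
have [N hN] := hS z _ e2.
have [|||||n Nn] := @normal_vanish R K M vM (fun k d => rin (d (qK k)) (qK k))
      (fun d => rin (rho d z) z) X _ _ _ _ _ (4^-1 * (e / 2) ^+ 2) N e4.
- by move=> k; exact: id_functional.
- exact: rep_functional.
- by move=> y My py hy; apply: (pos_dense_eq0 _ _ hqK) => //; exact: (vn_bop vM My).
- by move=> n; case: (ha n).
- move=> k f f0; have f1 : 0 < Num.min 1 f by rewrite lt_min ltr01 f0.
  have [N' hN'] := hA (qK k) _ f1; exists N' => n /hN'.
  rewrite lt_min => /andP[h1 h2].
  have [_ _ _ -> _] := ha n; rewrite -nrm_sqr /a fctE.
  by have := nrm_ge0 (b n (qK k) - A (qK k)); move: (nrm _) h1 h2 => s h1 h2 s0; nra.
have [_ _ _ _ ->] := ha n; rewrite /a repB // -nrm_sqr fctE.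
rewrite ltr_pM2l ?invr_gt0 // ltr_sqr ?nnegrE ?nrm_ge0 ?(ltW e2) // => h1.
have := nrm_tri (rho A z) (rho (b n) z) (S z); rewrite (nrmB (rho A z) (rho (b n) z)).
by have := hN n Nn; lra.
Qed.
End Representation.

(** * The range of a faithful normal representation is weakly closed *)

Section SquareResolvent.
Variables (R : realType) (H : hilbertType R).
Implicit Types (a b : H -> H).

Lemma sq_pos a : bop a -> adj a = a -> pos (a \o a).
Proof. by move=> ba aa; rewrite -{1}aa; exact: pos_adj_comp. Qed.

(** For a real number t in place of a: |2t/(1+t^2)| <= 1. *)
Lemma res_sq_bnd a b : bop a -> adj a = a -> is_res (a \o a) b ->
  forall x, 2 * nrm (a (b x)) <= nrm x.
Proof.
move=> ba aa [h _] x; set y := b x.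
have e : rin (a (a y)) y = rin (a y) (a y) by rewrite rin_adj // aa.
have : (2 * nrm (a y)) ^+ 2 <= nrm x ^+ 2.
  rewrite exprMn !nrm_sqr -(h x) -/y /= !rinE (rinC y (a (a y))) e.
  have := rin_ge0 (y - a (a y)); rewrite !rinE (rinC y (a (a y))) e; lra.
by rewrite ler_sqr ?nnegrE ?mulr_ge0 ?nrm_ge0.
Qed.

Lemma res_sq_comm a b : linear a -> is_res (a \o a) b -> forall x, a (b x) = b (a x).
Proof.
move=> la [h1 h2] x; have /= e2 := h2 (a (b x)); have /= e1 := h1 x.
by rewrite -e2 -(linD _ _ la) e1.
Qed.
End SquareResolvent.

Section ClosedRange.
Variables (R : realType) (K H : hilbertType R) (M : set (K -> K)).
Variable (rho : (K -> K) -> (H -> H)).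
Hypothesis vM : von_neumann M.
Hypothesis nrho : normal_rep M rho.
Hypothesis rho_inj : forall a, M a -> rho a = 0 -> a = 0.
Implicit Types (a b d : K -> K).

Let rbop := rep_bop nrho.
Let rcomp := rep_comp nrho.
Let radj := rep_adj nrho.
Let rid := rep_id nrho.
Let rbnd := rep_bnd vM nrho.
Let rL := repL nrho.
Let rD := repD nrho.
Let r0 := rep0 vM nrho.
Let rZ := repZ vM nrho.

Let P := rho @` M.
Let N := wspan P.

Lemma rep_image_bop : P `<=` @bop R H H.
Proof. by move=> _ [a Ma <-]; exact: rbop. Qed.

Lemma rep_image_lspan : lspan P `<=` P.
Proof.
apply: lspan_ind => [|c _ _ [a Ma <-] [b Mb <-]].
  by exists 0; [exact: vn0|exact: r0].
by exists (c *: a + b); [exact: vn_comb|exact: rL].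
Qed.

Lemma rep_image_vn : von_neumann N.
Proof.
have bP := rep_image_bop.
have Nid : N id by apply: sub_wspan => //; exists id; [exact: vn_id|exact: rid].
split=> //.
- move=> S T NS NT; have : wspan (setcomp P P) (S \o T).
    by apply: wspan_setcomp => //; exists S => //; exists T.
  apply: wspan_mono => // _ [_ [a Ma <-] [_ [b Mb <-] <-]].
  by exists (a \o b); [exact: vn_comp|exact: rcomp].
- move=> T NT; have := wspan_adj bP NT; apply: wspan_mono => // _ [_ [a Ma <-] <-].
  by exists (adj a); [exact: vn_adj|exact: radj].
- exact: wspan_id.
Qed.
Let vN := rep_image_vn.

(** A weak approximation rho a of G may be replaced by its real part, as G is
    self-adjoint; [weak_strong] then applies to the real subspace of the
    rho a with a self-adjoint. *)
Lemma rep_sa_approx G : N G -> adj G = G -> forall (k : nat) (z : 'I_k -> H) (e : R), 0 < e ->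
  exists2 a, M a /\ adj a = a & forall i, nrm (G (z i) - rho a (z i)) < e.
Proof.
move=> NG aG k z e e0.
have bG := vn_bop vN NG.
have [||||_ [a [Ma aa] <-] ha] := @weak_strong R H H
    [set rho a | a in [set a | M a /\ adj a = a]] G _ _ _ _ k z e e0.
- by exists 0; [split; [exact: vn0|exact: adj0]|exact: r0].
- move=> _ _ [a [Ma aa] <-] [b [Mb ab] <-]; exists (a + b); last exact: rD.
  by split; [exact: vnD|rewrite adjD ?aa ?ab //; exact: (vn_bop vM)].
- move=> r _ [a [Ma aa] <-]; exists (r%:C *: a); last exact: rZ.
  by split; [exact: vnZ|rewrite adjZ ?aa ?conjC_real //; exact: (vn_bop vM)].
- move=> s f f0; have /wspanP[_ hG] := NG.
  have [_ /rep_image_lspan[a Ma <-] ha] := hG (s ++ [seq (p.2, p.1) | p <- s]) f f0.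
  have Ma' := vn_adj vM Ma; have ba := vn_bop vM Ma.
  have Msum : M (a + adj a) by exact: vnD.
  exists (rho ((2^-1)%:C *: (a + adj a))).
    exists ((2^-1)%:C *: (a + adj a)) => //; split; first exact: vnZ.
    rewrite adjZ ?conjC_real; last exact: (vn_bop vM).
    by rewrite adjD ?adjK // 1?addrC //; exact: adj_bop.
  move=> p ps; rewrite rZ // rD // radj // !fctE.
  have h1 : `|rin (G p.1 - rho a p.1) p.2| < f by apply: ha; rewrite mem_cat ps.
  have h2 : `|rin (G p.2 - rho a p.2) p.1| < f.
    by apply: (ha (p.2, p.1)); rewrite mem_cat (map_f (fun p => (p.2, p.1)) ps) orbT.
  have br := rbop Ma.
  have -> : rin (G p.1 - (2^-1)%:C *: (rho a p.1 + adj (rho a) p.1)) p.2 =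
     2^-1 * rin (G p.1 - rho a p.1) p.2 + 2^-1 * rin (G p.2 - rho a p.2) p.1.
    rewrite !rinE rin_adjr // (rinC p.1) (rin_adj p.2 p.1 bG) aG (rinC p.2); lra.
  apply: le_lt_trans (ler_normD _ _) _; rewrite !normrM ger0_norm ?invr_ge0 //; lra.
by exists a.
Qed.

(** On the unit ball the map G |-> (T + T G^2)/2 is a contraction of ratio 1/2
    when |T| <= 1/2.  Its fixed point commutes with T and is self-adjoint, and
    2 G = T (1 + G^2). *)
Lemma half_cayley T : N T -> adj T = T -> bnd 2^-1 T ->
  exists G B, [/\ N G, adj G = G, N B, is_res (G \o G) B & forall x, T x = 2%:R%:C *: G (B x)].
Proof.
move=> NT aT hT; have bT := vn_bop vN NT; have lT := bop_lin bT.
pose Q := [set G | [/\ N G, adj G = G, G \o T = T \o G & bnd 1 G]].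
pose F (G : H -> H) : H -> H := (2^-1)%:C *: (T + (T \o (G \o G))).
have [|||||||G [NG aG cG bG] FG] := @vn_fixpoint R H N vN Q F 2^-1 0.
- by rewrite invr_ge0.
- by lra.
- by move=> G [].
- split; [exact: vn0|exact: adj0| |].
    by apply/funext => x; rewrite /= lin0.
  by move=> x; rewrite nrm0 mul1r nrm_ge0.
- move=> G [NG aG cG hG].
  have NGG : N (T \o (G \o G)) by do 2!apply: vn_comp => //.
  have boG := vn_bop vN NG; have lG := bop_lin boG.
  have cx x : G (T x) = T (G x) by exact: (congr1 (@^~ x) cG).
  have bGG := bop_comp boG boG.
  split.
  + by apply: vnZ => //; exact: vnD.
  + rewrite adjZ; last by apply: bopD => //; exact: vn_bop NGG.
    rewrite conjC_real adjD //; last exact: vn_bop NGG.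
    rewrite (adj_comp bT bGG) (adj_comp boG boG) aT aG; congr (_ *: (_ + _)); apply/funext => x /=.
    by rewrite !cx.
  + apply/funext => x; rewrite /F /= !fctE /= (linZ _ _ lT) (linD _ _ lT).
    by rewrite !cx.
  + move=> x; rewrite /F !fctE nrmZr ger0_norm ?invr_ge0 //=.
    have := nrmD (T x) (T (G (G x))); have := hT x; have := hT (G (G x)).
    have := hG x; have := hG (G x); have := nrm_ge0 x; lra.
- move=> G NG happ.
  have boG := vn_bop vN NG; have lG := bop_lin boG; have [c c0 hc] := bop_bnd bT.
  split=> //.
  + apply: adj_uniq => // x y; apply/eqP; rewrite -subr_eq0 -normr_le0.
    apply/ler_addgt0Pr => e e0; rewrite add0r.
    have e1 : 0 < e / (2 * (nrm x * nrm y + 1)).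
      by rewrite divr_gt0 // mulr_gt0 // ltr_wpDl // mulr_ge0 ?nrm_ge0.
    have [G' [NG' aG' _ _] hG'] := happ _ e1.
    have eG' : rin (G' x) y = rin x (G' y) by rewrite rin_adj ?aG' //; exact: vn_bop NG'.
    have -> : rin (G x) y - rin x (G y) = rin ((G - G') x) y - rin x ((G - G') y).
      by rewrite !fctE !rinE eG'; lra.
    apply: le_trans (ler_normB _ _) _.
    set f := e / _ in hG' e1.
    have k1 : `|rin ((G - G') x) y| <= f * nrm x * nrm y.
      by apply: le_trans (rin_CS _ _) _; rewrite ler_wpM2r ?nrm_ge0.
    have k2 : `|rin x ((G - G') y)| <= f * nrm x * nrm y.
      apply: le_trans (rin_CS _ _) _.
      by rewrite (mulrC f) -mulrA ler_wpM2l ?nrm_ge0.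
    have -> : e = f * (2 * (nrm x * nrm y + 1)).
      by rewrite /f divfK // lt0r_neq0 // mulr_gt0 // ltr_wpDl // mulr_ge0 ?nrm_ge0.
    lra.
  + apply/funext => x /=; apply/eqP; rewrite -subr_eq0; apply/eqP/nrm_small => e e0.
    have e1 : 0 < e / (2 * c * (nrm x + 1)).
      by rewrite divr_gt0 // !mulr_gt0 // ltr_wpDl // nrm_ge0.
    have [G' [NG' _ cG' _] hG'] := happ _ e1.
    have -> : G (T x) - T (G x) = (G - G') (T x) - T ((G - G') x).
      rewrite !fctE (linB _ _ lT); have -> : G' (T x) = T (G' x) by exact: (congr1 (@^~ x) cG').
      by rewrite opprB addrA subrK.
    apply: le_trans (nrmD _ _) _; rewrite nrmN.
    set f := e / _ in hG' e1.
    have k1 : nrm ((G - G') (T x)) <= f * (c * nrm x).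
      by apply: le_trans (hG' _) _; rewrite ler_pM2l.
    have k2 : nrm (T ((G - G') x)) <= c * (f * nrm x).
      by apply: le_trans (hc _) _; rewrite ler_pM2l.
    have -> : e = f * (2 * c * (nrm x + 1)).
      by rewrite /f divfK // lt0r_neq0 // !mulr_gt0 // ltr_wpDl // nrm_ge0.
    have : 0 < f * c by rewrite mulr_gt0.
    lra.
  + move=> x; apply/ler_addgt0Pr => e e0.
    have e1 : 0 < e / (nrm x + 1) by rewrite divr_gt0 // ltr_wpDl // nrm_ge0.
    have [G' [_ _ _ hG'] hGG'] := happ _ e1.
    have := nrmD ((G - G') x) (G' x); rewrite fctE subrK; have := hG' x; have := hGG' x.
    rewrite fctE; have : e / (nrm x + 1) * nrm x <= e.
      rewrite mulrAC ler_pdivrMr ?ltr_wpDl ?nrm_ge0 // ler_wpM2l ?(ltW e0) //; lra.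
    lra.
- move=> G G' C [NG _ _ hG] [NG' _ _ hG'] C0 hC x.
  have lG := vn_lin vN NG.
  have -> : (F G - F G') x = (2^-1)%:C *: T (G ((G - G') x) + (G - G') (G' x)).
    rewrite /F !fctE /= -scalerBr; congr (_ *: _).
    rewrite opprD addrACA subrr add0r -(linB _ _ lT); congr (T _).
    by rewrite (linB _ _ lG) addrA subrK.
  rewrite nrmZr ger0_norm ?invr_ge0 //.
  have := hT (G ((G - G') x) + (G - G') (G' x)).
  have := nrmD (G ((G - G') x)) ((G - G') (G' x)).
  have := hG ((G - G') x); have := hC x; have := hC (G' x); have := hG' x.
  have := nrm_ge0 x; set u := nrm (G' x); set t := nrm x; nra.
have boG := vn_bop vN NG; have lG := bop_lin boG.
have [B NB hB] := vn_res vN (vn_comp vN NG NG) (sq_pos boG aG).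
exists G, B; split=> // x.
have eG : G (B x) = (2^-1)%:C *: (T (B x) + T (G (G (B x)))).
  exact: esym (congr1 (@^~ (B x)) FG).
rewrite [in RHS]eG scalerA -{1}(hB.1 x) (linD _ _ lT).
have -> : (2%:R%:C * (2^-1)%:C : R[i]) = 1 by rewrite -rmorphM mulfV ?pnatr_eq0.
by rewrite scale1r.
Qed.

(** Kaplansky's density argument.  Write T = 2G/(1+G^2) and let a n be
    self-adjoint in M with rho (a n) -> G strongly, on enough vectors.  The elements
    b n = 2 a n/(1 + (a n)^2) of M are bounded by 1, and rho (b n) -> T strongly,
    because the difference is
    2 S (A - G) B - 2 A S (A - G) G B, where A = rho (a n), S = (1 + A^2)^-1 and
    B = (1 + G^2)^-1.  Then [rep_seq_limit] applies. *)
Lemma rep_closed_half T : N T -> adj T = T -> bnd 2^-1 T -> P T.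
Proof.
move=> NT aT hT; have [G [B [NG aG NB hB hTG]]] := half_cayley NT aT hT.
have bT := vn_bop vN NT; have lT := bop_lin bT.
have boG := vn_bop vN NG; have lG := bop_lin boG.
have boB := vn_bop vN NB; have lB := bop_lin boB.
have [q hq] := separable_seq H.
have /choice[a ha] : forall n : nat, exists a, [/\ M a, adj a = a &
    forall k, (k <= n)%N -> nrm (G (B (q k)) - rho a (B (q k))) < n.+1%:R^-1 /\
      nrm (G (G (B (q k))) - rho a (G (B (q k)))) < n.+1%:R^-1].
  move=> n; have hn : 0 < n.+1%:R^-1 :> R by rewrite invr_gt0.
  (* both families B (q k) and G (B (q k)), k <= n, in one tuple *)
  pose z (i : 'I_(n.+1 + n.+1)) := match fintype.split i with
    | inl j => B (q j) | inr j => G (B (q j)) end.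
  have [a [Ma aa] ha] := rep_sa_approx NG aG z hn; exists a; split=> // k.
  rewrite -ltnS => kn; split.
    have := ha (lshift n.+1 (Ordinal kn)); rewrite /z.
    by have -> : fintype.split (lshift n.+1 (Ordinal kn)) = inl (Ordinal kn) := unsplitK (inl _).
  have := ha (rshift n.+1 (Ordinal kn)); rewrite /z.
  by have -> : fintype.split (rshift n.+1 (Ordinal kn)) = inr (Ordinal kn) := unsplitK (inr _).
have Ma n : M (a n) by case: (ha n).
have aa n : adj (a n) = a n by case: (ha n).
have ba n : bop (a n) := vn_bop vM (Ma n).
have /choice[r hr] : forall n, exists r, M r /\ is_res (a n \o a n) r.
  move=> n; have [r Mr hr] := vn_res vM (vn_comp vM (Ma n) (Ma n)) (sq_pos (ba n) (aa n)).
  by exists r.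
have Mr n : M (r n) := (hr n).1.
pose b n : K -> K := 2%:R%:C *: (a n \o r n).
have Mar n : M (a n \o r n) by exact: vn_comp.
have Mb n : M (b n) by exact: vnZ.
have bb n : bnd 1 (b n).
  move=> x; rewrite /b fctE nrmZr ger0_norm // mul1r.
  exact: res_sq_bnd (ba n) (aa n) (hr n).2 x.
pose A n := rho (a n); pose S n := rho (r n).
have bA n : bop (A n) by exact: rbop.
have bS n : bop (S n) by exact: rbop.
have aA n : adj (A n) = A n by rewrite -radj // aa.
have res n : is_res (A n \o A n) (S n).
  have [h1 h2] := (hr n).2.
  have k1 : r n + ((a n \o a n) \o r n) = id by apply/funext => x; exact: h1.
  have k2 : r n \o (id + (a n \o a n)) = id by apply/funext => x; exact: h2.
  have Maa : M (a n \o a n) by exact: vn_comp.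
  have Mid := vn_id vM.
  have Maar : M ((a n \o a n) \o r n) by exact: vn_comp.
  split=> z.
    have := congr1 (fun f => rho f z) k1.
    by rewrite (rD (Mr n) Maar) (rcomp Maa (Mr n)) (rcomp (Ma n) (Ma n)) rid.
  have := congr1 (fun f => rho f z) k2.
  by rewrite (rcomp (Mr n) (vnD vM Mid Maa)) (rD Mid Maa) (rcomp (Ma n) (Ma n)) rid.
have eb n z : rho (b n) z = 2%:R%:C *: A n (S n z) by rewrite /b (rZ _ (Mar n)) (rcomp (Ma n) (Mr n)).
have diff n z : nrm (rho (b n) z - T z) <=
    2 * nrm (G (B z) - A n (B z)) + nrm (G (G (B z)) - A n (G (B z))).
  have lS := bop_lin (bS n); have lA := bop_lin (bA n).
  have cAS := res_sq_comm lA (res n).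
  set y := B z.
  have ez : z = y + G (G y) by rewrite (hB.1 z).
  have -> : rho (b n) z - T z =
     2%:R%:C *: S n (A n y - G y) - 2%:R%:C *: A n (S n (A n (G y) - G (G y))).
    rewrite eb hTG -/y -!scalerBr; congr (_ *: _).
    have [_ h2] := res n; have /= e2 := h2 (G y).
    rewrite ez; move: e2; move: (G (G y)) => g'; move: (G y) => g e2.
    have -> : A n (S n (y + g')) - g = A n (S n (y + g')) - (S n g + S n (A n (A n g))).
      by rewrite -(linD _ _ lS) e2.
    rewrite (linD _ _ lS) !(linB _ _ lA, linB _ _ lS) !cAS (linD _ _ lA) !cAS.
    by rewrite opprD addrACA opprB.
  apply: le_trans (nrmD _ _) _; rewrite nrmN !nrmZr ger0_norm //.
  have aSA n' := res_nrm (bop_comp (bA n') (bA n')) (bS n') (sq_pos (bA n') (aA n')) (res n').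
  have := aSA n (A n y - G y); rewrite mul1r (nrmB (A n y)) => h1.
  have := res_sq_bnd (bA n) (aA n) (res n) (A n (G y) - G (G y)).
  rewrite (nrmB (A n (G y))) => h2.
  by apply: lerD; rewrite ?ler_pM2l.
have bnd1 n : bnd 1 (rho (b n)) by exact: rbnd.
have lim z : seq_cvg (fun n => rho (b n) z) (T z).
  move=> e e0; have e4 : 0 < e / 4 by lra.
  have [k hk] := hq z _ e4.
  have e12 : 0 < e / 12 by lra.
  have [n0 hn0] := inv_small e12; exists (maxn k n0) => n; rewrite geq_max => /andP[kn /hn0 hn].
  have [_ _ /(_ k kn)[h1 h2]] := ha n.
  have h3 := diff n (q k).
  have := nrm_tri (rho (b n) z) (rho (b n) (q k)) (T z).
  have := nrm_tri (rho (b n) (q k)) (T (q k)) (T z).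
  have := bnd1 n (z - q k); rewrite (linB _ _ (bop_lin (rbop (Mb n)))).
  have := hT (q k - z); rewrite (linB _ _ lT) (nrmB (q k)).
  move: hn h1 h2 h3; rewrite -/(A n); set f := n.+1%:R^-1; have := nrm_ge0 (z - q k).
  lra.
by have [c Mc <-] := rep_seq_limit vM nrho rho_inj Mb bb lim; exists c.
Qed.

(** The real and imaginary parts of an element of the closure, scaled to norm at
    most 1/2, come under [rep_closed_half]. *)
Theorem rep_closed : wspan (rho @` M) = rho @` M.
Proof.
apply/seteqP; split; last exact/sub_wspan/rep_image_bop.
have comb c S T : P S -> P T -> P (c *: S + T).
  by move=> [a Ma <-] [b Mb <-]; exists (c *: a + b); [exact: vn_comb|exact: rL].
have P0 : P 0 by exists 0; [exact: vn0|exact: r0].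
have PZ c S : P S -> P (c *: S) by move=> PS; rewrite -[_ *: _]addr0; exact: comb.
have sa T : N T -> adj T = T -> P T.
  move=> NT aT; have bT := vn_bop vN NT; have [c c0 hc] := bop_bnd bT.
  pose t := (2 * c)^-1; have t0 : 0 < t by rewrite invr_gt0 mulr_gt0.
  have PT : P (t%:C *: T).
    apply: rep_closed_half; first exact: (vnZ vN).
      by rewrite adjZ // conjC_real aT.
    move=> x; rewrite fctE nrmZr gtr0_norm //.
    have -> : 2^-1 * nrm x = t * (c * nrm x) by rewrite /t; field; exact: lt0r_neq0.
    by rewrite ler_pM2l.
  have -> : T = (2 * c)%:C *: (t%:C *: T).
    by rewrite scalerA -rmorphM mulfV ?scale1r // lt0r_neq0 // mulr_gt0.
  exact: PZ.
move=> T NT; have bT := vn_bop vN NT; have NT' := vn_adj vN NT; have bT' := adj_bop bT.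
have e1 : P (T + adj T).
  by apply: sa; [exact: (vnD vN)|rewrite adjD // adjK // addrC].
have e2 : P ('i%C *: (T - adj T)).
  apply: sa; first by apply: (vnZ vN); exact: (vnB vN).
  rewrite adjZ ?adjB ?adjK //; last exact: bopB.
  have -> : Num.conj 'i%C = - 'i%C :> R[i] by apply/eqP; rewrite eq_complex /= oppr0 !eqxx.
  by rewrite scaleNr -scalerN opprB.
have -> : T = (2^-1)%:C *: (- 'i%C *: ('i%C *: (T - adj T)) + (T + adj T)).
  rewrite scalerA; have -> : (- 'i%C * 'i%C : R[i]) = 1.
    by apply/eqP; rewrite eq_complex /=; apply/andP; split; apply/eqP; ring.
  rewrite scale1r addrACA addNr addr0 -mulr2n -[T *+ 2]scaler_nat scalerA.
  have -> : ((2^-1)%:C * 2%:R : R[i]) = 1.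
    by rewrite -(rmorph_nat (real_complex R)) -rmorphM mulVf ?pnatr_eq0.
  by rewrite scale1r.
by apply/PZ/comb.
Qed.
End ClosedRange.

(** * The left regular representation *)

Section GNS.
Variables (R : realType) (K : hilbertType R).
Implicit Types (A N : set (K -> K)) (a b c d p : K -> K).

(** What the left regular representation needs to know about a pair consisting of
    an algebra A and a state or weight: N is the left ideal of square-integrable
    elements, hat its map into L^2.  States and weights both provide it. *)
Definition gns A N (H : hilbertType R) (hat : (K -> K) -> H) : Prop :=
  [/\ [/\ N 0, forall k b c, N b -> N c -> N (k *: b + c) &
          forall a b, A a -> N b -> N (a \o b)],
      linear_on N hat /\ dense (hat @` N),
      forall a b c, A a -> N b -> N c ->
        inner (hat (a \o b)) (hat c) = inner (hat b) (hat (adj a \o c)),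
      forall p b, A p -> pos p -> N b -> 0 <= rin (hat (p \o b)) (hat b) &
      forall D X, increases_to A D X -> forall b, N b -> forall m : R,
        (forall d, D d -> rin (hat (d \o b)) (hat b) <= m) -> rin (hat (X \o b)) (hat b) <= m].

Definition lreg N (H : hilbertType R) (hat : (K -> K) -> H) a : H -> H :=
  the_bop [set T | forall b, N b -> T (hat b) = hat (a \o b)].

End GNS.

Section GNSRep.
Variables (R : realType) (K H : hilbertType R) (A N : set (K -> K)).
Variable (hat : (K -> K) -> H).
Hypothesis vA : von_neumann A.
Hypothesis gA : gns A N hat.
Implicit Types (a b c d p : K -> K).

Lemma gns_comb k b c : N b -> N c -> N (k *: b + c).
Proof. by case: gA => [[_ h _] _ _ _ _]; exact: h. Qed.
Lemma gns_ideal a b : A a -> N b -> N (a \o b).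
Proof. by case: gA => [[_ _ h] _ _ _ _]; exact: h. Qed.
Lemma hat_comb k b c : N b -> N c -> hat (k *: b + c) = k *: hat b + hat c.
Proof. by case: gA => [_ [h _] _ _ _]; exact: h. Qed.
Lemma hat_dense z (e : R) : 0 < e -> exists2 b, N b & nrm (z - hat b) < e.
Proof.
by case: gA => [_ [_ /denseP h] _ _ _] /(h z)[_ [b Nb <-] hb]; exists b.
Qed.
Lemma hat_adj a b c : A a -> N b -> N c ->
  inner (hat (a \o b)) (hat c) = inner (hat b) (hat (adj a \o c)).
Proof. by case: gA => [_ _ h _ _]; exact: h. Qed.
Lemma gns_0 : N 0. Proof. by case: gA => [[]]. Qed.
Lemma hat0 : hat 0 = 0.
Proof.
have N0 := gns_0.
by have := hat_comb (-1) N0 N0; rewrite !scaleN1r !addNr.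
Qed.
Lemma gnsZ k b : N b -> N (k *: b).
Proof. by move=> Nb; rewrite -[k *: b]addr0; apply: gns_comb => //; exact: gns_0. Qed.
Lemma hatD b c : N b -> N c -> hat (b + c) = hat b + hat c.
Proof. by move=> Nb Nc; rewrite -[b]scale1r hat_comb // !scale1r. Qed.
Lemma hatZ k b : N b -> hat (k *: b) = k *: hat b.
Proof.
by move=> Nb; rewrite -[k *: b]addr0 hat_comb ?hat0 ?addr0 //; exact: gns_0.
Qed.
Lemma hatB b c : N b -> N c -> hat (b - c) = hat b - hat c.
Proof.
move=> Nb Nc; rewrite -[- c]scaleN1r -[- hat c]scaleN1r hatD ?hatZ //; exact: gnsZ.
Qed.
Lemma dense_lspan_hat : dense (lspan (hat @` N)).
Proof.
apply/denseP => x e /(hat_dense x)[b Nb hb]; exists (hat b) => //.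
by apply: sub_lspan; exists b.
Qed.

(** If a is bounded by k then k^2 - a^* a is a positive element of A, and its form
    at hat b is nonnegative. *)
Lemma hat_bnd a (k : R) : 0 <= k -> A a -> bnd k a -> forall b, N b ->
  nrm (hat (a \o b)) <= k * nrm (hat b).
Proof.
move=> k0 Aa ha b Nb; have ba := vn_bop vA Aa.
have Aa' := vn_adj vA Aa; have Aaa : A (adj a \o a) by exact: vn_comp.
pose p : K -> K := (k ^+ 2)%:C *: id - (adj a \o a).
have Ap : A p by apply: vnB => //; apply: vnZ => //; exact: vn_id.
have pp : pos p := pos_sub_adj_comp k0 ba ha.
have : 0 <= rin (hat (p \o b)) (hat b) by case: gA => [_ _ _ h _]; exact: h.
have -> : p \o b = (k ^+ 2)%:C *: b - (adj a \o (a \o b)) by [].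
have Nab := gns_ideal Aa Nb.
rewrite hatB; [|exact: gnsZ|exact: gns_ideal].
rewrite hatZ // rinDl rinNl rinZl.
have -> : rin (hat (adj a \o (a \o b))) (hat b) = rin (hat (a \o b)) (hat (a \o b)).
  by rewrite /rin hat_adj // adjK.
rewrite subr_ge0 -!nrm_sqr -exprMn.
by rewrite ler_sqr ?nnegrE ?mulr_ge0 ?nrm_ge0.
Qed.

Lemma lregP a : A a -> bop (lreg N hat a) /\ forall b, N b -> lreg N hat a (hat b) = hat (a \o b).
Proof.
move=> Aa; have [k k0 hk] := bop_bnd (vn_bop vA Aa).
have [|||x e e0|T [bT _ hT]] :=
    @extend_relation R H H [set (hat b, hat (a \o b)) | b in N] k.
- exact: ltW.
- move=> c _ _ [b Nb <-] [b' Nb' <-]; exists (c *: b + b'); first exact: gns_comb.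
  have -> : a \o (c *: b + b') = c *: (a \o b) + (a \o b').
    by apply/funext => x; rewrite /= !fctE (vn_lin vA Aa).
  rewrite !hat_comb //; exact: gns_ideal.
- by move=> _ [b Nb <-] /=; apply: hat_bnd => //; exact: ltW.
- by have [b Nb hb] := hat_dense x e0; exists (hat b, hat (a \o b)) => //; exists b.
apply: (@the_bopP R H H _ T) => //.
by move=> b Nb; apply: (hT (hat b, hat (a \o b))); exists b.
Qed.

Lemma lreg_bop a : A a -> bop (lreg N hat a). Proof. by case/lregP. Qed.
Lemma lreg_hat a b : A a -> N b -> lreg N hat a (hat b) = hat (a \o b).
Proof. by move=> /lregP[_ h]; exact: h. Qed.

Lemma hat_ext (L : hilbertType R) (T T' : H -> L) : bop T -> bop T' ->
  (forall b, N b -> T (hat b) = T' (hat b)) -> T = T'.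
Proof.
move=> bT bT' h; apply: (bop_ext bT bT' dense_lspan_hat) => _ [b Nb <-]; exact: h.
Qed.

Lemma hat_inner_ext (u v : H) : (forall b, N b -> rin (hat b) u = rin (hat b) v) -> u = v.
Proof.
move=> h; apply/eqP; rewrite -subr_eq0; apply/eqP; set w := u - v.
have hw b : N b -> rin (hat b) w = 0 by move=> Nb; rewrite rinDr rinNr h // subrr.
apply: rin_eq0; apply/eqP; rewrite eq_le rin_ge0 andbT.
apply/ler_addgt0Pr => e e0; rewrite add0r.
have e1 : 0 < e / (nrm w + 1) by rewrite divr_gt0 // ltr_wpDl // nrm_ge0.
have [b Nb hb] := hat_dense w e1.
have -> : rin w w = rin (w - hat b) w by rewrite rinDl rinNl hw // subr0.
apply: le_trans (ler_norm _) _; apply: le_trans (rin_CS _ _) _.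
move: hb; rewrite ltr_pdivlMr ?ltr_wpDl ?nrm_ge0 //.
have := nrm_ge0 (w - hat b); lra.
Qed.

(** Quadratic forms with a common bound are equicontinuous on bounded sets. *)
Lemma quad_diff (T : H -> H) (k e : R) z h : bop T -> 0 <= k -> bnd k T -> e <= 1 ->
  nrm (z - h) <= e -> `|rin (T z) z - rin (T h) h| <= k * e * (2 * nrm z + 1).
Proof.
move=> bT k0 hk e1 he; have lT := bop_lin bT.
have -> : rin (T z) z - rin (T h) h = rin (T (z - h)) z + rin (T h) (z - h).
  by rewrite (linB _ _ lT) !rinE; lra.
apply: le_trans (ler_normD _ _) _.
have := rin_CS (T (z - h)) z; have := rin_CS (T h) (z - h).
have := hk (z - h); have := hk h; have := nrmD (h - z) z.
rewrite subrK (nrmB h).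
have := nrm_ge0 (z - h); have := nrm_ge0 z; have := nrm_ge0 h.
have := nrm_ge0 (T h); have := nrm_ge0 (T (z - h)).
move: (nrm (T (z - h))) (nrm (T h)) (nrm h) (nrm z) he => p q u v.
move: (nrm (z - h)) => t he p0 q0 u0 v0 t0 huv hq hp h1 h2.
have a1 : p * v <= k * e * v.
  by rewrite ler_wpM2r // (le_trans hp) // ler_wpM2l.
have a2 : q * t <= k * (v + 1) * e.
  apply: ler_pM => //; apply: le_trans hq _; rewrite ler_wpM2l //; lra.
lra.
Qed.

(** Each property is given on the dense subspace of the hat b; the ones that are
    not equations of bounded operators pass to H by [quad_diff], with a bound k
    common to the net D and its supremum in the case of normality. *)
Theorem gns_rep : normal_rep A (lreg N hat).
Proof.
have sa a : A a -> lreg N hat (adj a) = adj (lreg N hat a).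
  move=> Aa; have Aa' := vn_adj vA Aa.
  apply: hat_ext; [exact: lreg_bop|exact/adj_bop/lreg_bop|move=> b Nb].
  apply: hat_inner_ext => c Nc; rewrite lreg_hat // -rin_adj; last exact: lreg_bop.
  by rewrite lreg_hat // /rin hat_adj.
have ps p : A p -> pos p -> pos (lreg N hat p).
  move=> Ap pp; have bp := lreg_bop Ap; apply: rin_pos => //.
    by rewrite -sa // (pos_sa (vn_bop vA Ap) pp).
  move=> z; apply/ler_addgt0Pr => e e0.
  have [k k0 hk] := bop_bnd bp.
  have kz : 0 < k * (2 * nrm z + 1) by rewrite mulr_gt0 // ltr_wpDl // mulr_ge0 // nrm_ge0.
  pose f := Num.min 1 (e / (k * (2 * nrm z + 1))).
  have f0 : 0 < f by rewrite lt_min ltr01 divr_gt0.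
  have [b Nb hb] := hat_dense z f0.
  have f1 : f <= 1 by rewrite ge_min lexx.
  have := quad_diff bp (ltW k0) hk f1 (ltW hb); rewrite lreg_hat //.
  have : 0 <= rin (hat (p \o b)) (hat b) by case: gA => [_ _ _ h _]; exact: h.
  have : f * (k * (2 * nrm z + 1)) <= e by rewrite -ler_pdivlMr // ge_min lexx orbT.
  rewrite ler_norml => h1 h2 /andP[h3 _]; lra.
split=> //.
- move=> k a b Aa Ab; have Ac : A (k *: a + b) by exact: vn_comb.
  apply: hat_ext; [exact: lreg_bop|apply: bop_comb; exact: lreg_bop|move=> c Nc].
  rewrite !fctE !lreg_hat //.
  have -> : (k *: a + b) \o c = k *: (a \o c) + (b \o c) by [].
  by rewrite hat_comb //; exact: gns_ideal.
- split=> //.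
  + by move=> a; exact: lreg_bop.
  + move=> a b Aa Ab; have Aab := vn_comp vA Aa Ab.
    apply: hat_ext; [exact: lreg_bop|apply: bop_comp; exact: lreg_bop|move=> c Nc].
    by rewrite /= !lreg_hat //; exact: gns_ideal.
  + have Aid := vn_id vA; apply: hat_ext; [exact: lreg_bop|exact: bop_id|].
    by move=> b Nb; rewrite lreg_hat.
- move=> D X hX z m hm; have [AX pX DX _] := increases_toP vA hX.
  have [_ DM _ _] := hX.
  have bX := vn_bop vA AX; have [k k0 hk] := bop_bnd bX.
  have hd d : D d -> bnd k d.
    move=> Dd; have [Ad pd] := DM _ Dd; apply: pos_bnd => //; first exact: vn_bop Ad.
    by move=> x; apply: le_trans (DX _ Dd x) _; exact: bnd_rle.
  have hl a : A a -> bnd k a -> bnd k (lreg N hat a).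
    move=> Aa ha z'; apply/ler_addgt0Pr => e e0; have bl := lreg_bop Aa.
    have [c c0 hc] := bop_bnd bl.
    have e1 : 0 < e / (c + k) by rewrite divr_gt0 // addr_gt0.
    have [b Nb hb] := hat_dense z' e1.
    have := hat_bnd (ltW k0) Aa ha Nb; rewrite -lreg_hat // => h1.
    have := nrmD (lreg N hat a (z' - hat b)) (lreg N hat a (hat b)).
    rewrite (linB _ _ (bop_lin bl)) subrK -(linB _ _ (bop_lin bl)) => h2.
    have h3 := hc (z' - hat b).
    have h4 : k * nrm (hat b) <= k * (nrm (z' - hat b) + nrm z').
      rewrite ler_pM2l // nrmB; have := nrmD (hat b - z') z'; by rewrite subrK.
    have : (c + k) * nrm (z' - hat b) <= e.
      by rewrite mulrC -ler_pdivlMr ?addr_gt0 // ltW.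
    lra.
  apply/ler_addgt0Pr => e e0.
  have kz : 0 < 2 * (k * (2 * nrm z + 1)).
    by rewrite !mulr_gt0 // ltr_wpDl // mulr_ge0 // nrm_ge0.
  pose f := Num.min 1 (e / (2 * (k * (2 * nrm z + 1)))).
  have f0 : 0 < f by rewrite lt_min ltr01 divr_gt0.
  have [b Nb hb] := hat_dense z f0.
  have f1 : f <= 1 by rewrite ge_min lexx.
  have fe : f * (2 * (k * (2 * nrm z + 1))) <= e by rewrite -ler_pdivlMr // ge_min lexx orbT.
  have hXb : rin (hat (X \o b)) (hat b) <= m + e / 2.
    case: gA => [_ _ _ _ h]; apply: (h _ _ hX) => // d Dd.
    have [Ad pd] := DM _ Dd; have := hm _ Dd.
    have := quad_diff (lreg_bop Ad) (ltW k0) (hl _ Ad (hd _ Dd)) f1 (ltW hb).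
    rewrite lreg_hat // ler_norml => /andP[h1 h2]; lra.
  have := quad_diff (lreg_bop AX) (ltW k0) (hl _ AX hk) f1 (ltW hb).
  rewrite lreg_hat // ler_norml => /andP[h1 h2]; lra.
Qed.
End GNSRep.

(** * States and weights *)

Section Conjugation.
Variables (R : realType) (K : hilbertType R) (A : set (K -> K)).
Hypothesis vA : von_neumann A.
Implicit Types (a b c d p : K -> K).

Lemma conj_pos p b : bop b -> pos p -> pos (adj b \o (p \o b)).
Proof. by move=> bb pp x; rewrite /= inner_adjr //; exact: pp. Qed.

(** The supremum of an increasing net is its pointwise limit, so it commutes with
    conjugation by b, even if b is not invertible. *)
Lemma increases_conj D X b : increases_to A D X -> A b ->
  increases_to A [set adj b \o (d \o b) | d in D] (adj b \o (X \o b)).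
Proof.
move=> hX Ab; have [AX pX DX limX] := increases_toP vA hX.
have [[d0 Dd0] DM Ddir _] := hX.
have bb := vn_bop vA Ab; have Ab' := vn_adj vA Ab; have bX := vn_bop vA AX.
have Ac a : A a -> A (adj b \o (a \o b)) by move=> Aa; do 2!apply: vn_comp => //.
have conj_le a a' : ople a a' -> ople (adj b \o (a \o b)) (adj b \o (a' \o b)).
  by move=> h x; rewrite /= !inner_adjr //; exact: h.
have inner_rinE a x : rin ((adj b \o (a \o b)) x) x = rin (a (b x)) (b x).
  by rewrite /= rin_adjr.
apply: increases_toI => //.
- by exists (adj b \o (d0 \o b)), d0.
- by move=> _ [d /DM[Ad pd] <-]; split; [exact: Ac|exact: conj_pos].
- move=> _ _ [d Dd <-] [d' Dd' <-]; have [e [De h h']] := Ddir _ _ Dd Dd'.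
  by exists (adj b \o (e \o b)); split; [exists e|exact: conj_le|exact: conj_le].
- exact: Ac.
- apply: pos_sa; [exact: (vn_bop vA (Ac _ AX))|exact: conj_pos].
- by case: hX => _ _ _ [_ h _] _ [d Dd <-]; apply/conj_le/h.
- move=> x m hm; rewrite inner_rinE; apply: limX => d Dd; rewrite -inner_rinE.
  by apply: hm; exists d.
Qed.
End Conjugation.

Definition fin_weight (R : realType) (K : hilbertType R) (w : (K -> K) -> \bar R) p : R :=
  fine (w p).

Section Weight.
Variables (R : realType) (K : hilbertType R) (A : set (K -> K)) (w : (K -> K) -> \bar R).
Hypothesis vA : von_neumann A.
Implicit Types (a b c d p q : K -> K).

Definition normal_weight : Prop :=
  [/\ forall a, A a -> pos a -> (0 <= w a)%E,
      forall a b, A a -> pos a -> A b -> pos b -> w (a + b) = (w a + w b)%E,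
      forall (r : R) a, 0 <= r -> A a -> pos a -> w (r%:C *: a) = (r%:E * w a)%E &
      forall D x, increases_to A D x -> w x = ereal_sup (w @` D)].
Hypothesis nw : normal_weight.
Let w_ge0 a : A a -> pos a -> (0 <= w a)%E. Proof. by case: nw => h _ _ _; exact: h. Qed.
Let wD a b : A a -> pos a -> A b -> pos b -> w (a + b) = (w a + w b)%E.
Proof. by case: nw => _ h _ _; exact: h. Qed.
Let wZ (r : R) a : 0 <= r -> A a -> pos a -> w (r%:C *: a) = (r%:E * w a)%E.
Proof. by case: nw => _ _ h _; exact: h. Qed.
Let wsup D x : increases_to A D x -> w x = ereal_sup (w @` D).
Proof. by case: nw => _ _ _ h; exact: h. Qed.

Let F := finite_pos A w.
Local Notation g := (fin_weight w).
Let N := sq_integrable A (Weight w).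

Lemma weight_mono a b : A a -> pos a -> A b -> pos b -> rle a b -> (w a <= w b)%E.
Proof.
move=> Aa pa Ab pb h; have Aba : A (b - a) by exact: vnB.
have ba := vn_bop vA Aa; have bb := vn_bop vA Ab.
have pba : pos (b - a).
  apply: rin_pos; [exact: bopB|by rewrite adjB // !pos_sa|].
  by move=> x; rewrite !fctE !rinE subr_ge0.
have -> : b = a + (b - a) by rewrite addrC subrK.
by rewrite wD // leeDl // w_ge0.
Qed.

Lemma fin_A p : F p -> A p. Proof. by case. Qed.
Lemma fin_pos p : F p -> pos p. Proof. by case. Qed.
Lemma fin_bop p : F p -> bop p. Proof. by case=> Ap _ _; exact: (vn_bop vA). Qed.
Lemma fin_weightK p : F p -> w p = (g p)%:E.
Proof. by move=> [Ap pp h]; rewrite /fin_weight fineK // ge0_fin_numE // w_ge0. Qed.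
Lemma fin_weight_ge0 p : F p -> 0 <= g p.
Proof. by move=> [Ap pp _]; rewrite /fin_weight fine_ge0 // w_ge0. Qed.
Lemma finD p q : F p -> F q -> F (p + q).
Proof.
move=> [Ap pp fp] [Aq pq fq]; split; [exact: vnD|exact: posD|].
by rewrite wD // lte_add_pinfty.
Qed.
Lemma fin_weightD p q : F p -> F q -> g (p + q) = g p + g q.
Proof.
move=> Fp Fq; apply: EFin_inj; rewrite -fin_weightK ?wD ?EFinD ?fin_weightK //; try exact: fin_A; try exact: fin_pos.
exact: finD.
Qed.
Lemma finZ (r : R) p : 0 <= r -> F p -> F (r%:C *: p).
Proof.
move=> r0 Fp; have [Ap pp fp] := Fp; split; [exact: vnZ|exact: posZ|].
by rewrite wZ // fin_weightK // -EFinM ltry.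
Qed.
Lemma fin_weightZ (r : R) p : 0 <= r -> F p -> g (r%:C *: p) = r * g p.
Proof.
move=> r0 Fp; apply: EFin_inj; rewrite -fin_weightK; last exact: finZ.
rewrite wZ ?fin_weightK ?EFinM //; [exact: fin_A|exact: fin_pos].
Qed.
Lemma fin_hered p q : A p -> pos p -> F q -> rle p q -> F p.
Proof.
move=> Ap pp [Aq pq fq] h; split=> //; apply: le_lt_trans fq.
exact: weight_mono.
Qed.
Lemma fin_weight_mono p q : F p -> F q -> rle p q -> g p <= g q.
Proof.
move=> Fp Fq h; rewrite -lee_fin -!fin_weightK //.
by apply: weight_mono => //; [exact: fin_A|exact: fin_pos|exact: fin_A|exact: fin_pos].
Qed.
Lemma fin0 : F 0.
Proof.
split; [exact: vn0|exact: pos0|].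
have -> : (0 : K -> K) = (0 : R)%:C *: 0 by rewrite scaler0.
by rewrite wZ ?mul0e ?ltry //; [exact: vn0|exact: pos0].
Qed.
Lemma fin_weight0 : g 0 = 0.
Proof.
have -> : (0 : K -> K) = (0 : R)%:C *: 0 by rewrite scaler0.
by rewrite fin_weightZ ?mul0r //; exact: fin0.
Qed.

Lemma sqintP a : N a <-> A a /\ F (adj a \o a).
Proof.
split=> [[Aa h]|[Aa [_ _ h]]]; split=> //; split=> //; first exact: (vn_comp vA (vn_adj vA Aa) Aa).
by apply: pos_adj_comp; exact: (vn_bop vA).
Qed.
Lemma sqint_A a : N a -> A a. Proof. by case. Qed.
Lemma sqint_ideal a b : A a -> N b -> N (a \o b).
Proof.
move=> Aa /sqintP[Ab Fb]; have ba := vn_bop vA Aa; have bb := vn_bop vA Ab.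
have Aab : A (a \o b) by exact: vn_comp.
have bab := vn_bop vA Aab.
apply/sqintP; split=> //.
have [k k0 hk] := bop_bnd ba.
apply: (@fin_hered _ ((k ^+ 2)%:C *: (adj b \o b))).
- exact: (vn_comp vA (vn_adj vA Aab) Aab).
- exact: pos_adj_comp.
- by apply: finZ => //; exact: sqr_ge0.
move=> x; rewrite fctE rinZl /= !rin_adjr // -!nrm_sqr -exprMn.
by rewrite ler_sqr ?nnegrE ?mulr_ge0 ?nrm_ge0 ?(ltW k0) //; exact: hk.
Qed.
Lemma sqint_comb k b c : N b -> N c -> N (k *: b + c).
Proof.
move=> /sqintP[Ab Fb] /sqintP[Ac Fc]; have bb := vn_bop vA Ab; have bc := vn_bop vA Ac.
have Abc : A (k *: b + c) by exact: vn_comb.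
have bbc := vn_bop vA Abc.
apply/sqintP; split=> //.
pose m := complex.Re `|k|.
have m0 : 0 <= m by rewrite -ler0c RRe_real ?normr_real.
apply: (@fin_hered _ ((2 * m ^+ 2)%:C *: (adj b \o b) + 2%:C *: (adj c \o c))).
- exact: (vn_comp vA (vn_adj vA Abc) Abc).
- exact: pos_adj_comp.
- by apply: finD; apply: finZ => //; rewrite mulr_ge0 // sqr_ge0.
move=> x; rewrite [in leRHS]fctE rinDl [in leRHS]fctE rinZl [in leRHS]fctE rinZl /= !rin_adjr // -!nrm_sqr.
rewrite -[(k *: b + c) x]/(k *: b x + c x); have := nrmD (k *: b x) (c x); rewrite nrmZ -/m.
have := nrm_ge0 (k *: b x + c x); have := nrm_ge0 (b x); have := nrm_ge0 (c x).
move: (nrm (b x)) (nrm (c x)) (nrm (_ + _)) => s t u s0 t0 u0 h.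
have h2 : u ^+ 2 <= (m * s + t) ^+ 2 by rewrite ler_sqr ?nnegrE ?addr_ge0 ?mulr_ge0.
have := sqr_ge0 (m * s - t); lra.
Qed.
Lemma sqint0 : N 0.
Proof.
apply/sqintP; split; first exact: vn0.
have -> : adj (0 : K -> K) \o 0 = 0 :> (K -> K) by rewrite adj0.
exact: fin0.
Qed.

(** Polarization: 4 c^* b is the sum over k in {1, -1, i, -i} of
    k (k c + b)^* (k c + b). *)
Lemma sqint_span b c : N b -> N c -> lspan F (adj c \o b).
Proof.
move=> Nb Nc; have bb := vn_bop vA (sqint_A Nb); have bc := vn_bop vA (sqint_A Nc).
pose q (k : R[i]) := adj (k *: c + b) \o (k *: c + b).
have Fq k : F (q k) by have /sqintP[] := sqint_comb k Nc Nb.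
have -> : adj c \o b = (4^-1)%:C *: (1 *: q 1 + (-1 *: q (-1) + ('i%C *: q 'i%C + (- 'i%C *: q (- 'i%C) + 0)))).
  rewrite addr0; apply/funext => x; apply: rin_eqP => y.
  have bk k : bop (k *: c + b) by exact: bop_comb.
  have qr k z : rin (q k x) z = rin (k *: c x + b x) (k *: c z + b z).
    by rewrite /q /= rin_adjr.
  have im (u : K) : rin ('i%C *: u) y = - rin u ('i%C *: y).
    by rewrite -[in RHS]rin_ii scale_ii rinNr opprK.
  rewrite /= rin_adjr // rinZl !fctE !rinDl !scale1r !scaleN1r !scaleNr !rinNl !im !qr.
  rewrite (linZ _ _ (bop_lin bc)) (linZ _ _ (bop_lin bb)) !scale1r !scaleN1r !scaleNr scale_ii.
  rewrite !rinE.
  rewrite !rin_ii.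
  have e1 u v : rin ('i%C *: u) v = - rin u ('i%C *: v).
    by rewrite -[in RHS]rin_ii scale_ii rinNr opprK.
  rewrite !e1; lra.
apply: lspanZ; do 4!(apply: lspan_comb; first exact/sub_lspan/Fq); exact: lspan0.
Qed.

(** The graph of the linear extension of w.  It is single-valued because two
    decompositions of x have equal real and imaginary parts, and p - p' = q - q'
    gives w (p + q') = w (q + p'). *)
Let V x (z : R[i]) := exists p1 p2 p3 p4, [/\ F p1, F p2, F p3 & F p4] /\
  x = (p1 - p2) + 'i%C *: (p3 - p4) /\ z = (g p1 - g p2) +i* (g p3 - g p4).

Let Vfun x z z' : V x z -> V x z' -> z = z'.
Proof.
move=> [p1 [p2 [p3 [p4 [[F1 F2 F3 F4] [ex ->]]]]]] [q1 [q2 [q3 [q4 [[G1 G2 G3 G4] [ey ->]]]]]].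
have key p p' q q' : F p -> F p' -> F q -> F q' ->
    (forall u, rin ((p - p') u) u = rin ((q - q') u) u) -> g p - g p' = g q - g q'.
  move=> Fp Fp' Fq Fq' h.
  have : g (p + q') = g (q + p').
    apply/eqP; rewrite eq_le; apply/andP; split; apply: fin_weight_mono; try exact: finD.
      by move=> u; have := h u; rewrite !fctE !rinE; lra.
    by move=> u; have := h u; rewrite !fctE !rinE; lra.
  by rewrite !fin_weightD //; lra.
have sa p q u : F p -> F q -> rin ('i%C *: ((p - q) u)) u = 0.
  move=> Fp Fq; have bpq : bop (p - q) by apply: bopB; exact: fin_bop.
  have apq : adj (p - q) = p - q.
    rewrite adjB; [|exact: fin_bop|exact: fin_bop].
    by rewrite !pos_sa //; [exact: fin_bop|exact: fin_pos|exact: fin_bop|exact: fin_pos].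
  have := inner_sa u bpq apq; rewrite inner_rin => -[h].
  by rewrite rinC -rin_ii scale_ii rinNr rinC h oppr0.
have sa' p q u : F p -> F q -> rin ('i%C *: ((p - q) u)) ('i%C *: u) = rin ((p - q) u) u.
  by rewrite rin_ii.
have eu u : (p1 - p2) u + 'i%C *: (p3 - p4) u = (q1 - q2) u + 'i%C *: (q3 - q4) u.
  by have := congr1 (@^~ u) (etrans (esym ex) ey).
have sb p q u : F p -> F q -> rin ((p - q) u) ('i%C *: u) = 0.
  by move=> Fp Fq; rewrite -rin_ii scale_ii rinNr sa // oppr0.
congr (_ +i* _); apply: key => // u.
  by have := congr1 (fun z => rin z u) (eu u); rewrite /= !(rinDl, sa) // !addr0.
have : rin ((p1 - p2) u + 'i%C *: (p3 - p4) u) ('i%C *: u) =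
    rin ((q1 - q2) u + 'i%C *: (q3 - q4) u) ('i%C *: u) by rewrite eu.
by rewrite (rinDl ((p1 - p2) u)) (rinDl ((q1 - q2) u)) !sa' // !sb // !add0r.
Qed.

Let VD x z x' z' : V x z -> V x' z' -> V (x + x') (z + z').
Proof.
move=> [p1 [p2 [p3 [p4 [[F1 F2 F3 F4] [-> ->]]]]]] [q1 [q2 [q3 [q4 [[G1 G2 G3 G4] [-> ->]]]]]].
exists (p1 + q1), (p2 + q2), (p3 + q3), (p4 + q4); split; first by split; exact: finD.
split; first by rewrite addrACA -scalerDr !opprD; congr (_ + _ *: _); exact: addrACA.
by rewrite !fin_weightD //; apply/eqP; rewrite eq_complex /=; apply/andP; split; apply/eqP; ring.
Qed.
Let VN x z : V x z -> V (- x) (- z).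
Proof.
move=> [p1 [p2 [p3 [p4 [[F1 F2 F3 F4] [-> ->]]]]]]; exists p2, p1, p4, p3; split=> //.
split; first by rewrite opprD -scalerN !opprB.
by apply/eqP; rewrite eq_complex /= !opprB !eqxx.
Qed.
Let Vi x z : V x z -> V ('i%C *: x) ('i%C * z).
Proof.
move=> [p1 [p2 [p3 [p4 [[F1 F2 F3 F4] [-> ->]]]]]]; exists p4, p3, p1, p2; split=> //.
split; last by apply/eqP; rewrite eq_complex /=; apply/andP; split; apply/eqP; ring.
apply/funext => u; change ('i%C *: ((p1 u - p2 u) + 'i%C *: (p3 u - p4 u)) =
  (p4 u - p3 u) + 'i%C *: (p1 u - p2 u)).
by rewrite scalerDr scale_ii addrC opprB.
Qed.
Let VZp (r : R) x z : 0 <= r -> V x z -> V (r%:C *: x) (r%:C * z).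
Proof.
move=> r0 [p1 [p2 [p3 [p4 [[F1 F2 F3 F4] [-> ->]]]]]].
exists (r%:C *: p1), (r%:C *: p2), (r%:C *: p3), (r%:C *: p4).
split; first by split; exact: finZ.
split; first by rewrite scalerDr !scalerA mulrC -scalerA !scalerBr.
by rewrite !fin_weightZ //; apply/eqP; rewrite eq_complex /=; apply/andP; split; apply/eqP; ring.
Qed.
Let VZr (r : R) x z : V x z -> V (r%:C *: x) (r%:C * z).
Proof.
move=> hV; have [r0|r0] := leP 0 r; first exact: VZp.
have rE : r%:C = - (- r)%:C :> R[i] by rewrite rmorphN opprK.
by rewrite rE scaleNr mulNr; apply/VN/VZp => //; rewrite oppr_ge0 ltW.
Qed.
Let VZ (k : R[i]) x z : V x z -> V (k *: x) (k * z).
Proof.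
move=> hV; rewrite [k]complexE mulrDl scalerDl -mulrA -scalerA.
by apply: VD; [exact: VZr|exact/Vi/VZr].
Qed.
Let Vfin p : F p -> V p (g p)%:C.
Proof.
move=> Fp; have F0 := fin0; exists p, 0, 0, 0; split=> //; rewrite fin_weight0 !subr0.
by rewrite scaler0 addr0.
Qed.
Let Vspan x : lspan F x -> exists z, V x z.
Proof.
move: x; apply: lspan_ind => [|k s x Fs [z hz]].
  by exists (g 0)%:C; apply/Vfin/fin0.
by exists (k * (g s)%:C + z); apply: VD => //; apply/VZ/Vfin.
Qed.

(** The linear extension exists, so the choice made in the definition of [value]
    picks it. *)
Lemma value_weight : linear_on (lspan F) (value A (Weight w) : _ -> R[i]^o) /\
  forall p, F p -> value A (Weight w) p = (g p)%:C.
Proof.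
pose f x := xget 0 (V x).
have fV x z : V x z -> f x = z.
  by move=> hz; exact: (Vfun (xgetPex 0 (ex_intro _ z hz)) hz).
suff hf : [set f : (K -> K) -> R[i] | linear_on (lspan F) (f : _ -> R[i]^o) /\
    forall a, F a -> f a = (g a)%:C] f by exact: (xgetPex (fun=> 0) (ex_intro _ f hf)).
split=> [k x y /Vspan[z hz] /Vspan[z' hz']|p Fp]; last exact/fV/Vfin.
by rewrite (fV _ _ hz) (fV _ _ hz'); apply: fV; apply: VD => //; exact: VZ.
Qed.

Lemma sqint_conj_fin p b : A p -> pos p -> N b -> F (adj b \o (p \o b)).
Proof.
move=> Ap pp Nb; have bp := vn_bop vA Ap; have Ab := sqint_A Nb; have bb := vn_bop vA Ab.
have [k k0 hk] := bop_bnd bp; have /sqintP[_ Fb] := Nb.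
apply: (@fin_hered _ (k%:C *: (adj b \o b))).
- exact: (vn_comp vA (vn_adj vA Ab) (vn_comp vA Ap Ab)).
- exact: conj_pos.
- by apply: finZ => //; exact: ltW.
by move=> x; rewrite fctE rinZl /= !rin_adjr //; exact: bnd_rle.
Qed.

Lemma gns_weight (H : hilbertType R) (hat : (K -> K) -> H) :
  is_L2 A (Weight w) hat -> gns A N hat.
Proof.
move=> [lh hh dh]; have [lv pv] := value_weight.
have hb p b : A p -> pos p -> N b -> rin (hat (p \o b)) (hat b) = g (adj b \o (p \o b)).
  move=> Ap pp Nb; rewrite /rin hh //; last exact: sqint_ideal.
  by rewrite pv //; exact: sqint_conj_fin.
split=> //.
- by split; [exact: sqint0|exact: sqint_comb|exact: sqint_ideal].
- move=> a b c Aa Nb Nc; have Aa' := vn_adj vA Aa.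
  rewrite !hh //; try exact: sqint_ideal.
  rewrite adj_comp ?adjK //; [exact: (vn_bop vA)|exact: adj_bop (vn_bop vA Aa)|].
  exact: (vn_bop vA (sqint_A Nc)).
- by move=> p b Ap pp Nb; rewrite hb //; apply: fin_weight_ge0; exact: sqint_conj_fin.
- move=> D X hX b Nb m hm; have [AX pX _ _] := increases_toP vA hX; have [_ DM _ _] := hX.
  rewrite hb // -lee_fin -fin_weightK; last exact: sqint_conj_fin.
  rewrite (wsup (increases_conj vA hX (sqint_A Nb))); apply: ge_ereal_sup.
  move=> _ [_ [d Dd <-] <-]; have [Ad pd] := DM _ Dd.
  by rewrite fin_weightK ?lee_fin -?hb //; [exact: hm|exact: sqint_conj_fin].
Qed.
End Weight.

Section State.
Variables (R : realType) (K : hilbertType R) (A : set (K -> K)) (f : (K -> K) -> R[i]).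
Hypothesis vA : von_neumann A.

Definition normal_state : Prop :=
  [/\ linear_on A (f : (K -> K) -> R[i]^o), forall a, A a -> pos a -> 0 <= f a &
      forall D x, increases_to A D x ->
        (forall d, D d -> f d <= f x) /\ forall m, (forall d, D d -> f d <= m) -> f x <= m].

Lemma gns_state (H : hilbertType R) (hat : (K -> K) -> H) : normal_state ->
  is_L2 A (State f) hat -> gns A A hat.
Proof.
move=> [lf pf nf] [lh hh dh].
have Ac p b : A p -> A b -> A (adj b \o (p \o b)).
  by move=> Ap Ab; exact: (vn_comp vA (vn_adj vA Ab) (vn_comp vA Ap Ab)).
have hb p b : A p -> pos p -> A b ->
    (rin (hat (p \o b)) (hat b))%:C = f (adj b \o (p \o b)).
  move=> Ap pp Ab; rewrite /rin hh //; last exact: vn_comp.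
  rewrite /= RRe_real // ger0_real // pf //; first exact: Ac.
  by apply: conj_pos => //; exact: (vn_bop vA).
split=> //.
- split; [exact: vn0|by move=> k b c; exact: vn_comb|by move=> a b; exact: vn_comp].
- move=> a b c Aa Ab Acc; have Aa' := vn_adj vA Aa.
  rewrite !hh //; try exact: vn_comp.
  rewrite adj_comp ?adjK //; [exact: (vn_bop vA)|exact: adj_bop (vn_bop vA Aa)|].
  exact: (vn_bop vA Acc).
- move=> p b Ap pp Ab; rewrite -ler0c hb // pf //; first exact: Ac.
  by apply: conj_pos => //; exact: (vn_bop vA).
- move=> D X hX b Ab m hm; have [AX pX _ _] := increases_toP vA hX; have [_ DM _ _] := hX.
  rewrite -lecR hb //; have [_ h] := nf _ _ (increases_conj vA hX Ab); apply: h.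
  move=> _ [d Dd <-]; have [Ad pd] := DM _ Dd.
  by rewrite -hb // lecR; exact: hm.
Qed.
End State.

(** * Composition with the conditional expectation *)

Section Expectation.
Variables (R : realType) (K : hilbertType R) (A1 A2 : set (K -> K)).
Variable eps : (K -> K) -> (K -> K).
Hypotheses (v1 : von_neumann A1) (v2 : von_neumann A2).
Hypotheses (ceps : cond_expectation A1 A2 eps) (neps : normal_map A1 A2 eps).
Implicit Types (a b c d p x : K -> K).

Lemma epsL k a b : A1 a -> A1 b -> eps (k *: a + b) = k *: eps a + eps b.
Proof. by case: ceps => h _ _ _ _; exact: h. Qed.
Lemma eps_in a : A1 a -> A2 (eps a). Proof. by case: ceps => _ h _ _ _; exact: h. Qed.
Lemma eps_pos a : A1 a -> pos a -> pos (eps a). Proof. by case: ceps => _ _ h _ _; exact: h. Qed.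
Lemma eps_fix a : A2 a -> eps a = a. Proof. by case: ceps => _ _ _ h _; exact: h. Qed.
Lemma eps_mod a x b : A2 a -> A1 x -> A2 b -> eps (a \o (x \o b)) = a \o (eps x \o b).
Proof. by case: ceps => _ _ _ _ h; exact: h. Qed.
Lemma epsD a b : A1 a -> A1 b -> eps (a + b) = eps a + eps b.
Proof. by move=> Aa Ab; rewrite -[a]scale1r epsL // !scale1r. Qed.
Lemma eps0 : eps 0 = 0. Proof. exact: eps_fix (vn0 v2). Qed.
Lemma epsZ k a : A1 a -> eps (k *: a) = k *: eps a.
Proof. by move=> Aa; rewrite -[k *: a]addr0 epsL ?eps0 ?addr0 //; exact: vn0. Qed.

Lemma eps_ople a b : A1 a -> A1 b -> ople a b -> ople (eps a) (eps b).
Proof.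
move=> Aa Ab h x; have Aba : A1 (b - a) by exact: vnB.
have pba : pos (b - a) by move=> y; rewrite innerDl innerNl subr_ge0.
have -> : b = a + (b - a) by rewrite addrC subrK.
by rewrite epsD // innerDl lerDl; exact: eps_pos.
Qed.

(** Normality of a composite with eps reduces to normality on A2. *)
Lemma eps_increases D X : increases_to A1 D X -> increases_to A2 (eps @` D) (eps X).
Proof.
move=> hX; have := neps hX; case: hX => [[d0 Dd0] DM Ddir _] hs; split=> //.
- by exists (eps d0), d0.
- by move=> _ [d /DM[Ad pd] <-]; split; [exact: eps_in|exact: eps_pos].
- move=> _ _ [a Da <-] [b Db <-]; have [c [Dc ac bc]] := Ddir _ _ Da Db.
  have [Aa _] := DM _ Da; have [Ab _] := DM _ Db; have [Ac _] := DM _ Dc.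
  by exists (eps c); split; [exists c|exact: eps_ople|exact: eps_ople].
Qed.

Lemma normal_weight_comp w : normal_weight A2 w -> normal_weight A1 (w \o eps).
Proof.
move=> [w0 wD wZ wsup]; split=> /=.
- by move=> a Aa pa; apply: w0; [exact: eps_in|exact: eps_pos].
- move=> a b Aa pa Ab pb; rewrite epsD // wD //; [exact: eps_in|exact: eps_pos|exact: eps_in|exact: eps_pos].
- by move=> r a r0 Aa pa; rewrite epsZ // wZ //; [exact: eps_in|exact: eps_pos].
- by move=> D X hX; rewrite (wsup _ _ (eps_increases hX)) -image_comp.
Qed.

Lemma normal_state_comp f : normal_state A2 f -> normal_state A1 (f \o eps).
Proof.
move=> [lf pf nf]; split=> /=.
- by move=> k a b Aa Ab; rewrite /= epsL // lf //; exact: eps_in.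
- by move=> a Aa pa; apply: pf; [exact: eps_in|exact: eps_pos].
- move=> D X hX; have [h1 h2] := nf _ _ (eps_increases hX); split.
    by move=> d Dd; apply: h1; exists d.
  by move=> m hm; apply: h2 => _ [d Dd <-]; exact: hm.
Qed.

Lemma value_weight_comp w y : normal_weight A2 w ->
  lspan (finite_pos A1 (w \o eps)) y ->
  value A1 (Weight (w \o eps)) y = value A2 (Weight w) (eps y).
Proof.
move=> nw; have nw1 := normal_weight_comp nw.
have [l1 e1] := value_weight v1 nw1; have [l2 e2] := value_weight v2 nw.
have Feps p : finite_pos A1 (w \o eps) p -> finite_pos A2 w (eps p).
  by move=> [Ap pp fp]; split; [exact: eps_in|exact: eps_pos|].
pose Q y := [/\ A1 y, lspan (finite_pos A1 (w \o eps)) y, lspan (finite_pos A2 w) (eps y) &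
  value A1 (Weight (w \o eps)) y = value A2 (Weight w) (eps y)].
move=> hy; suff [] : Q y by []; move: y hy; apply: lspan_ind => [|k p y Fp [Ay ly ley e]].
  have F0 := fin0 v1 nw1; split.
  - exact: vn0.
  - exact: lspan0.
  - by rewrite eps0; exact: lspan0.
  - by rewrite e1 // e2 //; exact: Feps.
have Ap : A1 p by case: Fp.
have lp := sub_lspan Fp; have lep := sub_lspan (Feps _ Fp).
split.
- exact: vn_comb.
- exact: lspan_comb.
- by rewrite epsL //; exact: lspan_comb.
- rewrite epsL // (l1 _ _ _ lp ly) (l2 _ _ _ lep ley) e; congr (_ *: _ + _).
  by rewrite e1 // e2 //; exact: Feps.
Qed.
End Expectation.

Section Approximation.
Variables (R : realType) (K : hilbertType R) (A1 A2 : set (K -> K)).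
Variable eps : (K -> K) -> (K -> K).
Hypotheses (v1 : von_neumann A1) (v2 : von_neumann A2) (A21 : A2 `<=` A1).
Hypotheses (ceps : cond_expectation A1 A2 eps) (neps : normal_map A1 A2 eps).
Variable w : (K -> K) -> \bar R.
Hypothesis nw : normal_weight A2 w.
Let F := finite_pos A2 w.
Local Notation g := (fin_weight w).
Let N1 := sq_integrable A1 (Weight (w \o eps)).
Let N2 := sq_integrable A2 (Weight w).

Lemma sqint_sub : N2 `<=` N1.
Proof.
move=> b [Ab hb]; split; first exact: A21.
by rewrite /= (eps_fix ceps) //; exact: (vn_comp v2 (vn_adj v2 Ab) Ab).
Qed.

(** With x = c u and y = d u one has u = x + k h x = y + l h y, so
    x - y = l h y - k h x.  Pairing this with h x and
    h y gives that the difference of the two forms is (l - k) <h x, h y>, and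
    pairing with h (x - y) gives (l + k) <h x, h y> >= 0. *)
Lemma res_decr (h c d : K -> K) (k l : R) (u : K) : bop h -> pos h -> 0 < k -> k <= l ->
  is_res (k%:C *: h) c -> is_res (l%:C *: h) d ->
  rin (h (d u)) u <= rin (h (c u)) u.
Proof.
move=> bh ph k0 kl hc hd; set x := c u; set y := d u.
have ex : u = x + k%:C *: h x by rewrite {1}(esym (hc.1 u)).
have ey : u = y + l%:C *: h y by rewrite {1}(esym (hd.1 u)).
have sh a b : rin (h a) b = rin a (h b) by rewrite rin_adj // (pos_sa bh ph).
have e : x - y = l%:C *: h y - k%:C *: h x.
  have e' : x + k%:C *: h x = y + l%:C *: h y by rewrite -ex.
  by rewrite {1}(canRL (addrK _) e') addrAC (addrAC y) subrr add0r.
have r1 : rin (x - y) (h x) = rin (l%:C *: h y - k%:C *: h x) (h x) by rewrite e.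
have r2 : rin (x - y) (h y) = rin (l%:C *: h y - k%:C *: h x) (h y) by rewrite e.
have := pos_ge0 (x - y) ph; rewrite (linB _ _ (bop_lin bh)).
have -> : rin (h y) u = rin (h y) y + l * rin (h y) (h y) by rewrite {1}ey rinDr rinZr.
have -> : rin (h x) u = rin (h x) x + k * rin (h x) (h x) by rewrite {1}ex rinDr rinZr.
have ha := rin_ge0 (h x); have hb := rin_ge0 (h y).
move: r1 r2; rewrite !rinE (rinC x (h x)) (rinC y (h y)) (rinC x (h y)) (rinC y (h x)).
have -> : rin (h y) x = rin (h x) y by rewrite sh rinC.
rewrite (rinC (h y) (h x)).
move: (rin (h x) x) (rin (h y) y) (rin (h x) y) (rin (h x) (h x)) (rin (h y) (h y)) (rin (h x) (h y)) ha hb.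
move=> p q r a b s a0 b0 r1 r2 r3.
have lk0 : 0 < l + k by lra.
have s0 : 0 <= s.
  have ka := mulr_ge0 (ltW k0) a0; have l0 : 0 <= l by lra.
  have lb := mulr_ge0 l0 b0; have : 0 <= (l + k) * s by lra.
  by rewrite pmulr_rge0.
have : 0 <= (l - k) * s by rewrite mulr_ge0 // subr_ge0.
lra.
Qed.

(** With h = eps (x^* x), of finite weight, take b = 1 - c for c = (1 + k h)^-1.
    Then b^2 <= b <= k h, so b is square-integrable, and the square of the norm of
    hat x - hat (x b) = hat (x c) is w (c h c) <= w (h c).  The elements h - h c
    increase to h with k, so w (h c) tends to 0 by normality. *)
Lemma hat_approx (H : hilbertType R) (hat : (K -> K) -> H) :
  is_L2 A1 (Weight (w \o eps)) hat -> forall x, N1 x -> forall e : R, 0 < e ->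
  exists2 b, N2 b & nrm (hat x - hat (x \o b)) < e.
Proof.
move=> hL2 x Nx e e0.
have nw1 := normal_weight_comp v1 v2 ceps neps nw.
have [lh hh _] := hL2; have gA1 := gns_weight v1 nw1 hL2.
have Ax := sqint_A Nx; have bx := vn_bop v1 Ax.
have Axx := vn_comp v1 (vn_adj v1 Ax) Ax.
pose h := eps (adj x \o x).
have Ah : A2 h by exact: (eps_in ceps).
have ph : pos h by apply: (eps_pos ceps) => //; exact: pos_adj_comp.
have bh := vn_bop v2 Ah; have lh' := bop_lin bh.
have Fh : F h by split=> //; case: Nx.
have sh := pos_sa bh ph.
pose k n : R := n.+1%:R.
have k0 n : 0 < k n by rewrite ltr0n.
have Akh n : A2 ((k n)%:C *: h) by exact: vnZ.
have pkh n : pos ((k n)%:C *: h) by apply: posZ => //; exact: ltW.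
have bkh n := vn_bop v2 (Akh n).
have /choice[c hc] : forall n, exists c, A2 c /\ is_res ((k n)%:C *: h) c.
  by move=> n; have [c Ac hc] := vn_res v2 (Akh n) (pkh n); exists c.
have Ac n : A2 (c n) := (hc n).1.
have bc n := vn_bop v2 (Ac n).
have pc n : pos (c n) := res_pos (bkh n) (bc n) (pkh n) (hc n).2.
have sc n : adj (c n) = c n := pos_sa (bc n) (pc n).
pose b n : K -> K := id - c n.
have bid := @bop_id R K.
have Ab n : A2 (b n) by apply: vnB => //; exact: vn_id.
have bb n := vn_bop v2 (Ab n).
have sb n : adj (b n) = b n by rewrite /b adjB // sc adj_id.
have bE n u : rin (b n u) u = rin u u - rin (c n u) u by rewrite /b !fctE !rinE.
have bv n u : b n u = (k n)%:C *: h (c n u).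
  by rewrite /b fctE -{1}((hc n).2.1 u) addrC addKr.
have pb n : pos (b n).
  apply: rin_pos => // u; rewrite bE subr_ge0.
  exact: res_le1 (bkh n) (bc n) (pkh n) (hc n).2.
have b1 n u : rin (b n u) u <= 1 * rin u u.
  by rewrite bE mul1r gerBl; exact: pos_ge0.
have bkhle n u : rin (b n u) u <= k n * rin (h u) u.
  by rewrite bE -rinZl; exact: res_ge u (bkh n) (bc n) (pkh n) (hc n).2.
have Nb n : N2 (b n).
  apply/(sqintP w v2); split=> //; apply: (fin_hered v2 nw (q := (k n)%:C *: h)).
  - exact: (vn_comp v2 (vn_adj v2 (Ab n)) (Ab n)).
  - exact: pos_adj_comp.
  - by apply: (finZ v2 nw) => //; exact: ltW.
  move=> u; rewrite fctE rinZl /= rin_adjr //.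
  apply: le_trans (pos_sqr_le (bb n) (pb n) ltr01 (b1 n) u) _.
  by rewrite mul1r.
(* t n is h c: b n = k h c, and dividing by k keeps positivity visible *)
pose t n : K -> K := ((k n)^-1)%:C *: b n.
have At n : A2 (t n) by exact: vnZ.
have ki n : 0 <= (k n)^-1 by rewrite invr_ge0 ltW.
have pt n : pos (t n) by exact: posZ.
have kn0 n : k n != 0 by exact: lt0r_neq0.
have tE n u : rin (t n u) u = rin (h (c n u)) u.
  by rewrite /t fctE rinZl bv rinZl mulrA mulVf // mul1r.
have th n : rle (t n) h.
  move=> u; rewrite /t fctE rinZl; have := bkhle n u.
  by rewrite -ler_pdivrMl // invrK.
have Ft n : F (t n) by apply: (fin_hered v2 nw (q := h)).
have bt n := vn_bop v2 (At n).
have st n := pos_sa (bt n) (pt n).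
pose E n : K -> K := h - t n.
have AE n : A2 (E n) by exact: vnB.
have bE' n := vn_bop v2 (AE n).
have sE n : adj (E n) = E n by rewrite /E adjB // sh st.
have EE n u : rin (E n u) u = rin (h u) u - rin (t n u) u by rewrite /E !fctE !rinE.
have pE n : pos (E n) by apply: rin_pos => // u; rewrite EE subr_ge0; exact: th.
have Emono n m : (n <= m)%N -> rle (E n) (E m).
  move=> nm u; rewrite !EE lerD2l lerN2 !tE.
  by apply: res_decr (k0 n) _ (hc n).2 (hc m).2 => //; rewrite /k ler_nat.
have FE n : F (E n).
  by apply: (fin_hered v2 nw (q := h)) => // u; rewrite EE gerBl; exact: pos_ge0.
have op n m : (n <= m)%N -> ople (E n) (E m).
  by move=> nm; apply/ople_rle => //; exact: Emono.
have inc : increases_to A2 (range E) h.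
  apply: increases_toI => //.
  - by exists (E 0%N), 0%N.
  - by move=> _ [n _ <-].
  - move=> _ _ [n _ <-] [m _ <-]; exists (E (maxn n m)); split; first by exists (maxn n m).
      by apply: op; exact: leq_maxl.
    by apply: op; exact: leq_maxr.
  - move=> _ [n _ <-]; apply/ople_rle => // u; rewrite EE gerBl; exact: pos_ge0.
  - move=> u m hm; apply/ler_addgt0Pr => f f0.
    have f1 : 0 < f / (rin u u + 1) by rewrite divr_gt0 // ltr_wpDl // rin_ge0.
    have [n0 /(_ n0 (leqnn n0)) hn] := inv_small f1.
    have : rin (E n0 u) u <= m by apply: hm; exists n0.
    rewrite EE; have : rin (t n0 u) u <= (k n0)^-1 * rin u u.
      by rewrite /t fctE rinZl; apply: ler_wpM2l => //; have := b1 n0 u; rewrite mul1r.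
    have : (k n0)^-1 * (rin u u + 1) < f by rewrite -ltr_pdivlMr // ltr_wpDl // rin_ge0.
    have := ki n0; move: ((k n0)^-1) (rin (t n0 u) u) (rin u u) (rin (h u) u) => z y' r s; rewrite mulrDr mulr1 => z0 h1 h2 h3.
    rewrite -lerBlDl; apply: le_trans (_ : y' <= _); first by move: h3; rewrite !lerBlDl addrC.
    by apply: le_trans h2 _; apply: le_trans (ltW h1); rewrite lerDl.
have [n hn] : exists n, g (t n) < e ^+ 2.
  apply: contrapT => hcon.
  have ht n : e ^+ 2 <= g (t n) by rewrite leNgt; apply/negP => hlt; apply: hcon; exists n.
  have [_ _ _ wsup] := nw; have := wsup _ _ inc.
  rewrite (fin_weightK nw Fh) => wh.
  have : (ereal_sup (w @` range E) <= (g h - e ^+ 2)%:E)%E.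
    apply: ge_ereal_sup => _ [_ [n _ <-] <-]; rewrite (fin_weightK nw (FE n)) lee_fin.
    have : g h = g (E n) + g (t n) by rewrite -(fin_weightD v2 nw (FE n) (Ft n)) /E subrK.
    by have := ht n; lra.
  rewrite -wh lee_fin; have : 0 < e ^+ 2 by rewrite exprn_gt0.
  by lra.
exists (b n) => //.
have Nxb : N1 (x \o b n) by apply: (sqint_ideal v1 nw1) => //; exact: sqint_sub.
have exc : x - (x \o b n) = x \o c n.
  apply/funext => u; rewrite /b /= !fctE (linB _ _ (bop_lin bx)).
  by rewrite opprB addrC subrK.
have Nxc : N1 (x \o c n).
  by rewrite -exc -scaleN1r addrC; apply: (sqint_comb v1 nw1).
have -> : hat x - hat (x \o b n) = hat (x \o c n).
  by rewrite -exc (hatB gA1).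
have Fxc : finite_pos A1 (w \o eps) (adj (x \o c n) \o (x \o c n)).
  by have /(sqintP (w \o eps) v1)[] := Nxc.
have eqn : nrm (hat (x \o c n)) ^+ 2 = g (c n \o (h \o c n)).
  rewrite nrm_sqr /rin hh //; have [_ ev] := value_weight v1 nw1.
  rewrite (ev _ Fxc) /=; congr (fine (w _)); rewrite (adj_comp bx (bc n)) sc.
  have -> : (c n \o adj x) \o (x \o c n) = c n \o ((adj x \o x) \o c n) by [].
  by rewrite (eps_mod ceps).
rewrite -ltr_sqr ?nnegrE ?nrm_ge0 ?(ltW e0) // eqn; apply: le_lt_trans hn.
have Achc : A2 (c n \o (h \o c n)) by exact: (vn_comp v2 (Ac n) (vn_comp v2 Ah (Ac n))).
have pchc : pos (c n \o (h \o c n)) by rewrite -{1}(sc n); exact: conj_pos.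
have le : rle (c n \o (h \o c n)) (t n).
  move=> u; rewrite tE /= rin_adj // sc -{4}((hc n).2.1 u) rinDr fctE rinZr lerDl.
  by apply: mulr_ge0; [exact: ltW|exact: rin_ge0].
exact: (fin_weight_mono v2 nw (fin_hered v2 nw Achc pchc (Ft n) le) (Ft n) le).
Qed.

(** If a b = 0 for every square-integrable b, then a annihilates the positive
    elements of finite weight, whose weak span contains 1 by semifiniteness. *)
Lemma weight_faithful (H : hilbertType R) (hat : (K -> K) -> H) :
  (forall a, A2 a -> pos a -> w a = 0%E -> a = 0) -> wspan F = A2 ->
  is_L2 A2 (Weight w) hat ->
  forall a, A2 a -> (forall b, N2 b -> hat (a \o b) = 0) -> a = 0.
Proof.
move=> fw sw hL2 a Aa ha; have [lh hh _] := hL2; have ba := vn_bop v2 Aa.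
have [_ ev] := value_weight v2 nw.
have ab0 b : N2 b -> a \o b = 0.
  move=> Nb; have Nab : N2 (a \o b) by exact: (sqint_ideal v2 nw Aa Nb).
  have Fab : F (adj (a \o b) \o (a \o b)) by have /(sqintP w v2)[] := Nab.
  have bab := vn_bop v2 (sqint_A Nab).
  have : g (adj (a \o b) \o (a \o b)) = 0.
    have := hh _ _ Nab Nab; rewrite ha // inner0l (ev _ Fab) => /esym h.
    by have := congr1 (@complex.Re R) h.
  move=> g0; have : adj (a \o b) \o (a \o b) = 0.
    by have [Ap pp _] := Fab; apply: fw => //; rewrite (fin_weightK nw Fab) g0.
  move=> h; apply/funext => u; apply: rin_eq0.
  by rewrite -rin_adjr //; have := congr1 (fun f => rin (f u) u) h => /= ->; exact: rin0l.
have ap p : F p -> a \o p = 0.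
  move=> Fp; apply: ab0; have [Ap pp _] := Fp; have bp := vn_bop v2 Ap.
  apply/(sqintP w v2); split=> //; have [c c0 hc] := bop_bnd bp.
  apply: (fin_hered v2 nw (q := c%:C *: p)).
  - exact: (vn_comp v2 (vn_adj v2 Ap) Ap).
  - exact: pos_adj_comp.
  - by apply: (finZ v2 nw) => //; exact: ltW.
  move=> u; rewrite fctE rinZl /= rin_adjr //.
  by apply: pos_sqr_le => // v; exact: bnd_rle.
have /wspanP[_ hid] : wspan F id by rewrite sw; exact: vn_id.
apply/funext => u; apply: rin_eq0; apply/eqP; rewrite eq_le rin_ge0 andbT.
apply/ler_addgt0Pr => e e0; rewrite add0r.
have [X FX hX] := hid [:: (u, adj a (a u))] e e0.
have aX : a \o X = 0.
  move: X FX {hX}; apply: lspan_ind => [|k p X Fp IH].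
    by apply/funext => v; exact: lin0 (bop_lin ba).
  apply/funext => v; rewrite /= !fctE (bop_lin ba).
  have -> : a (p v) = 0 by exact: (congr1 (@^~ v) (ap _ Fp)).
  have -> : a (X v) = 0 by exact: (congr1 (@^~ v) IH).
  by rewrite scaler0 addr0.
have := hX (u, adj a (a u)); rewrite mem_head /= rinDl rinNl -!rin_adj // => /(_ isT).
have -> : a (X u) = 0 by exact: (congr1 (@^~ u) aX).
by rewrite rin0l subr0 => h; apply: le_trans (ler_norm _) (ltW h).
Qed.
End Approximation.

(** * The bimodule of an inclusion *)

Section Isometries.
Variables (R : realType) (H K : hilbertType R) (T : H -> K).
Hypotheses (bT : bop T) (iT : forall x y, inner (T x) (T y) = inner x y).

Lemma iso_rin x y : rin (T x) (T y) = rin x y.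
Proof. by rewrite /rin iT. Qed.

Lemma iso_nrm x : nrm (T x) = nrm x.
Proof. by apply/eqP; rewrite -(@eqrXn2 _ 2) ?nrm_ge0 // !nrm_sqr iso_rin. Qed.

Lemma iso_adjK x : adj T (T x) = x.
Proof. by apply: rin_eqP => y; rewrite rin_adjr // iso_rin. Qed.

Lemma iso_adj_nrm y : nrm (adj T y) <= nrm y.
Proof.
apply: nrm_rin_le; first exact: nrm_ge0.
move=> x; rewrite rin_adjr //; apply: le_trans (ler_norm _) _.
by apply: le_trans (rin_CS _ _) _; rewrite iso_nrm.
Qed.

(** T T^* fixes the range of T, and it is a contraction. *)
Lemma iso_range y : closure (range T) y -> T (adj T y) = y.
Proof.
move=> /closureP h; apply/eqP; rewrite -subr_eq0; apply/eqP/nrm_small => e e0.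
have e2 : 0 < e / 2 by lra.
have [_ [x _ <-] hx] := h _ e2; have la := bop_lin (adj_bop bT).
have -> : T (adj T y) - y = T (adj T (y - T x)) - (y - T x).
  by rewrite (linB _ _ la) iso_adjK (linB _ _ (bop_lin bT)) opprB addrA subrK.
apply: le_trans (nrmD _ _) _; rewrite nrmN iso_nrm.
have := iso_adj_nrm (y - T x); lra.
Qed.

Lemma dense_iso_unitary : (forall y (e : R), 0 < e -> exists x, nrm (y - T x) < e) ->
  unitary T /\ forall y, T (adj T y) = y.
Proof.
move=> d; have h y : T (adj T y) = y.
  by apply/iso_range/closureP => e /(d y)[x hx]; exists (T x).
split=> //; split=> //; first exact: bop_lin.
by apply/seteqP; split=> // y _; exists (adj T y).
Qed.
End Isometries.

Section Nondegenerate.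
Variables (R : realType) (H : hilbertType R) (B : set (H -> H)).

(** Given vectors z, let p be the defect of the best approximation of z by the
    tuples X z.  For Y in B, the tuple Y^* Y p is a limit of tuples Y^* Y (z - X z),
    which lie in the span, so <Y p, Y p> = <p, Y^* Y p> = 0; hence Y p = 0 for all Y,
    and p = 0 by nondegeneracy. *)
Lemma nondegenerate_id : B `<=` @bop R H H -> (forall X Y, B X -> B Y -> B (X \o Y)) ->
  (forall X, B X -> B (adj X)) -> (forall z, (forall X, B X -> X z = 0) -> z = 0) ->
  wspan B id.
Proof.
move=> bB BC Badj Bnd.
have BlC X Y : B X -> lspan B Y -> lspan B (X \o Y).
  move=> BX; have lX := bop_lin (bB _ BX); move: Y; apply: lspan_ind => [|a Y Z BY IH].
    have -> : X \o (0 : H -> H) = 0 :> (H -> H) by apply/funext => z; exact: lin0.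
    exact: lspan0.
  have -> : X \o (a *: Y + Z) = a *: (X \o Y) + (X \o Z).
    by apply/funext => z; rewrite /= !fctE lX.
  by apply: lspan_comb => //; apply/sub_lspan/BC.
apply/wspanP; split; first exact: bop_id.
move=> s e e0; pose z (i : 'I_(size s)) := (tnth (in_tuple s) i).1.
have [|||p hp app] := @tuple_projection R H (size s) [set v | exists2 X, lspan B X & v = X \o z] z.
- by exists 0 => //; exact: lspan0.
- by move=> _ _ [X BX ->] [Y BY ->]; exists (X + Y) => //; exact: lspanD.
- by move=> r _ [X BX ->]; exists (r%:C *: X) => //; exact: lspanZ.
have p0 i : p i = 0.
  apply: Bnd => Y BY; have bY := bB _ BY; have lY := bop_lin bY.
  have bY' := adj_bop bY; have lY' := bop_lin bY'.
  have [c c0 hc] := bop_bnd (bop_comp bY' bY).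
  suff : trin (Y \o p) (Y \o p) <= 0.
    move=> h; apply: rin_eq0; apply/eqP; rewrite eq_le rin_ge0 andbT.
    by apply: le_trans h; exact: (rin_le_trin (Y \o p) i).
  apply/ler_addgt0Pr => f f0; rewrite add0r.
  pose C := \sum_j nrm (p j).
  have C0 : 0 <= C by apply: sumr_ge0 => j _; exact: nrm_ge0.
  have f1 : 0 < f / (c * (C + 1)) by rewrite divr_gt0 // mulr_gt0 // ltr_wpDl.
  have [_ [X BX ->] hX] := app _ f1.
  pose Z : H -> H := adj Y \o (Y - (Y \o X)).
  have BZ : lspan B Z.
    apply: (BlC); first exact: Badj.
    rewrite addrC -scaleN1r; apply: lspan_comb; [exact: (BlC _ _ BY BX)|exact: sub_lspan].
  have hZ : trin p (Z \o z) = 0 by apply: hp; exists Z.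
  pose v := z - (X \o z) - p.
  have -> : trin (Y \o p) (Y \o p) = - trin (adj Y \o (Y \o v)) p.
    have -> : adj Y \o (Y \o v) = (Z \o z) - (adj Y \o (Y \o p)).
      apply/funext => j; rewrite /v /Z /= !fctE /= !(linB _ _ lY) !(linB _ _ lY') //.
    rewrite trinDl trinNl [trin (Z \o z) p]trinC hZ sub0r opprK.
    by apply: eq_bigr => j _; rewrite /= rin_adjr.
  apply: le_trans (ler_norm _) _; rewrite normrN.
  apply: le_trans (_ : (c * (f / (c * (C + 1)))) * C <= _).
    apply: trin_le_nrm => j; apply: le_trans (hc _) _.
    by rewrite ler_pM2l // ltW // hX.
  rewrite mulrA mulrAC ler_pdivrMr; last by rewrite mulr_gt0 // ltr_wpDl.
  rewrite (mulrC c) -mulrA ler_pM2l // ler_pM2l //; lra.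
pose C := \sum_(j < size s) nrm (tnth (in_tuple s) j).2.
have C0 : 0 <= C by apply: sumr_ge0 => j _; exact: nrm_ge0.
have e1 : 0 < e / (C + 1) by rewrite divr_gt0 // ltr_wpDl.
have [_ [X BX ->] hX] := app _ e1; exists X => // q /(tnthP (in_tuple s))[i ->].
apply: le_lt_trans (rin_CS _ _) _; have := hX i; rewrite p0 subr0 /= -/(z i) => h.
have hi : nrm (tnth (in_tuple s) i).2 <= C.
  by rewrite /C (bigD1 i) //= lerDl; apply: sumr_ge0 => j _; exact: nrm_ge0.
apply: le_lt_trans (_ : e / (C + 1) * C < _).
  by apply: ler_pM; rewrite ?nrm_ge0 // ltW.
by rewrite mulrAC ltr_pdivrMr ?ltr_wpDl // ltr_pM2l //; lra.
Qed.
End Nondegenerate.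

Section RepFacts.
Variables (R : realType) (K H : hilbertType R) (A : set (K -> K)).
Variables (rho : (K -> K) -> (H -> H)) (B : set (H -> H)).
Hypotheses (vA : von_neumann A) (nrho : normal_rep A rho).
Hypotheses (bB : B `<=` @bop R H H) (hB : forall a, A a -> B (rho a)).

Lemma rep_star_hom : star_hom A B rho.
Proof. by case: nrho => h1 [_ h2 h3 _] _ _; split. Qed.

(** The supremum is least among all bounded operators that dominate the image, so
    it is the supremum in any B that contains it. *)
Lemma rep_normal_map : normal_map A B rho.
Proof.
move=> D X hX; have [AX pX DX _] := increases_toP vA hX; have [[d0 Dd0] DM _ _] := hX.
have lim : forall z (m : R), (forall d, D d -> rin (rho d z) z <= m) -> rin (rho X z) z <= m.
  by case: nrho => _ _ _ h; exact: h hX.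
have pr d : D d -> pos (rho d) by move=> /DM[Ad pd]; exact: (rep_pos nrho).
split; first exact: hB.
  move=> _ [d Dd <-]; have [Ad pd] := DM _ Dd; have AXd : A (X - d) by exact: vnB.
  have bX := vn_bop vA AX; have bd := vn_bop vA Ad.
  have pXd : pos (X - d).
    apply: rin_pos; [exact: bopB|by rewrite adjB // !pos_sa|].
    by move=> u; rewrite !fctE !rinE subr_ge0; exact: DX.
  move=> z; have := rep_pos nrho AXd pXd z.
  by rewrite (repB vA nrho) // innerDl innerNl subr_ge0.
move=> y By hy; have by' := bB By.
have py : pos y by apply: ople_pos (hy (rho d0) _); [exact: pr|exists d0].
have bX := rep_bop nrho AX; have rX := rep_pos nrho AX pX.
apply/(ople_rle bX by' (pos_sa bX rX) (pos_sa by' py)) => z; apply: lim => d Dd.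
have [Ad pd] := DM _ Dd; have bd := rep_bop nrho Ad.
have [h _] := ople_rle bd by' (pos_sa bd (pr _ Dd)) (pos_sa by' py).
by apply: h; apply: hy; exists d.
Qed.
End RepFacts.

(** The square-integrable elements N1, N2 of A1, A2 with their maps into L^2 are
    described by three facts: [hat_eps] (the inner product of L^2 of A1, computed
    through eps), [hat1_total] (right multiplication by N2 is nondegenerate on N1)
    and [hat2_faithful]. *)
Section Inclusion.
Variables (R : realType) (K : hilbertType R) (A1 A2 : set (K -> K)).
Variable eps : (K -> K) -> (K -> K).
Hypotheses (v1 : von_neumann A1) (v2 : von_neumann A2) (A21 : A2 `<=` A1).
Hypothesis ceps : cond_expectation A1 A2 eps.
Variables (N1 N2 : set (K -> K)) (H1 H2 : hilbertType R).
Variables (hat1 : (K -> K) -> H1) (hat2 : (K -> K) -> H2).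
Hypotheses (g1 : gns A1 N1 hat1) (g2 : gns A2 N2 hat2).
Hypotheses (N1A : N1 `<=` A1) (N21 : N2 `<=` N1).
Hypothesis hat_eps : forall x b c, A1 x -> N2 b -> N2 c ->
  inner (hat1 (x \o b)) (hat1 c) = inner (hat2 (eps x \o b)) (hat2 c).
Hypothesis hat1_total : forall x, N1 x -> forall e : R, 0 < e ->
  exists2 b, N2 b & nrm (hat1 x - hat1 (x \o b)) < e.
Hypothesis hat2_faithful : forall a, A2 a -> (forall b, N2 b -> hat2 (a \o b) = 0) -> a = 0.

Let pi1 := lreg N1 hat1.
Let pi2 := lreg N2 hat2.
Let U : H2 -> H1 := the_bop [set T | forall b, N2 b -> T (hat2 b) = hat1 b].
Let e : H1 -> H1 := U \o adj U.
Let E0 := [set pi1 a \o U | a in A1].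
Let J0 := [set pi1 a \o e \o pi1 b | a in A1 & b in A1].

Let n1 : normal_rep A1 pi1 := gns_rep v1 g1.
Let n2 : normal_rep A2 pi2 := gns_rep v2 g2.
Let p1h a b : A1 a -> N1 b -> pi1 a (hat1 b) = hat1 (a \o b).
Proof. exact: (lreg_hat v1 g1). Qed.
Let p2h a b : A2 a -> N2 b -> pi2 a (hat2 b) = hat2 (a \o b).
Proof. exact: (lreg_hat v2 g2). Qed.
Let p1b := rep_bop n1.
Let p2b := rep_bop n2.
Let p1c := rep_comp n1.
Let p1a := rep_adj n1.

Lemma hat_N2 b c : N2 b -> N2 c -> inner (hat1 b) (hat1 c) = inner (hat2 b) (hat2 c).
Proof.
move=> Nb Nc; have A2id := vn_id v2.
by rewrite -[b]/(id \o b) hat_eps // ?(eps_fix ceps) //; exact: vn_id.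
Qed.

Lemma inclusionP : [/\ bop U, forall x y, inner (U x) (U y) = inner x y &
  forall b, N2 b -> U (hat2 b) = hat1 b].
Proof.
have [||T [bT iT hT]] := @extend_isometry R H2 H1 [set (hat2 b, hat1 b) | b in N2].
- by move=> _ _ [b Nb <-] [c Nc <-] /=; rewrite hat_N2.
- by rewrite image_comp; exact: (dense_lspan_hat g2).
have hT' b : N2 b -> T (hat2 b) = hat1 b.
  by move=> Nb; apply: (hT (hat2 b, hat1 b)); exists b.
have [bU hU] : bop U /\ forall b, N2 b -> U (hat2 b) = hat1 b.
  exact: (@the_bopP R H2 H1 _ T bT hT').
by split=> //; have -> : U = T by apply: (hat_ext g2) => // b Nb; rewrite hU ?hT'.
Qed.
Let bU : bop U. Proof. by case: inclusionP. Qed.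
Let iU x y : inner (U x) (U y) = inner x y. Proof. by case: inclusionP => _ h _; exact: h. Qed.
Let hU b : N2 b -> U (hat2 b) = hat1 b. Proof. by case: inclusionP => _ _; apply. Qed.
Let bU' : bop (adj U) := adj_bop bU.
Let be : bop e := bop_comp bU bU'.
Let UK x : adj U (U x) = x := iso_adjK bU iU x.

(** The identity U^* x U = eps x of the Jones construction, with
    [inclusion_comm], is all that the algebra of E rests on. *)
Lemma inclusion_eps x : A1 x -> adj U \o (pi1 x \o U) = pi2 (eps x).
Proof.
move=> Ax; have Aex : A2 (eps x) by exact: (eps_in ceps).
apply: (hat_ext g2); [|exact: p2b|move=> b Nb].
  by apply: bop_comp => //; apply: bop_comp => //; exact: p1b.
apply: (hat_inner_ext g2) => c Nc.
rewrite /= -rin_adj // !hU // p1h ?p2h //; last exact: N21.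
by rewrite rinC [RHS]rinC /rin hat_eps.
Qed.

Lemma inclusion_comm b : A2 b -> pi1 b \o U = U \o pi2 b.
Proof.
move=> Ab; have Ab1 := A21 Ab.
apply: (hat_ext g2); [|by apply: bop_comp => //; exact: p2b|move=> c Nc].
  by apply: bop_comp => //; exact: p1b.
have Nbc : N2 (b \o c) by exact: (gns_ideal g2).
by rewrite /= hU // p1h ?p2h ?hU //; exact: N21.
Qed.

Lemma inclusion_nrm x : `|U x| = `|x|.
Proof. by rewrite !nrmE (iso_nrm iU). Qed.

Lemma jones_projection : orth_projection (closure (hat1 @` N2)) e.
Proof.
move=> x; split.
  apply/closureP => f f0; have [b Nb hb] := hat_dense g2 (adj U x) f0.
  exists (hat1 b); first by exists b.
  by rewrite -(hU Nb) /e /= -(linB _ _ (bop_lin bU)) (iso_nrm iU).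
move=> y My; have ey : U (adj U y) = y.
  apply: (iso_range bU iU); apply/closureP => f f0; move/closureP: My => /(_ f f0)[_ [b Nb <-] h].
  by exists (hat1 b) => //; exists (hat2 b) => //; exact: hU.
by rewrite -ey -(inner_adjr _ _ bU) (linB _ _ (bop_lin bU')) /e /= UK subrr inner0l.
Qed.

Let E0b : E0 `<=` @bop R H2 H1.
Proof. by move=> _ [a Aa <-]; apply: bop_comp => //; exact: p1b. Qed.
Let J0b : J0 `<=` @bop R H1 H1.
Proof. by move=> _ [a Aa [b Ab <-]]; exact: (bop_comp (bop_comp (p1b Aa) be) (p1b Ab)). Qed.

Let adjE a : A1 a -> adj (pi1 a \o U) = adj U \o pi1 (adj a).
Proof. by move=> Aa; rewrite (adj_comp (p1b Aa) bU) -p1a. Qed.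

Lemma E0E0s : setcomp E0 (setadj E0) = J0.
Proof.
apply/seteqP; split.
  move=> _ [_ [a Aa <-] [_ [_ [b Ab <-] <-] <-]].
  exists a => //; exists (adj b); first exact: vn_adj.
  by rewrite adjE.
move=> _ [a Aa [b Ab <-]]; exists (pi1 a \o U); first by exists a.
have Ab' := vn_adj v1 Ab; exists (adj (pi1 (adj b) \o U)).
  by exists (pi1 (adj b) \o U) => //; exists (adj b).
by rewrite adjE // adjK //; exact: (vn_bop v1).
Qed.

Lemma E0sE0 : setcomp (setadj E0) E0 = pi2 @` A2.
Proof.
apply/seteqP; split.
  move=> _ [_ [_ [a Aa <-] <-] [_ [b Ab <-] <-]].
  have Aa' := vn_adj v1 Aa; have Aab := vn_comp v1 Aa' Ab.
  exists (eps (adj a \o b)); first exact: (eps_in ceps).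
  by rewrite -inclusion_eps // (p1c Aa' Ab) adjE.
move=> _ [c Ac <-]; have Aid := vn_id v1; have Ac1 := A21 Ac.
exists (adj (pi1 id \o U)); first by exists (pi1 id \o U) => //; exists id.
exists (pi1 c \o U); first by exists c.
by rewrite adjE // adj_id (rep_id n1) -{2}(eps_fix ceps Ac) -inclusion_eps.
Qed.

(** The product is pi1 (a eps (bc)) U, since U^* pi1 (bc) U = pi2 (eps (bc)). *)
Lemma triple_E0 a b c : A1 a -> A1 b -> A1 c ->
  E0 ((pi1 a \o U) \o (adj U \o pi1 b) \o (pi1 c \o U)).
Proof.
move=> Aa Ab Ac; have Abc := vn_comp v1 Ab Ac; have Aex := eps_in ceps Abc.
exists (a \o eps (b \o c)); first exact: (vn_comp v1 Aa (A21 Aex)).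
rewrite (p1c Aa (A21 Aex)) -[(_ \o _) \o U]/(pi1 a \o (pi1 (eps (b \o c)) \o U)).
by rewrite inclusion_comm // -inclusion_eps // (p1c Ab Ac).
Qed.

(** J0 is closed under products by [triple_E0].  If every pi1 a e pi1 b kills z,
    then z is orthogonal to every hat1 (x c) with c in N2, and these are total. *)
Lemma J0_id : wspan J0 id.
Proof.
apply: nondegenerate_id => //.
- move=> _ _ [a Aa [b Ab <-]] [c Ac [d Ad <-]].
  have [x Ax ex] := triple_E0 Aa Ab Ac.
  exists x => //; exists d => //; apply/funext => z.
  by have := congr1 (@^~ (adj U (pi1 d z))) ex.
- move=> _ [a Aa [b Ab <-]]; exists (adj b); first exact: vn_adj.
  exists (adj a); first exact: vn_adj.
  have b1 := p1b Aa; have b2 := p1b Ab.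
  by rewrite (adj_comp (bop_comp b1 be) b2) (adj_comp b1 be) (adj_comp bU bU') adjK // !p1a.
move=> z hz; apply: (hat_inner_ext g1) => x Nx; rewrite rin0r.
have Ax := N1A Nx; have Ax' := vn_adj v1 Ax; have Aid := vn_id v1.
have hc c : N2 c -> rin (hat1 (x \o c)) z = 0.
  move=> Nc; have : U (adj U (pi1 (adj x) z)) = 0.
    have /= := hz (pi1 id \o e \o pi1 (adj x)).
    by rewrite (rep_id n1); apply; exists id => //; exists (adj x) => //; rewrite (rep_id n1).
  move=> h; have h0 : adj U (pi1 (adj x) z) = 0.
    by rewrite -[LHS]UK h; exact: lin0 (bop_lin bU').
  rewrite -p1h //; last exact: N21.
  by rewrite (rin_adj _ _ (p1b Ax)) -(p1a Ax) -(hU Nc) (rin_adj _ _ bU) h0 rin0r.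
apply/eqP; rewrite -normr_le0; apply/ler_addgt0Pr => f f0; rewrite add0r.
have f1 : 0 < f / (nrm z + 1) by rewrite divr_gt0 // ltr_wpDl // nrm_ge0.
have [c Nc hx] := hat1_total Nx f1.
have -> : rin (hat1 x) z = rin (hat1 x - hat1 (x \o c)) z by rewrite rinDl rinNl hc // subr0.
apply: le_trans (rin_CS _ _) _.
move: hx; rewrite ltr_pdivlMr ?ltr_wpDl ?nrm_ge0 //.
have := nrm_ge0 (hat1 x - hat1 (x \o c)); lra.
Qed.

Lemma pi1_in_J a : A1 a -> wspan J0 (pi1 a).
Proof.
move=> Aa; have := wspan_comp (p1b Aa) (@bop_id R H1) J0b J0_id.
apply: wspan_mono => // _ [_ [b Ab [c Ac <-]] <-].
by exists (a \o b); [exact: vn_comp|exists c => //; rewrite (p1c Aa Ab)].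
Qed.

Lemma pi2_inj a : A2 a -> pi2 a = 0 -> a = 0.
Proof.
move=> Aa h; apply: hat2_faithful => // b Nb.
by rewrite -p2h // -/pi2 h.
Qed.

(** E0^* E0 is the image of A2 under pi2, which is already weakly closed. *)
Lemma EsE : wspan (setcomp (setadj (wspan E0)) (wspan E0)) = pi2 @` A2.
Proof.
rewrite setadj_wspan // wspan_setcomp_eq //; last exact: setadj_bop.
by rewrite E0sE0; exact: (rep_closed v2 n2 pi2_inj).
Qed.

Lemma EEs : wspan (setcomp (wspan E0) (setadj (wspan E0))) = wspan J0.
Proof.
by rewrite setadj_wspan // wspan_setcomp_eq ?E0E0s //; exact: setadj_bop.
Qed.

Lemma inclusion_bimodule : hilbert_vN_bimodule A1 A2 (BimoduleData (wspan E0) pi1 pi2).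
Proof.
have E0sb := setadj_bop E0b.
split=> /=; [by rewrite wspan_id| | |].
- move=> _ [_ [S ES [T' [T ET <-] <-]] [T2 ET2 <-]].
  have w1 : wspan (setcomp E0 (setadj E0)) (S \o adj T).
    apply: wspan_setcomp => //; exists S => //; exists (adj T) => //.
    by rewrite -setadj_wspan //; exists T.
  have : wspan (setcomp (setcomp E0 (setadj E0)) E0) ((S \o adj T) \o T2).
    by apply: wspan_setcomp => //; [exact: setcomp_bop|exists (S \o adj T) => //; exists T2].
  apply: wspan_mono => // _ [_ [_ [a Aa <-] [_ [_ [b Ab <-] <-] <-]] [_ [c Ac <-] <-]].
  by rewrite adjE //; apply: triple_E0 => //; exact: vn_adj.
- rewrite EsE; have bim : pi2 @` A2 `<=` @bop R H2 H2 by move=> _ [a Aa <-]; exact: p2b.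
  have him a : A2 a -> (pi2 @` A2) (pi2 a) by move=> Aa; exists a.
  split; [exact: (rep_star_hom n2 him)|split=> //|exact: (rep_normal_map v2 n2 bim him)].
  move=> a b /set_mem Aa /set_mem Ab h; apply/eqP; rewrite -subr_eq0; apply/eqP.
  apply: pi2_inj; first exact: vnB.
  by rewrite (repB v2 n2) // h subrr.
- rewrite EEs; split; [exact: (rep_star_hom n1 pi1_in_J)| |by move=> T _; rewrite (rep_id n1)].
  exact: (rep_normal_map v1 n1 (@wspan_bop _ _ _ J0) pi1_in_J).
Qed.

Section Stinespring.
Variables (L1 L2 : hilbertType R) (tens : (K -> K) -> (K -> K) -> L1) (hat : (K -> K) -> L2).
Hypothesis tens_inner : forall a1 b1 a2 b2, A1 a1 -> A1 b1 -> N2 a2 -> N2 b2 ->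
  inner (tens a1 a2) (tens b1 b2) = inner (hat2 (eps (adj b1 \o a1) \o a2)) (hat2 b2).
Hypothesis tens_dense : dense (lspan [set tens a b | a in A1 & b in N2]).
Hypothesis gh : gns A2 N2 hat.
Hypothesis hat_inner : forall b c, N2 b -> N2 c -> inner (hat b) (hat c) = inner (hat2 b) (hat2 c).

Let rho1 := fun a : K -> K => the_bop [set T : L1 -> L1 |
    forall b1 b2, A1 b1 -> N2 b2 -> T (tens b1 b2) = tens (a \o b1) b2].
Let rho2 := lreg N2 hat.
Let r2h a b : A2 a -> N2 b -> rho2 a (hat b) = hat (a \o b).
Proof. exact: (lreg_hat v2 gh). Qed.
Let V := the_bop [set T : L2 -> L1 | forall a2, N2 a2 -> T (hat a2) = tens id a2].

(** w1 sends tens a b to hat1 (a b) and w2 sends hat b to hat2 b; both preserve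
    inner products, and w1 has dense range because the hat1 (x b) with b in N2 are
    total.  They carry V to U and the Stinespring actions to pi1 and pi2. *)
Lemma stinespring_iso : bimodule_iso A1 A2
  (BimoduleData (wspan [set rho1 a \o V \o rho2 b | a in A1 & b in A2]) rho1 rho2)
  (BimoduleData (wspan E0) pi1 pi2).
Proof.
have Aid1 := vn_id v1; have Aid2 := vn_id v2.
have idl a b : A1 a -> N2 b -> N1 (a \o b).
  by move=> Aa Nb; apply: (gns_ideal g1) => //; exact: N21.
have [||w1 [bw1 iw1 hw1']] := @extend_isometry R L1 H1
    [set p | exists a b, [/\ A1 a, N2 b & p = (tens a b, hat1 (a \o b))]].
- move=> _ _ [a1 [a2 [Aa1 Na2 ->]]] [b1 [b2 [Ab1 Nb2 ->]]] /=.
  have Ab1' := vn_adj v1 Ab1; have Aab := vn_comp v1 Ab1' Aa1.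
  rewrite tens_inner // -hat_eps // -[_ \o a2]/(adj b1 \o (a1 \o a2)).
  by rewrite (hat_adj g1 Ab1') ?adjK //; [exact: (vn_bop v1)|exact: idl|exact: N21].
- suff -> : fst @` [set p | exists a b, [/\ A1 a, N2 b & p = (tens a b, hat1 (a \o b))]] =
     [set tens a b | a in A1 & b in N2] by [].
  apply/seteqP; split.
    by move=> _ [_ [a [b [Aa Nb ->]]] <-]; exists a => //; exists b.
  by move=> _ [a Aa [b Nb <-]]; exists (tens a b, hat1 (a \o b)) => //; exists a, b.
have hw1 a b : A1 a -> N2 b -> w1 (tens a b) = hat1 (a \o b).
  by move=> Aa Nb; apply: (hw1' (tens a b, hat1 (a \o b))); exists a, b.
have [||w2 [bw2 iw2 hw2']] := @extend_isometry R L2 H2 [set (hat b, hat2 b) | b in N2].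
- by move=> _ _ [b Nb <-] [c Nc <-] /=; rewrite hat_inner.
- by rewrite image_comp; exact: (dense_lspan_hat gh).
have hw2 b : N2 b -> w2 (hat b) = hat2 b.
  by move=> Nb; apply: (hw2' (hat b, hat2 b)); exists b.
have [u1 w1K] : unitary w1 /\ forall y, w1 (adj w1 y) = y.
  apply: dense_iso_unitary => // y f f0; have f2 : 0 < f / 2 by lra.
  have [x Nx hx] := hat_dense g1 y f2; have [b Nb hb] := hat1_total Nx f2.
  exists (tens x b); rewrite hw1 //; last exact: N1A.
  by apply: le_lt_trans (nrm_tri _ (hat1 x) _) _; lra.
have [u2 w2K] : unitary w2 /\ forall y, w2 (adj w2 y) = y.
  apply: dense_iso_unitary => // y f f0; have [b Nb hb] := hat_dense g2 y f0.
  by exists (hat b); rewrite hw2.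
have bw1' := adj_bop bw1; have bw2' := adj_bop bw2.
have Kw1 := iso_adjK bw1 iw1; have Kw2 := iso_adjK bw2 iw2.
have rho1P a : A1 a -> bop (rho1 a) /\ w1 \o rho1 a = pi1 a \o w1.
  move=> Aa; have ba := p1b Aa.
  have [||br hr] := @the_bopP R L1 L1 [set T : L1 -> L1 |
    forall b1 b2, A1 b1 -> N2 b2 -> T (tens b1 b2) = tens (a \o b1) b2]
    (adj w1 \o (pi1 a \o w1)).
  - by do 2!apply: bop_comp => //.
  - move=> b1 b2 Ab1 Nb2 /=; rewrite hw1 // p1h //; last exact: idl.
    have Aab := vn_comp v1 Aa Ab1.
    by rewrite -[a \o (b1 \o b2)]/((a \o b1) \o b2) -hw1 // Kw1.
  split=> //; apply: (bop_ext (bop_comp bw1 br) (bop_comp ba bw1) tens_dense).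
  move=> _ [b1 Ab1 [b2 Nb2 <-]] /=; have Aab := vn_comp v1 Aa Ab1.
  by rewrite hr // !hw1 // p1h //; exact: idl.
have [bV hV] : bop V /\ w1 \o V = U \o w2.
  have [||br hr] := @the_bopP R L2 L1 [set T : L2 -> L1 | forall a2, N2 a2 -> T (hat a2) = tens id a2]
    (adj w1 \o (U \o w2)).
  - by do 2!apply: bop_comp => //.
  - by move=> b Nb /=; rewrite hw2 // hU // -[b]/(id \o b) -hw1 // Kw1.
  have hV0 b : N2 b -> V (hat b) = tens id b by exact: hr.
  split=> //; apply: (hat_ext gh); [exact: bop_comp|exact: bop_comp|move=> b Nb /=].
  by rewrite hV0 // hw1 // hw2 // hU.
have rho2P b : A2 b -> bop (rho2 b) /\ w2 \o rho2 b = pi2 b \o w2.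
  move=> Ab; have br := lreg_bop v2 gh Ab; split=> //.
  apply: (hat_ext gh); [exact: bop_comp|by apply: bop_comp => //; exact: p2b|move=> c Nc /=].
  have Nbc := gns_ideal g2 Ab Nc.
  by rewrite r2h // !hw2 // p2h.
have Gb : [set rho1 a \o V \o rho2 b | a in A1 & b in A2] `<=` @bop R L2 L1.
  move=> _ [a Aa [b Ab <-]]; have [b1 _] := rho1P a Aa; have [b2 _] := rho2P b Ab.
  by apply: bop_comp => //; exact: bop_comp.
exists w1, w2; split=> //.
- by move=> a /rho1P[].
- by move=> b /rho2P[].
apply/seteqP; split=> /=.
- move=> X EX; exists (adj w1 \o X \o w2); last first.
    by apply/funext => z /=; rewrite w1K w2K.
  have := wspan_comp bw1' bw2 E0b EX; apply: wspan_mono => // _ [_ [a Aa <-] <-].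
  exists a => //; exists id => //; apply/funext => z /=.
  have [_ h1] := rho1P a Aa.
  have e1 u : rho1 a u = adj w1 (pi1 a (w1 u)).
    by rewrite -[LHS]Kw1; congr (adj w1 _); exact: (congr1 (@^~ u) h1).
  have e2 u : w1 (V u) = U (w2 u) by exact: (congr1 (@^~ u) hV).
  have -> : rho2 id z = z by have := rep_id (gns_rep v2 gh) => /(congr1 (@^~ z)).
  by rewrite e1 e2.
move=> _ [X EX <-]; have := wspan_comp bw1 bw2' Gb EX.
apply: wspan_mono => // _ [_ [a Aa [b Ab <-]] <-].
have Ab1 := A21 Ab; exists (a \o b); first exact: vn_comp.
have [_ h1] := rho1P a Aa; have [_ h2] := rho2P b Ab.
apply/funext => z; rewrite (p1c Aa Ab1) /=.
have -> : w1 (rho1 a (V (rho2 b (adj w2 z)))) = pi1 a (w1 (V (rho2 b (adj w2 z)))).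
  exact: (congr1 (@^~ _) h1).
have -> : w1 (V (rho2 b (adj w2 z))) = U (w2 (rho2 b (adj w2 z))) by exact: (congr1 (@^~ _) hV).
have -> : w2 (rho2 b (adj w2 z)) = pi2 b (w2 (adj w2 z)) by exact: (congr1 (@^~ _) h2).
rewrite w2K; congr (pi1 a _); exact: (congr1 (@^~ z) (inclusion_comm Ab)).
Qed.
End Stinespring.
End Inclusion.

(** * Inclusions with a conditional expectation *)

Section Core.
Variables (R : realType) (K : hilbertType R) (A1 A2 : set (K -> K)).
Variable eps : (K -> K) -> (K -> K).
Hypotheses (v1 : von_neumann A1) (v2 : von_neumann A2) (A21 : A2 `<=` A1).
Hypotheses (ceps : cond_expectation A1 A2 eps) (neps : normal_map A1 A2 eps).

(** What the theorem uses of the state or weight phi2, for any realization of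
    the two L^2 spaces. *)
Definition L2_system (phi2 : functional K) : Prop :=
  let phi1 := comp_functional phi2 eps in
  let N1 := sq_integrable A1 phi1 in
  let N2 := sq_integrable A2 phi2 in
  [/\ N1 `<=` A1 /\ N2 `<=` N1,
      forall (H : hilbertType R) (hat : (K -> K) -> H), is_L2 A1 phi1 hat ->
        gns A1 N1 hat /\ (forall x, N1 x -> forall e : R, 0 < e ->
          exists2 b, N2 b & nrm (hat x - hat (x \o b)) < e),
      forall (H : hilbertType R) (hat : (K -> K) -> H), is_L2 A2 phi2 hat ->
        gns A2 N2 hat /\
        (forall a, A2 a -> (forall b, N2 b -> hat (a \o b) = 0) -> a = 0) &
      forall x b c, A1 x -> N2 b -> N2 c ->
        value A1 phi1 (adj c \o (x \o b)) = value A2 phi2 (adj c \o (eps x \o b))].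

Lemma state_L2_system f : faithful_normal_state A2 f -> L2_system (State f).
Proof.
move=> [lf pf f1 ff nf]; have nf2 : normal_state A2 f by [].
have nf1 := normal_state_comp v1 ceps neps nf2.
split.
- by split.
- move=> H hat hL; split; first exact: (gns_state v1 nf1 hL).
  by move=> x Ax e e0; exists id; [exact: vn_id|rewrite subrr nrm0].
- move=> H hat hL; split; first exact: (gns_state v2 nf2 hL).
  move=> a Aa ha; have ba := vn_bop v2 Aa; have Aid := vn_id v2.
  have [_ hh _] := hL; have := hh a a Aa Aa.
  have -> : hat a = 0 by rewrite -[a]/(a \o id) ha.
  rewrite inner0l => /esym h.
  have aa0 := ff _ (vn_comp v2 (vn_adj v2 Aa) Aa) (pos_adj_comp ba) h.
  apply/funext => u; apply: rin_eq0; rewrite -rin_adjr //.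
  by have := congr1 (fun g => rin (g u) u) aa0 => /= ->; exact: rin0l.
- move=> x b c Ax Ab Ac; rewrite /= (eps_mod ceps) //; exact: vn_adj.
Qed.

Lemma weight_L2_system w : faithful_normal_semifinite_weight A2 w -> L2_system (Weight w).
Proof.
move=> [[w0 wD wZ] wf ws wfin]; have nw : normal_weight A2 w by [].
have nw1 := normal_weight_comp v1 v2 ceps neps nw.
split.
- by split; [move=> a []|exact: (sqint_sub v2 A21 ceps)].
- move=> H hat hL; split; first exact: (gns_weight v1 nw1 hL).
  exact: (hat_approx v1 v2 A21 ceps neps nw hL).
- move=> H hat hL; split; first exact: (gns_weight v2 nw hL).
  exact: (weight_faithful v2 nw wf wfin hL).
- move=> x b c Ax Nb Nc; have sub := sqint_sub (w := w) v2 A21 ceps.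
  have Nxb := sqint_ideal v1 nw1 Ax (sub _ Nb).
  rewrite (value_weight_comp v1 v2 ceps neps nw).
    by rewrite (eps_mod ceps) //; [exact/(vn_adj v2)/(sqint_A Nc)|exact: (sqint_A Nb)].
  exact: (sqint_span v1 nw1 Nxb (sub _ Nc)).
Qed.
End Core.

Local Close Scope complex_scope.

Theorem mainTheorem6 (R : realType) (K : hilbertType R) (A1 A2 : set (K -> K))
    (eps : (K -> K) -> (K -> K)) (phi2 : functional K)
    (H1 H2 : hilbertType R) (hat1 : (K -> K) -> H1) (hat2 : (K -> K) -> H2) :
  von_neumann A1 -> von_neumann A2 -> A2 `<=` A1 ->
  cond_expectation A1 A2 eps -> faithful_map A1 eps -> normal_map A1 A2 eps ->
  faithful_normal A2 phi2 ->
  let phi1 := comp_functional phi2 eps in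
  is_L2 A1 phi1 hat1 -> is_L2 A2 phi2 hat2 ->
  let pi1 := left_regular A1 phi1 hat1 in
  let pi2 := left_regular A2 phi2 hat2 in
  let U := L2_inclusion A2 phi2 hat1 hat2 in
  let e := U \o adj U in
  let E0 := [set pi1 a \o U | a in A1] in
  let E := wspan E0 in
  let X := BimoduleData E pi1 pi2 in
  let Jones := wspan [set pi1 a \o e \o pi1 b | a in A1 & b in A1] in
  [/\ forall x, `|U x| = `|x|,
      orth_projection (closure (hat1 @` sq_integrable A2 phi2)) e,
      hilbert_vN_bimodule A1 A2 X,
      wspan (setcomp E0 (setadj E0)) = Jones /\
      wspan (setcomp E (setadj E)) = Jones &
      forall (L1 L2 : hilbertType R) (tens : (K -> K) -> (K -> K) -> L1)
          (hat : (K -> K) -> L2),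
        is_stinespring_space A1 A2 eps phi2 tens -> is_L2 A2 phi2 hat ->
        bimodule_iso A1 A2 (stinespring_bimodule A1 A2 phi2 tens hat) X].
Proof.
move=> v1 v2 A21 ceps _ neps fn phi1 hL1 hL2 pi1 pi2 U e E0 E X Jones.
have [[N1A N21] sys1 sys2 val] : L2_system A1 A2 eps phi2.
  by case: phi2 fn {phi1 hL1 hL2 pi1 pi2 U e E0 E X Jones} => [f|w] fn;
    [exact: state_L2_system|exact: weight_L2_system].
have [g1 tot] := sys1 _ _ hL1; have [g2 faith] := sys2 _ _ hL2.
have [_ hh1 _] := hL1; have [_ hh2 _] := hL2.
have heps x b c : A1 x -> sq_integrable A2 phi2 b -> sq_integrable A2 phi2 c ->
    inner (hat1 (x \o b)) (hat1 c) = inner (hat2 (eps x \o b)) (hat2 c).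
  move=> Ax Nb Nc; rewrite hh1; [|exact/(gns_ideal g1 Ax)/N21|exact: N21].
  by rewrite hh2 //; [exact: val|apply: (gns_ideal g2) => //; exact: (eps_in ceps)].
split.
- exact: (inclusion_nrm v1 v2 ceps g2 heps).
- exact: (jones_projection v1 v2 ceps g2 heps).
- exact: (inclusion_bimodule v1 v2 A21 ceps g1 g2 N1A N21 heps tot faith).
- split; first by rewrite /E0 (E0E0s v1 v2 ceps g1 g2 heps).
  exact: (EEs v1 v2 ceps g1 g2 heps).
- move=> L1 L2 tens hat [_ _ hti dt] hL; have [gh _] := sys2 _ _ hL.
  have [_ hh _] := hL.
  apply: (stinespring_iso v1 v2 A21 ceps g1 g2 N1A N21 heps tot _ dt gh).
    move=> a1 b1 a2 b2 Aa1 Ab1 Na2 Nb2; rewrite hti // hh2 //.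
    apply: (gns_ideal g2) => //; apply: (eps_in ceps).
    exact: (vn_comp v1 (vn_adj v1 Ab1) Aa1).
  by move=> b c Nb Nc; rewrite hh // hh2.
Qed.
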